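(* For every admissible pair of integers $(d,k_0)$ there exists an integer $\ell$, depending only on $d$ and $k_0$ (equivalently, on the type $d$ and the essential type $d-k_0$), such that the following holds. Let $M\subset\mathbb C^2$ be a smooth pseudoconvex hypersurface of finite type $d$ and essential type $d-k_0$ whose defining function at $p=0\in M$ is of the admissible form described in the context, and let $M'\subset\mathbb C^2$ be a real hypersurface. Then the germs at $p$ of biholomorphisms $H$ such that $H(M)=M'$ are uniquely determined by their $\ell$-jet at $p$; that is, if $H_1,H_2$ are two such germs with the same $\ell$-jet at $p$, then $H_1=H_2$.
   Context: Admissible pairs: integers with $d$ even and $d/2\le k_0\le d-1$. Admissible form of the defining function at $0$: near $0$, $M=\{r=0\}$ with $r$ real-valued of class $\mathcal C^{d/2+k_0+5}$ and $$r(z,w)=-\mathrm{Re}\,w+P(z,\overline z)+\sum_{i+j=d+1}z^i\overline z^j r_{ij0}(z)+\sum_{l=1}^{d-1}\sum_{i+j=d-l}z^i\overline z^j(\mathrm{Im}\, w)^l r_{ijl}(z,\mathrm{Im}\, w)+\theta_1(\mathrm{Im}\, w),$$ where $P(z,\overline z)=\sum_{j=d-k_0}^{k_0}\alpha_jz^j\overline z^{d-j}$, $\alpha_j=\overline{\alpha_{d-j}}$, $\alpha_{k_0}\neq0$, is a subharmonic homogeneous polynomial with $\{z:P_{z\overline z}(z,\overline z)=0\}=\{0\}$, and $r_{ij0}$, $r_{ijl}$ (complex-valued) and $\theta_1$ (real-valued) are functions of class $\mathcal C^{k_0-d/2+5}$ near the origin with $\theta_1(\mathrm{Im}\, w)=O(|\mathrm{Im}\,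 w|^2)$. For such $M$, the type (D'Angelo type) at $0$ is $d$ and the essential type is the integer $d-k_0$. *)

(* Defs.v *)
(* MathComp-Analysis, over an abstract realType; complex numbers are R[i]. *)
From mathcomp Require Import all_boot all_order all_algebra.
From mathcomp.real_closed Require Import complex.
From mathcomp Require Import all_classical all_reals all_analysis.
Import Order.TTheory GRing.Theory Num.Theory.
Import numFieldNormedType.Exports.

Set Implicit Arguments.
Unset Strict Implicit.
Unset Printing Implicit Defensive.

Local Open Scope classical_set_scope.
Local Open Scope ring_scope.
Local Open Scope complex_scope.

(* R[i] as a bundled field, so that it carries the topology and norm that
   MathComp-Analysis puts on any numFieldType; [differentiable] on normed
   modules over CC R is then complex differentiability. *)
Definition CC (R : realType) : numClosedFieldType := R[i].
Definition CC2 (R : realType) : normedModType (CC R) := (CC R * CC R)%type.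

Section Defs.
Variable R : realType.
Local Notation C := (CC R).
Local Notation C2 := (CC2 R).

(* Class C^k on an open subset U of a finite-dimensional V: all iterated
   directional derivatives up to order k exist and are continuous on U. *)
Fixpoint class_C (V W : normedModType R) (k : nat) (U : set V) (f : V -> W)
    {struct k} : Prop :=
  (forall x, U x -> {for x, continuous f}) /\
  if k is k'.+1 then
    forall v : V, (forall x, U x -> derivable f x v) /\ class_C k' U ('D_v f)
  else True.

Definition class_C_near0 (V W : normedModType R) (k : nat) (f : V -> W) : Prop :=
  exists2 U : set V, open U /\ U 0 & class_C k U f.

Definition cR (x : R) : C := x%:C.
Definition ofR2 (x : R * R) : C := x.1 +i* x.2.
Definition ofR4 (x : (R * R) * (R * R)) : C2 := (ofR2 x.1, ofR2 x.2).

(* Real directional derivatives, and Wirtinger derivatives along e: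
   for e = (1, 0), [dz e f] and [dzb e f] are f_z and f_{\bar z}. *)
Section Wirtinger.
Variable V : normedModType C.

Definition rderive (u : V -> R) (v x : V) : R :=
  'D_1 (fun t : R => u (x + cR t *: v)) 0.

Definition rderiveC (f : V -> C) (v x : V) : C :=
  rderive (fun y => complex.Re (f y)) v x +i* rderive (fun y => complex.Im (f y)) v x.

Definition dz (e : V) (f : V -> C) (x : V) : C :=
  (rderiveC f e x - ('i : C) * rderiveC f (('i : C) *: e) x) / 2.

Definition dzb (e : V) (f : V -> C) (x : V) : C :=
  (rderiveC f e x + ('i : C) * rderiveC f (('i : C) *: e) x) / 2.

End Wirtinger.

Definition e1 : C2 := (1, 0).
Definition e2 : C2 := (0, 1).

Definition toC (T : Type) (u : T -> R) : T -> C := fun x => cR (u x).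

Definition defining_on (k : nat) (M U : set C2) (rho : C2 -> R) : Prop :=
  [/\ open U,
      class_C k [set x | U (ofR4 x)] (rho \o ofR4),
      (forall q, U q -> (M q <-> rho q = 0)) &
      (forall q, U q -> M q -> exists v : C2, rderive rho v q != 0)].

Definition real_hypersurface (k : nat) (M : set C2) : Prop :=
  forall p, M p -> exists U rho, U p /\ defining_on k M U rho.

Definition levi_form (rho : C2 -> R) (q t : C2) : C :=
  let L e e' := dz e (dzb e' (toC rho)) q in
  L e1 e1 * t.1 * Num.conj t.1 + L e1 e2 * t.1 * Num.conj t.2 +
  L e2 e1 * t.2 * Num.conj t.1 + L e2 e2 * t.2 * Num.conj t.2.

(* One side {rho < 0} of M is pseudoconvex near each point of M. *)
Definition pseudoconvex (M : set C2) : Prop :=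
  forall p, M p -> exists U rho, [/\ U p, defining_on 2 M U rho &
    forall q t, U q -> M q ->
      dz e1 (toC rho) q * t.1 + dz e2 (toC rho) q * t.2 = 0 ->
      0 <= levi_form rho q t].

Definition holomorphic_on (V W : normedModType C) (U : set V) (f : V -> W) :
    Prop :=
  open U /\ forall x, U x -> differentiable f x.

Definition vanish_order_ge (V : normedModType C) (g : C -> V) (m : nat) : Prop :=
  g =O_ (0 : C) (fun x => x ^+ m).

Definition vanish_order (V : normedModType C) (g : C -> V) (m : nat) : Prop :=
  vanish_order_ge g m /\ ~ vanish_order_ge g m.+1.

(* D'Angelo's quotients nu(rho o gamma) / nu(gamma), over the germs of
   nonconstant holomorphic curves gamma with gamma 0 = p; taking every m with
   nu(rho o gamma) >= m covers curves with infinite order of contact. *)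
Definition contact_quotients (rho : C2 -> R) (p : C2) : set (\bar R) :=
  [set q | exists (gamma : C -> C2) (W : set C) (n m : nat),
    [/\ W 0 /\ holomorphic_on W gamma, gamma 0 = p,
        vanish_order (fun x => gamma x - p) n,
        vanish_order_ge (toC (rho \o gamma)) m &
        q = ((m%:R / n%:R : R)%:E)%E]].

(* Two C^1 defining functions of M are comparable near p, so they have the
   same contact quotients. *)
Definition dangelo_type (M : set C2) (p : C2) (tau : \bar R) : Prop :=
  exists U rho, [/\ U p, defining_on 1 M U rho &
    ereal_sup (contact_quotients rho p) = tau].

Definition subharmonic (u : C -> R) : Prop :=
  (forall z (c : R), u z < c -> \forall y \near z, u y < c) /\
  (forall (a : C) (rho : R), 0 < rho ->
     u a <= (2 * pi)^-1 *
       Rintegral lebesgue_measure `[0, 2 * pi]%classic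
         (fun t : R => u (a + cR rho * (cos t +i* sin t : C)))).

Definition admissible_poly (d k0 : nat) (alpha : nat -> C) (z : C) : C :=
  \sum_(d - k0 <= j < k0.+1) alpha j * z ^+ j * Num.conj z ^+ (d - j).

(* The essential type of M at 0 is by definition the integer d - k0 read off
   such a form, i.e. the least exponent of z occurring in P. *)
Definition admissible_form (d k0 : nat) (M : set C2) : Prop :=
  exists (U : set C2) (r : C2 -> R) (alpha : nat -> C)
         (r0 : nat -> nat -> C -> C) (r1 : nat -> nat -> nat -> C -> R -> C)
         (theta1 : R -> R),
  let P := admissible_poly d k0 alpha in
  let k := (k0 - d./2 + 5)%N in
  [/\ [/\ U 0 & defining_on (d./2 + k0 + 5) M U r],
      [/\ (forall j, (d - k0 <= j <= k0)%N ->
             alpha j = Num.conj (alpha (d - j)%N)),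
          alpha k0 != 0,
          subharmonic (fun z => complex.Re (P z)) &
          [set z | dz (1 : C) (dzb (1 : C) P) z = 0] = [set 0]],
      [/\ (forall i j, (i + j = d.+1)%N ->
             class_C_near0 k (fun x : R * R => complex.Re (r0 i j (ofR2 x))) /\
             class_C_near0 k (fun x : R * R => complex.Im (r0 i j (ofR2 x)))),
          (forall i j l, (1 <= l <= d.-1)%N -> (i + j = d - l)%N ->
             class_C_near0 k
               (fun x : R * R * R => complex.Re (r1 i j l (ofR2 x.1) x.2)) /\
             class_C_near0 k
               (fun x : R * R * R => complex.Im (r1 i j l (ofR2 x.1) x.2))),
          class_C_near0 k theta1 &
          theta1 =O_ (0 : R) (fun t => t ^+ 2)] &
      forall z w : C, U (z, w) ->
        cR (r (z, w)) =
          - cR (complex.Re w) + P z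
          + \sum_(i < d.+2)
              z ^+ i * Num.conj z ^+ (d.+1 - i) * r0 i (d.+1 - i)%N z
          + \sum_(1 <= l < d) \sum_(i < (d - l).+1)
              z ^+ i * Num.conj z ^+ (d - l - i) * cR (complex.Im w) ^+ l
                * r1 i (d - l - i)%N l z (complex.Im w)
          + cR (theta1 (complex.Im w))].

(* H represents a germ at p of a biholomorphism with H(M) = M' as germs. *)
Definition biholomorphism_germ (p : C2) (M M' : set C2) (H : C2 -> C2) : Prop :=
  exists (U : set C2) (G : C2 -> C2),
  [/\ U p, holomorphic_on U H, holomorphic_on (H @` U) G,
      (forall x, U x -> G (H x) = x) &
      H @` (M `&` U) = M' `&` (H @` U)].

Definition same_jet (l : nat) (p : C2) (f g : C2 -> C2) : Prop :=
  forall a b : nat, (a + b <= l)%N ->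
    iter a (fun h => 'D_e1 h) (iter b (fun h => 'D_e2 h) f) p =
    iter a (fun h => 'D_e1 h) (iter b (fun h => 'D_e2 h) g) p.

End Defs.

Definition admissible_pair (d k0 : nat) : Prop :=
  ~~ odd d /\ (d./2 <= k0 < d)%N.

(* Main.v *)
Require Import Defs.
From mathcomp Require Import all_boot all_order all_algebra.
From mathcomp.real_closed Require Import complex.
From mathcomp Require Import all_classical all_reals all_analysis.
From mathcomp Require Import ring lra zify.
Import Order.TTheory GRing.Theory Num.Theory.
Import numFieldNormedType.Exports.

(** Let F be the germ of the inverse of H1 composed with H2.  It is holomorphic
    near 0, maps M into M, and F - id vanishes to order l + 1 at 0; the claim is
    that F = id.  Because F is holomorphic on a full neighbourhood of 0, one can
    compare leading terms directly.

    Give z weight 1 and w weight d.  If F = (z + f, w + g) is not the identity,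
    some coefficient of f or g is nonzero; let n be the least weight that occurs,
    where a monomial of g counts with its weight and a monomial of f with its
    weight plus d - 1.  Call F0 and G0 the corresponding weighted homogeneous
    parts.  M is the graph Re w = P + (terms of weight at least d + 1 with
    Lipschitz coefficients), so following a point of M and its image under F along
    the dilations (z, w) |-> (p z, p^d w), and dividing by p^n, gives in the limit
    Re G0 = 2 Re (P_z F0) on the model Re w = P(z, conj z): see
    [leading_identity].  The remainder of the defining function enters only
    through Lipschitz estimates, so finite smoothness of M is enough.

    A weighted homogeneous field of this kind is an infinitesimal automorphism of
    the model, and the model has none of large weight ([model_rigid]).  Indeed
    polarization turns the identity into a polynomial one in independent variables
    x, y, u replacing z, conj z, w.  As every monomial of P contains both z and
    conj z, putting y = 0 determines G0, comparing the coefficients of y^(d - k0)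
    determines F0, and the slice on which conj w vanishes gives a last relation
    that leaves only zero.  This needs n >= 3 d, which l = 3 d guarantees
    ([low_coefs]).

    The analytic input is that complex differentiable maps of two variables are
    sums of double power series with the expected derivatives
    ([biseries_exists]).  It is derived from a discrete form of Goursat's lemma
    ([goursat_block]) and of Cauchy's formula ([cauchy_avg]): averages over roots
    of unity replace contour integrals, and an ultrafilter limit of these averages
    ([circle_mean_exists]) provides a linear functional that can be iterated in
    the two variables. *)

Set Implicit Arguments.
Unset Strict Implicit.
Unset Printing Implicit Defensive.

Local Open Scope classical_set_scope.
Local Open Scope ring_scope.

(** * Complex moduli with real values *)

Section Modulus.
Variable R : realType.
Local Notation C := (CC R).

(** The norm of CC R takes its values in CC R, which is not totally ordered;
    estimates are made with this real-valued modulus instead. *)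
Definition modC (z : C) : R := complex.Re `|z|.

Lemma cRD (x y : R) : cR (x + y) = cR x + cR y.
Proof. exact: (rmorphD (real_complex R)). Qed.
Lemma cRN (x : R) : cR (- x) = - cR x.
Proof. exact: (rmorphN (real_complex R)). Qed.
Lemma cRB (x y : R) : cR (x - y) = cR x - cR y.
Proof. exact: (rmorphB (real_complex R)). Qed.
Lemma cRM (x y : R) : cR (x * y) = cR x * cR y.
Proof. exact: (rmorphM (real_complex R)). Qed.
Lemma cR0 : cR (0 : R) = 0. Proof. by []. Qed.
Lemma cR1 : cR (1 : R) = 1. Proof. by []. Qed.
Lemma cRX (x : R) n : cR (x ^+ n) = cR x ^+ n.
Proof. exact: (rmorphXn (real_complex R)). Qed.
Lemma cRV (x : R) : cR (x^-1) = (cR x)^-1.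
Proof. exact: (fmorphV (real_complex R)). Qed.
Lemma cRn n : cR (n%:R : R) = n%:R.
Proof. exact: (rmorph_nat (real_complex R)). Qed.
Lemma cR_inj (x y : R) : cR x = cR y -> x = y.
Proof. exact: (@complexI R). Qed.
Lemma cR_eq0 (x : R) : (cR x == 0) = (x == 0).
Proof. exact: (fmorph_eq0 (real_complex R)). Qed.
Lemma le_cR (x y : R) : (cR x <= cR y) = (x <= y).
Proof. exact: lecR. Qed.
Lemma lt_cR (x y : R) : (cR x < cR y) = (x < y).
Proof. exact: ltcR. Qed.

Lemma cR_modC (z : C) : cR (modC z) = `|z|.
Proof. by rewrite /modC /cR; apply: RRe_real; apply: normr_real. Qed.

Lemma modC_ge0 (z : C) : 0 <= modC z.
Proof. by rewrite -le_cR cR_modC normr_ge0. Qed.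
Lemma modC0 : modC 0 = 0.
Proof. by apply: cR_inj; rewrite cR_modC normr0. Qed.
Lemma modC1 : modC 1 = 1.
Proof. by apply: cR_inj; rewrite cR_modC normr1. Qed.
Lemma modC_eq0 (z : C) : (modC z == 0) = (z == 0).
Proof. by rewrite -cR_eq0 cR_modC normr_eq0. Qed.
Lemma modC_gt0 (z : C) : (0 < modC z) = (z != 0).
Proof. by rewrite lt_neqAle modC_ge0 andbT eq_sym modC_eq0. Qed.
Lemma modCD (x y : C) : modC (x + y) <= modC x + modC y.
Proof. by rewrite -le_cR cRD !cR_modC ler_normD. Qed.
Lemma modCM (x y : C) : modC (x * y) = modC x * modC y.
Proof. by apply: cR_inj; rewrite cRM !cR_modC normrM. Qed.
Lemma modCN (x : C) : modC (- x) = modC x.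
Proof. by rewrite /modC normrN. Qed.
Lemma modCB (x y : C) : modC (x - y) <= modC x + modC y.
Proof. by rewrite -(modCN y); apply: modCD. Qed.
Lemma modCV (x : C) : modC (x^-1) = (modC x)^-1.
Proof. by apply: cR_inj; rewrite cRV !cR_modC normfV. Qed.
Lemma modCX (x : C) n : modC (x ^+ n) = modC x ^+ n.
Proof. by apply: cR_inj; rewrite cRX !cR_modC normrX. Qed.
Lemma modC_cR (x : R) : modC (cR x) = `|x|.
Proof.
rewrite /modC normc_def /= expr0n /= addr0 sqrtr_sqr //.
Qed.
Lemma modC_nat n : modC (n%:R : C) = n%:R.
Proof. by rewrite -cRn modC_cR normr_nat. Qed.
Lemma modCJ (x : C) : modC (Num.conj x) = modC x.
Proof. by rewrite /modC norm_conjC. Qed.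
Lemma modC_sum (I : Type) (r : seq I) (P : pred I) (F : I -> C) :
  modC (\sum_(i <- r | P i) F i) <= \sum_(i <- r | P i) modC (F i).
Proof.
elim/big_rec2: _ => [|i y z _ h]; first by rewrite modC0.
by apply: (le_trans (modCD _ _)); rewrite lerD2l.
Qed.
Lemma modC_sub_ge (x y : C) : modC x - modC y <= modC (x - y).
Proof. by have := modCD (x - y) y; rewrite subrK; lra. Qed.

Lemma modC_Re (z : C) : `|complex.Re z| <= modC z.
Proof. by rewrite -le_cR cR_modC; apply: normc_ge_Re. Qed.

Lemma complex_decomp (z : C) : z = cR (complex.Re z) + 'i * cR (complex.Im z).
Proof. by rewrite -complexiE; apply: complexE. Qed.

Lemma modC_Im (z : C) : `|complex.Im z| <= modC z.
Proof.
rewrite /modC normc_def /= -sqrtr_sqr ler_wsqrtr // lerDr sqr_ge0 //.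
Qed.

Lemma modC_ReIm (z : C) : modC z <= `|complex.Re z| + `|complex.Im z|.
Proof.
rewrite {1}[z]complex_decomp; apply: (le_trans (modCD _ _)).
rewrite modCM !modC_cR lerD2l -[leRHS]mul1r ler_wpM2r //.
by rewrite -le_cR cR_modC normCi.
Qed.

Lemma Re_D (x y : C) : complex.Re (x + y) = complex.Re x + complex.Re y.
Proof. by case: x y => [a b] [c e]. Qed.
Lemma Im_D (x y : C) : complex.Im (x + y) = complex.Im x + complex.Im y.
Proof. by case: x y => [a b] [c e]. Qed.
Lemma Re_N (x : C) : complex.Re (- x) = - complex.Re x.
Proof. by case: x => [a b]. Qed.
Lemma Im_N (x : C) : complex.Im (- x) = - complex.Im x.
Proof. by case: x => [a b]. Qed.
Lemma Re_M (x y : C) :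
  complex.Re (x * y) = complex.Re x * complex.Re y - complex.Im x * complex.Im y.
Proof. by case: x y => [a b] [c e]. Qed.
Lemma Im_M (x y : C) :
  complex.Im (x * y) = complex.Re x * complex.Im y + complex.Im x * complex.Re y.
Proof. by case: x y => [a b] [c e]. Qed.
Lemma conjE (z : C) : Num.conj z = (complex.Re z -i* complex.Im z)%C.
Proof.
case: z => a b /=; rewrite [X in Num.conj X]complex_decomp /=.
rewrite rmorphD rmorphM /= conjCi.
have conj_seq x : Num.conj (cR x) = cR x by apply/CrealP; apply: Creal_Re || rewrite /cR complex_real.
rewrite !conj_seq /cR -complexiE; simpc; by [].
Qed.
Lemma addJ (z : C) : z + Num.conj z = 2 * cR (complex.Re z).
Proof. by rewrite conjE; case: z => a b; rewrite mulr_natl mulr2n /cR; simpc; congr (_ +i* _)%C; rewrite ?mulr2n ?subrr. Qed.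
Lemma conj_cR (x : R) : Num.conj (cR x) = cR x.
Proof. by rewrite conjE /= oppr0. Qed.

End Modulus.

(** * The mean value inequality and the unit circle *)

Section MeanValue.
Variable R : realType.

Lemma MVT_bound (g : R -> R) (K a b : R) :
  (forall s, Num.min a b <= s <= Num.max a b -> derivable g s 1 /\ `|'D_1 g s| <= K) ->
  `|g b - g a| <= K * `|b - a|.
Proof.
wlog ab : a b / a <= b.
  move=> H h; have [ab|ba] := leP a b; first exact: H.
  rewrite distrC (distrC b); apply: H; first exact: ltW.
  by rewrite minC maxC.
rewrite min_l // max_r // => h.
have hd s : s \in `]a, b[ -> is_derive (s : R) (1 : R) g ('D_1 g s).
  rewrite in_itv /= => /andP[s1 s2].
  by have [] := h s; rewrite ?(ltW s1) ?(ltW s2) //; split.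
have hc : {within `[a, b], continuous g}.
  apply: derivable_within_continuous => s; rewrite in_itv /= => sb.
  by have [] := h s sb.
have [c cb ->] := MVT_segment ab hd hc.
rewrite normrM ler_wpM2r //.
by have [] := h c _; rewrite in_itv /= in cb.
Qed.

End MeanValue.

Section Circle.
Variable R : realType.
Local Notation C := (CC R).

Definition circ (y : R) : C := (cos (2 * pi * y) +i* sin (2 * pi * y))%C.

Lemma circD (x y : R) : circ (x + y) = circ x * circ y.
Proof.
rewrite /circ mulrDr cosD sinD /=.
by rewrite /GRing.mul /=; congr (_ +i* _)%C; rewrite addrC.
Qed.

Lemma circ0 : circ 0 = 1.
Proof. by rewrite /circ mulr0 cos0 sin0. Qed.

Lemma circ1 : circ 1 = 1.
Proof. by rewrite /circ mulr1 mulr_natl cos2pi sin2pi. Qed.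

Lemma circ_half : circ 2^-1 = -1.
Proof.
rewrite /circ mulrAC mulfV ?pnatr_eq0 // mul1r cospi sinpi.
by rewrite -cR1 -cRN.
Qed.

Lemma modC_circ (y : R) : modC (circ y) = 1.
Proof. by rewrite /modC normc_def /= cos2Dsin2 sqrtr1. Qed.

Lemma circ_lip (x y : R) : modC (circ x - circ y) <= 4 * pi * `|x - y|.
Proof.
apply: (le_trans (modC_ReIm _)).
rewrite /circ Re_D Im_D Re_N Im_N /=.
have e : `|2 * pi * x - 2 * pi * y| = 2 * pi * `|x - y|.
  by rewrite -mulrBr normrM (ger0_norm (mulr_ge0 _ (pi_ge0 _))).
have h1 : `|cos (2 * pi * x) - cos (2 * pi * y)| <= 1 * `|2 * pi * x - 2 * pi * y|.
  apply: MVT_bound => t _; have ic := is_derive_cos t; split; first by case: ic.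
  by rewrite derive_val normrN ler_norml sin_geN1 sin_le1.
have h2 : `|sin (2 * pi * x) - sin (2 * pi * y)| <= 1 * `|2 * pi * x - 2 * pi * y|.
  apply: MVT_bound => t _; have ic := is_derive_sin t; split; first by case: ic.
  by rewrite derive_val ler_norml cos_geN1 cos_le1.
by rewrite e in h1 h2; move: h1 h2; lra.
Qed.

End Circle.

(** * A discrete form of Goursat's lemma *)

Section Goursat.
Variable R : realType.
Local Notation C := (CC R).

(** Complex differentiability, spelled with real moduli so that error terms can
    be added up in R. *)
Definition cdifferentiable (f : C -> C) (z : C) : Prop :=
  exists b : C, forall eps : R, 0 < eps -> exists2 del : R, 0 < del &
    forall z', modC (z' - z) < del ->
      modC (f z' - f z - b * (z' - z)) <= eps * modC (z' - z).

Variables (s : R) (w : C) (del : R).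
Hypotheses (ws : modC w < s) (del0 : 0 < del) (del1 : del < 1).

(** With sigma in [del, 1] and y in [0, 1], the point w + sigma * spoke y runs
    over the region between the circle of radius s about 0 and its image under the
    homothety of centre w and ratio del.  In these coordinates the form
    f(zeta) dzeta / (zeta - w) is f * (dsigma / sigma + dspoke / spoke). *)
Definition spoke (y : R) : C := cR s * circ y - w.
Definition dyadic (n j : nat) : R := j%:R / (2 ^ n)%:R.
Definition dilation (n i : nat) : R := del + (1 - del) * dyadic n i.
Definition grid_pt (n i j : nat) : C := w + cR (dilation n i) * spoke (dyadic n j).
(** The integral of that form around a cell of the 2^n by 2^n grid, replaced by
    left Riemann sums. *)
Definition grid_cell (g : C -> C) n i j : C :=
  (g (grid_pt n i j) - g (grid_pt n i j.+1)) * ((cR (dilation n i.+1) - cR (dilation n i)) / cR (dilation n i))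
  + (g (grid_pt n i.+1 j) - g (grid_pt n i j))
     * ((spoke (dyadic n j.+1) - spoke (dyadic n j)) / spoke (dyadic n j)).
Definition grid_block (g : C -> C) n i0 j0 m : C :=
  \sum_(i0 <= i < i0 + m) \sum_(j0 <= j < j0 + m) grid_cell g n i j.

Let s0 : 0 < s. Proof. exact: le_lt_trans (modC_ge0 _) ws. Qed.

Lemma spoke_ge (y : R) : s - modC w <= modC (spoke y).
Proof.
apply: le_trans (modC_sub_ge _ _).
by rewrite modCM modC_circ modC_cR (gtr0_norm s0) mulr1.
Qed.

Lemma spoke_neq0 (y : R) : spoke y != 0.
Proof. by rewrite -modC_gt0; apply: lt_le_trans (spoke_ge y); rewrite subr_gt0. Qed.

Lemma spoke_le (y : R) : modC (spoke y) <= 2 * s.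
Proof.
apply: (le_trans (modCB _ _)).
by rewrite modCM modC_circ modC_cR (gtr0_norm s0) mulr1; have := ws; lra.
Qed.

Lemma spoke_lip (x y : R) : modC (spoke x - spoke y) <= 4 * pi * s * `|x - y|.
Proof.
rewrite /spoke [X in modC X](_ : _ = cR s * (circ x - circ y)); last by ring.
rewrite modCM modC_cR (gtr0_norm s0) [leRHS](_ : _ = s * (4 * pi * `|x - y|)); last by ring.
by rewrite ler_pM2l //; apply: circ_lip.
Qed.

Lemma pow2_gt0 n : 0 < (2 ^ n)%:R :> R.
Proof. by rewrite ltr0n expn_gt0. Qed.

Lemma dyadicS n j : dyadic n j.+1 - dyadic n j = (2 ^ n)%:R^-1.
Proof. by rewrite /dyadic -mulrBl -[j.+1]addn1 natrD [j%:R + _]addrC addrK mul1r. Qed.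

Lemma dyadic_ge0 n j : 0 <= dyadic n j.
Proof. by rewrite divr_ge0. Qed.

Lemma dilation_ge n i : del <= dilation n i.
Proof. by rewrite lerDl mulr_ge0 ?dyadic_ge0 // subr_ge0 ltW. Qed.
Lemma dilation_gt0 n i : 0 < dilation n i.
Proof. exact: lt_le_trans del0 (dilation_ge _ _). Qed.

(** Here the increments of the two coordinates telescope exactly: affine
    functions contribute nothing on any cell, so that nothing is required of the
    derivative of f beyond its existence. *)
Lemma grid_cell_affine (a b z0 : C) n i j : grid_cell (fun z => a + b * (z - z0)) n i j = 0.
Proof.
rewrite /grid_cell /grid_pt.
have h1 : cR (dilation n i) != 0 by rewrite cR_eq0 gt_eqF // dilation_gt0.
have h2 := spoke_neq0 (dyadic n j).
by field; rewrite ?h1 ?h2.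
Qed.

Lemma grid_cellB g h n i j : grid_cell (fun z => g z - h z) n i j = grid_cell g n i j - grid_cell h n i j.
Proof. rewrite /grid_cell; ring. Qed.

Lemma grid_block_affine (g : C -> C) (a b z0 : C) n i j m :
  grid_block g n i j m = grid_block (fun z => g z - (a + b * (z - z0))) n i j m.
Proof.
apply: eq_bigr => k _; apply: eq_bigr => l _.
by rewrite (grid_cellB g (fun z => a + b * (z - z0))) grid_cell_affine subr0.
Qed.

(** Inner edges are counted twice with opposite signs. *)
Lemma grid_block_boundary g n i0 j0 m : grid_block g n i0 j0 m =
  \sum_(i0 <= i < i0 + m) (g (grid_pt n i j0) - g (grid_pt n i (j0 + m)))
     * ((cR (dilation n i.+1) - cR (dilation n i)) / cR (dilation n i))
  + \sum_(j0 <= j < j0 + m) (g (grid_pt n (i0 + m) j) - g (grid_pt n i0 j))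
     * ((spoke (dyadic n j.+1) - spoke (dyadic n j)) / spoke (dyadic n j)).
Proof.
rewrite /grid_block /grid_cell.
under eq_bigr do rewrite big_split /=.
rewrite big_split /=; congr (_ + _).
  apply: eq_bigr => i _; rewrite -mulr_suml; congr (_ * _).
  under eq_bigr do rewrite -opprB.
  by rewrite sumrN telescope_sumr ?leq_addr // opprB.
rewrite exchange_big /=; apply: eq_bigr => j _.
by rewrite -mulr_suml telescope_sumr ?leq_addr.
Qed.

Lemma dilationB n i : dilation n i.+1 - dilation n i = (1 - del) / (2 ^ n)%:R.
Proof. by rewrite /dilation opprD addrACA subrr add0r -mulrBr dyadicS. Qed.

Let K2 : R := 2 / del + 8 * pi * s / (s - modC w).

Lemma K2_ge0 : 0 <= K2.
Proof.
have h : 0 < s - modC w by rewrite subr_gt0.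
apply: addr_ge0; apply: divr_ge0; rewrite ?(ltW del0) ?(ltW h) //.
by rewrite mulr_ge0 ?(ltW s0) // mulr_ge0 ?pi_ge0.
Qed.

Lemma radial_weight_le n i : modC ((cR (dilation n i.+1) - cR (dilation n i)) / cR (dilation n i)) <= del^-1 / (2 ^ n)%:R.
Proof.
rewrite -cRB modCM modCV !modC_cR dilationB.
rewrite normrM (ger0_norm (_ : 0 <= 1 - del)) ?subr_ge0 ?(ltW del1) //.
rewrite (gtr0_norm (dilation_gt0 _ _)) (gtr0_norm (_ : 0 < (2 ^ n)%:R^-1)) ?invr_gt0 ?pow2_gt0 //.
rewrite [leLHS](_ : _ = ((1 - del) / dilation n i) / (2 ^ n)%:R); last by ring.
rewrite ler_pM2r ?invr_gt0 ?pow2_gt0 //.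
rewrite -[leRHS]mul1r ler_pM ?invr_ge0 ?(ltW (dilation_gt0 _ _)) //; try by move: del0 del1; lra.
by rewrite lef_pV2 ?posrE ?dilation_gt0 // dilation_ge.
Qed.

Lemma angular_weight_le n j : modC ((spoke (dyadic n j.+1) - spoke (dyadic n j)) / spoke (dyadic n j))
   <= (4 * pi * s / (s - modC w)) / (2 ^ n)%:R.
Proof.
rewrite modCM modCV mulrAC ler_pM ?invr_ge0 ?modC_ge0 //.
  by apply: (le_trans (spoke_lip _ _)); rewrite dyadicS gtr0_norm // invr_gt0 pow2_gt0.
have h : 0 < s - modC w by rewrite subr_gt0.
rewrite lef_pV2 ?posrE // ?modC_gt0 ?spoke_neq0 //; exact: spoke_ge.
Qed.

(** Only the 4 m boundary edges count, each with a weight of order 1 / 2^n. *)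
Lemma grid_block_le g n i0 j0 m eta :
  (forall i j, (i0 <= i <= i0 + m)%N -> (j0 <= j <= j0 + m)%N -> modC (g (grid_pt n i j)) <= eta) ->
  modC (grid_block g n i0 j0 m) <= eta * (m%:R / (2 ^ n)%:R) * K2.
Proof.
move=> h; rewrite grid_block_boundary.
have e0 : 0 <= eta.
  by apply: le_trans (h i0 j0 _ _); rewrite ?modC_ge0 // leqnn leq_addr.
apply: (le_trans (modCD _ _)).
rewrite [leRHS](_ : _ = (2 * eta * (del^-1 / (2 ^ n)%:R)) *+ m
   + (2 * eta * ((4 * pi * s / (s - modC w)) / (2 ^ n)%:R)) *+ m); last first.
  rewrite /K2 -[_ *+ m]mulr_natr -[X in _ = _ + X]mulr_natr.
  have h1 : 0 < s - modC w by rewrite subr_gt0.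
  field; rewrite (gt_eqF h1) (gt_eqF del0).
  by rewrite [in _ != _](gt_eqF (pow2_gt0 n)).
apply: lerD; apply: (le_trans (modC_sum _ _ _)).
  rewrite -[X in _ *+ X](addKn i0) -sumr_const_nat.
  apply: ler_sum_nat => i /andP[h1 h2].
  rewrite modCM ler_pM ?modC_ge0 ?radial_weight_le //.
  apply: (le_trans (modCB _ _)).
  have A1 : modC (g (grid_pt n i j0)) <= eta by apply: h; rewrite ?h1 ?(ltnW h2) ?leqnn ?leq_addr.
  have A2 : modC (g (grid_pt n i (j0 + m))) <= eta by apply: h; rewrite ?h1 ?(ltnW h2) ?leqnn ?leq_addr.
  by move: A1 A2; lra.
rewrite -[X in _ *+ X](addKn j0) -sumr_const_nat.
apply: ler_sum_nat => i /andP[h1 h2].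
rewrite modCM ler_pM ?modC_ge0 ?angular_weight_le //.
apply: (le_trans (modCB _ _)).
have A1 : modC (g (grid_pt n i0 i)) <= eta by apply: h; rewrite ?h1 ?(ltnW h2) ?leqnn ?leq_addr.
have A2 : modC (g (grid_pt n (i0 + m) i)) <= eta by apply: h; rewrite ?h1 ?(ltnW h2) ?leqnn ?leq_addr.
by move: A1 A2; lra.
Qed.

Lemma grid_block_split g n i j m :
  grid_block g n i j (m + m) =
  grid_block g n i j m + grid_block g n i (j + m) m + (grid_block g n (i + m) j m + grid_block g n (i + m) (j + m) m).
Proof.
rewrite /grid_block addnA (@big_cat_nat _ _ _ (i + m)) /= ?leq_addr //.
congr (_ + _); rewrite -big_split /=; apply: eq_bigr => k _;
  by rewrite addnA (@big_cat_nat _ _ _ (j + m)) /= ?leq_addr.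
Qed.

Lemma dyadic_limit (b : nat -> nat) :
  (forall k, (b k).*2 <= b k.+1 <= (b k).*2.+1)%N ->
  exists y : R, forall k, dyadic k (b k) <= y <= dyadic k (b k).+1.
Proof.
move=> h.
have st k : dyadic k (b k) <= dyadic k.+1 (b k.+1) /\ dyadic k.+1 (b k.+1).+1 <= dyadic k (b k).+1.
  have /andP[h1 h2] := h k.
  have e j : dyadic k j = dyadic k.+1 j.*2.
    rewrite /dyadic expnS -mul2n !natrM; field.
    by rewrite (gt_eqF (pow2_gt0 k)).
  have mono m j j' : (j <= j')%N -> dyadic m j <= dyadic m j'.
    by move=> jj; rewrite ler_pM2r ?invr_gt0 ?pow2_gt0 // ler_nat.
  rewrite !e; split; apply: mono => //.
have lo k m : dyadic k (b k) <= dyadic (k + m) (b (k + m)%N).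
  elim: m => [|m ih]; first by rewrite addn0.
  by rewrite addnS; apply: (le_trans ih); have [] := st (k + m)%N.
have hi k m : dyadic (k + m) (b (k + m)%N).+1 <= dyadic k (b k).+1.
  elim: m => [|m ih]; first by rewrite addn0.
  by rewrite addnS; apply: le_trans ih; have [] := st (k + m)%N.
have lh k : dyadic k (b k) <= dyadic k (b k).+1.
  by rewrite ler_pM2r ?invr_gt0 ?pow2_gt0 // ler_nat.
have lohi k m : dyadic k (b k) <= dyadic m (b m).+1.
  have [km|mk] := leqP k m.
    by rewrite -(subnKC km); apply: (le_trans (lo _ _)); exact: lh.
  rewrite -(subnKC (ltnW mk)); apply: le_trans (hi _ (k - m)%N); exact: lh.
pose S := range (fun k => dyadic k (b k)).
exists (sup S) => k; apply/andP; split.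
  apply: ub_le_sup; last by exists k.
  by exists (dyadic 0 (b 0).+1) => _ [m _ <-].
apply: ge_sup; first by exists (dyadic 0 (b 0)), 0%N.
by move=> _ [m _ <-].
Qed.

Variable f : C -> C.
Hypothesis hf : forall z, modC z <= s -> cdifferentiable f z.

Lemma grid_block_split_scale k r a b :
  grid_block f (k + r.+1) (a * 2 ^ r.+1) (b * 2 ^ r.+1) (2 ^ r.+1) =
  grid_block f (k.+1 + r) (a.*2 * 2 ^ r) (b.*2 * 2 ^ r) (2 ^ r)
  + grid_block f (k.+1 + r) (a.*2 * 2 ^ r) (b.*2.+1 * 2 ^ r) (2 ^ r)
  + (grid_block f (k.+1 + r) (a.*2.+1 * 2 ^ r) (b.*2 * 2 ^ r) (2 ^ r)
  + grid_block f (k.+1 + r) (a.*2.+1 * 2 ^ r) (b.*2.+1 * 2 ^ r) (2 ^ r)).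
Proof.
have e c : (c * 2 ^ r.+1 = c.*2 * 2 ^ r)%N by rewrite expnS -mul2n; lia.
have e' c : (c.*2.+1 * 2 ^ r = c.*2 * 2 ^ r + 2 ^ r)%N by lia.
have e2 : (2 ^ r.+1 = 2 ^ r + 2 ^ r)%N by rewrite expnS; lia.
by rewrite addnS -addSn !e !e' e2 grid_block_split.
Qed.

Section Bisect.
Variable eps : R.
Hypothesis eps0 : 0 < eps.

(** The bound is proportional to the area of the block and is asked of all its
    sufficiently fine subdivisions: this is what makes it additive. *)
Definition small_block (k : nat) (p : nat * nat) := exists r0, forall r, (r0 <= r)%N ->
  modC (grid_block f (k + r) (p.1 * 2 ^ r) (p.2 * 2 ^ r) (2 ^ r)) <= eps / (4 ^ k)%:R.

Definition child_block (p q : nat * nat) :=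
  ((p.1.*2 <= q.1 <= p.1.*2.+1) && (p.2.*2 <= q.2 <= p.2.*2.+1))%N.

Lemma bad_child_block k p : ~ small_block k p -> exists q, ~ small_block k.+1 q /\ child_block p q.
Proof.
move=> bad; apply: contrapT => hn; apply: bad.
have sm a b : child_block p (a, b) -> small_block k.+1 (a, b).
  by move=> h; apply: contrapT => h'; apply: hn; exists (a, b).
rewrite /child_block /= in sm.
have [|r1 h1] := sm p.1.*2 p.2.*2; first by lia.
have [|r2 h2] := sm p.1.*2 p.2.*2.+1; first by lia.
have [|r3 h3] := sm p.1.*2.+1 p.2.*2; first by lia.
have [|r4 h4] := sm p.1.*2.+1 p.2.*2.+1; first by lia.
exists (r1 + r2 + r3 + r4).+1 => -[//|r] hr.
rewrite grid_block_split_scale.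
have {}h1 := h1 r ltac:(lia); have {}h2 := h2 r ltac:(lia).
have {}h3 := h3 r ltac:(lia); have {}h4 := h4 r ltac:(lia).
have e4 : eps / (4 ^ k)%:R = (eps / (4 ^ k.+1)%:R) *+ 4.
  rewrite expnS natrM -mulr_natr; field.
  by rewrite pnatr_eq0 expn_eq0.
rewrite e4.
apply: (le_trans (modCD _ _)); have t1 := modCD (grid_block f (k.+1 + r) (p.1.*2 * 2 ^ r) (p.2.*2 * 2 ^ r) (2 ^ r)) (grid_block f (k.+1 + r) (p.1.*2 * 2 ^ r) (p.2.*2.+1 * 2 ^ r) (2 ^ r)).
have t2 := modCD (grid_block f (k.+1 + r) (p.1.*2.+1 * 2 ^ r) (p.2.*2 * 2 ^ r) (2 ^ r)) (grid_block f (k.+1 + r) (p.1.*2.+1 * 2 ^ r) (p.2.*2.+1 * 2 ^ r) (2 ^ r)).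
rewrite -[_ *+ 4]mulr_natr; move: h1 h2 h3 h4 t1 t2 => /=; lra.
Qed.

Lemma dyadic_scale k r j : dyadic (k + r) (j * 2 ^ r) = dyadic k j.
Proof.
rewrite /dyadic expnD !natrM; field.
by rewrite (gt_eqF (pow2_gt0 k)) (gt_eqF (pow2_gt0 r)).
Qed.

(** Otherwise a sequence of nested bad blocks shrinks to a point.  Subtracting
    from f its first-order expansion there does not change the sums, and what
    remains is negligible with respect to the area of the blocks. *)
Lemma goursat_block : small_block 0 (0%N, 0%N).
Proof.
apply: contrapT => bad0.
have [|nxt hn] := @choice _ _ (fun (x : nat * (nat * nat)) (q : nat * nat) =>
    ~ small_block x.1 x.2 -> ~ small_block x.1.+1 q /\ child_block x.2 q).
  move=> [k p] /=; have [sm|nsm] := pselect (small_block k p); first by exists p.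
  by have [q hq] := bad_child_block nsm; exists q.
pose fix q k := if k is k'.+1 then nxt (k', q k') else (0%N, 0%N).
have qb k : ~ small_block k (q k).
  by elim: k => [//|k ih] /=; have [] := hn (k, q k) ih.
have qc k : child_block (q k) (q k.+1) by have [] := hn (k, q k) (qb k).
have [|x hx] := @dyadic_limit (fun k => (q k).1).
  by move=> k; have /andP[] := qc k.
have [|y hy] := @dyadic_limit (fun k => (q k).2).
  by move=> k; have /andP[] := qc k.
pose sgx := del + (1 - del) * x.
have x01 : 0 <= x <= 1.
  by have := hx 0%N; rewrite /dyadic /= !divr1.
have sg01 : del <= sgx <= 1.
  move: x01 => /andP[a1 a2].
  have p1 : 0 <= (1 - del) * x by rewrite mulr_ge0 // subr_ge0 ltW.
  have p2 : 0 <= (1 - del) * (1 - x) by rewrite mulr_ge0 // subr_ge0 // ltW.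
  by rewrite /sgx; apply/andP; split; move: p1 p2; lra.
have zs : modC (w + cR sgx * spoke y) <= s.
  rewrite /spoke [X in modC X](_ : _ = cR (1 - sgx) * w + cR sgx * (cR s * circ y)); last first.
    by rewrite cRB cR1; ring.
  apply: (le_trans (modCD _ _)); rewrite !modCM !modC_cR modC_circ (gtr0_norm s0).
  move: sg01 => /andP[b1 b2].
  rewrite !ger0_norm; [|by move: b1 b2 del0; lra|by move: b1 b2 del0; lra].
  have p : 0 <= (1 - sgx) * (s - modC w) by rewrite mulr_ge0 // subr_ge0 // ltW.
  by move: p; lra.
have [b hb] := hf zs.
pose z0 := w + cR sgx * spoke y.
pose K3 := 2 * s + 4 * pi * s.
have K30 : 0 < K3.
  have p : 0 <= 4 * pi * s by rewrite mulr_ge0 ?(ltW s0) // mulr_ge0 ?pi_ge0.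
  by move: p s0; rewrite /K3; lra.
(* points of a block of level k are within K3 / 2^k of z0, and a bound eta on
   the function costs eta * K2 / 2^k *)
pose e1 := eps / (K3 * (K2 + 1)).
have K2p : 0 < K2 + 1 by have := K2_ge0; lra.
have e10 : 0 < e1 by rewrite divr_gt0 // mulr_gt0.
have [d d0 hd] := hb e1 e10.
have [k hk] : exists k, K3 / (2 ^ k)%:R < d.
  have [n hn'] : exists n : nat, K3 / d < n%:R.
    by exists (Num.trunc (K3 / d)).+1; rewrite truncnS_gt.
  exists n; rewrite ltr_pdivrMr ?pow2_gt0 // mulrC -ltr_pdivrMr //.
  by apply: (lt_trans hn'); rewrite ltr_nat ltn_expl.
apply: (qb k); exists 0%N => r _.
rewrite (grid_block_affine _ (f z0) b z0).
have near i j : ((q k).1 * 2 ^ r <= i <= (q k).1 * 2 ^ r + 2 ^ r)%N ->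
   ((q k).2 * 2 ^ r <= j <= (q k).2 * 2 ^ r + 2 ^ r)%N ->
   modC (grid_pt (k + r) i j - z0) <= K3 / (2 ^ k)%:R.
  have cl t (m l : nat) : dyadic k m <= t <= dyadic k m.+1 -> (m * 2 ^ r <= l <= m * 2 ^ r + 2 ^ r)%N ->
     `|dyadic (k + r) l - t| <= (2 ^ k)%:R^-1.
    have e3 : (m * 2 ^ r + 2 ^ r = m.+1 * 2 ^ r)%N by rewrite mulSn addnC.
    rewrite e3 => /andP[t1 t2] /andP[l1 l2].
    have mono (u v : nat) : (u <= v)%N -> dyadic (k + r) u <= dyadic (k + r) v.
      by move=> jj; rewrite ler_pM2r ?invr_gt0 ?pow2_gt0 // ler_nat.
    have L1 := mono _ _ l1; have L2 := mono _ _ l2.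
    rewrite !dyadic_scale in L1 L2.
    have := dyadicS k m; rewrite ler_norml; move: t1 t2 L1 L2; lra.
  move=> hi hj.
  have a1 := cl _ _ _ (hx k) hi; have a2 := cl _ _ _ (hy k) hj.
  rewrite /grid_pt /z0 [X in modC X](_ : _ = cR (dilation (k + r) i - sgx) * spoke (dyadic (k + r) j)
     + cR sgx * (spoke (dyadic (k + r) j) - spoke y)); last by rewrite cRB; ring.
  apply: (le_trans (modCD _ _)); rewrite !modCM !modC_cR mulrDl.
  apply: lerD.
    rewrite mulrC ler_pM ?modC_ge0 ?spoke_le //.
    apply: le_trans a1.
    rewrite /dilation /sgx (_ : _ - _ = (1 - del) * (dyadic (k + r) i - x)); last by ring.
    rewrite normrM -[leRHS]mul1r ler_wpM2r // ger0_norm; move: del0 del1; lra.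
  rewrite -[leRHS]mul1r ler_pM ?modC_ge0 //.
    by move: sg01 => /andP[b1 b2]; rewrite ger0_norm //; move: del0; lra.
  apply: (le_trans (spoke_lip _ _)); rewrite ler_wpM2l // !mulr_ge0 ?pi_ge0 //.
  exact: ltW.
apply: (le_trans (grid_block_le (eta := e1 * (K3 / (2 ^ k)%:R)) _)).
  move=> i j hi hj; have nr := near i j hi hj.
  rewrite opprD addrA.
  apply: (le_trans (hd _ (le_lt_trans nr hk))).
  by rewrite ler_pM2l.
rewrite expnD [(4 ^ k)%N](_ : _ = 2 ^ k * 2 ^ k)%N; last by rewrite -expnMn.
rewrite !natrM [leLHS](_ : _ = eps / ((2 ^ k)%:R * (2 ^ k)%:R) * (K2 / (K2 + 1))).
  rewrite -[leRHS]mulr1 ler_wpM2l //.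
    by rewrite divr_ge0 ?(ltW eps0) // mulr_ge0 // ltW // pow2_gt0.
  by rewrite ler_pdivrMr // mul1r; lra.
rewrite /e1; field.
by rewrite (gt_eqF K2p) (gt_eqF K30) (gt_eqF (pow2_gt0 k)) (gt_eqF (pow2_gt0 r)).
Qed.

End Bisect.
End Goursat.

(** * Cauchy's formula for averages over roots of unity *)

Section CauchyAverage.
Variable R : realType.
Local Notation C := (CC R).

Lemma cdifferentiable_cont (f : C -> C) z : cdifferentiable f z -> forall eta : R, 0 < eta ->
  exists2 d : R, 0 < d & forall z', modC (z' - z) < d -> modC (f z' - f z) <= eta.
Proof.
move=> [b hb] eta eta0; have [d d0 hd] := hb 1 ltr01.
have B0 : 0 < modC b + 1 by have := modC_ge0 b; lra.
exists (Num.min d (eta / (modC b + 1))); first by rewrite lt_min d0 divr_gt0.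
move=> z'; rewrite lt_min => /andP[h1 h2].
rewrite (_ : _ - _ = (f z' - f z - b * (z' - z)) + b * (z' - z)); last by ring.
apply: (le_trans (modCD _ _)); have := hd _ h1; rewrite modCM mul1r => h3.
by move: h2; rewrite ltr_pdivlMr // => h2; move: h2 h3; nra.
Qed.

Definition node (s : R) (n j : nat) : C := cR s * circ (dyadic R n j).
Definition avg (s : R) (n : nat) (g : C -> C) : C :=
  (2 ^ n)%:R^-1 * \sum_(0 <= j < 2 ^ n) g (node s n j).

(** The broken line from 1 to -1 through half of the 2^n-th roots of unity has
    length at least 2. *)
Lemma root_step n : (1 <= n)%N ->
  4 <= (2 ^ n)%:R * modC (circ (2 ^ n)%:R^-1 - 1 : C).
Proof.
case: n => // n _; set h : R := _^-1.
have e : circ (2^-1 : R) - 1 = \sum_(0 <= j < 2 ^ n) (circ (h *+ j.+1) - circ (h *+ j)).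
  rewrite telescope_sumr // mulr0n circ0; congr (circ _ - _).
  rewrite /h -[RHS]mulr_natr expnS natrM; field.
  by rewrite (gt_eqF (pow2_gt0 R n)).
have e2 : modC (circ (2^-1 : R) - 1) = 2.
  by rewrite circ_half -opprD modCN -(modC_nat R 2).
have := e2; rewrite e => {}e2.
have : modC (\sum_(0 <= j < 2 ^ n) (circ (h *+ j.+1) - circ (h *+ j))) <= (modC (circ h - 1)) *+ (2 ^ n).
  apply: (le_trans (modC_sum _ _ _)).
  rewrite -[X in _ <= _ *+ X]subn0 -sumr_const_nat; apply: ler_sum_nat => j _.
  rewrite mulrS circD (_ : _ - _ = (circ h - 1) * circ (h *+ j)); last by ring.
  by rewrite modCM modC_circ mulr1.
by rewrite e2 -[_ *+ (2 ^ n)]mulr_natr expnS natrM; lra.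
Qed.

(** The sides y = 0 and y = 1 of the whole grid cancel since the circle closes up,
    so the sums over the large and the small circle have the same limit; on the
    small one f is close to f w.  Consecutive spokes differ by the factor
    circ (1 / 2^n) - 1 times the node, which turns such a sum into an average. *)
Lemma cauchy_avg (f : C -> C) (s : R) (w : C) : modC w < s ->
  (forall z, modC z <= s -> cdifferentiable f z) ->
  forall eps : R, 0 < eps -> exists n0, forall n, (n0 <= n)%N ->
  modC (avg s n (fun z => (f z - f w) * (z / (z - w)))) <= eps.
Proof.
move=> ws hf eps eps0.
have s0 : 0 < s by apply: le_lt_trans ws; exact: modC_ge0.
have sw0 : 0 < s - modC w by rewrite subr_gt0.
pose K := 4 * pi * s / (s - modC w).
have K0 : 0 <= K by rewrite divr_ge0 ?(ltW sw0) // mulr_ge0 ?(ltW s0) // mulr_ge0 ?pi_ge0.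
(* K bounds the total weight of the small circle *)
pose eta := eps / (K + 1).
have K1 : 0 < K + 1 by lra.
have eta0 : 0 < eta by rewrite divr_gt0.
have [d d0 hd] := cdifferentiable_cont (hf w (ltW ws)) eta0.
pose del := Num.min 2^-1 (d / (4 * s)).
have h2 : (0 : R) < 2^-1 by rewrite invr_gt0.
have del0 : 0 < del by rewrite /del lt_min h2 divr_gt0 // mulr_gt0.
have del1 : del < 1 by rewrite /del gt_min; apply/orP; left; lra.
have deld : 2 * s * del < d.
  have : del <= d / (4 * s) by rewrite /del ge_min lexx orbT.
  rewrite ler_pdivlMr ?mulr_gt0 // => h; move: h d0; lra.
have [r0 hr0] := goursat_block ws del0 del1 hf eps0.
exists r0.+1 => n hn.
have := hr0 n (ltnW hn); rewrite add0n !mul0n expn0 divr1 grid_block_boundary // !add0n.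
have y0 : dyadic R n 0 = 0 by rewrite /dyadic mul0r.
have y1 : dyadic R n (2 ^ n) = 1 by rewrite /dyadic divff // (gt_eqF (pow2_gt0 R n)).
rewrite big1 ?add0r; last first.
  by move=> i _; rewrite /grid_pt y0 y1 /spoke circ0 circ1 subrr mul0r.
move=> hb.
(* the outer side of the grid consists of the nodes themselves *)
have p1 j : grid_pt s w del n (2 ^ n) j = node s n j.
  rewrite /grid_pt /dilation y1 mulr1 [del + _]addrC subrK cR1 mul1r /spoke addrC subrK //.
have sg0 : dilation del n 0 = del by rewrite /dilation y0 mulr0 addr0.
pose om : C := circ (2 ^ n)%:R^-1 - 1.
have ratio j : (spoke s w (dyadic R n j.+1) - spoke s w (dyadic R n j)) / spoke s w (dyadic R n j) =
   om * (node s n j / (node s n j - w)).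
  rewrite /spoke /node.
  have -> : dyadic R n j.+1 = (2 ^ n)%:R^-1 + dyadic R n j by rewrite -(dyadicS R n j) subrK.
  by rewrite circD /om [RHS]mulrA; congr (_ * _); ring.
have h4 := root_step (leq_trans (isT : (1 <= r0.+1)%N) hn).
pose A := \sum_(0 <= j < 2 ^ n) (f (node s n j) - f w) * (node s n j / (node s n j - w)).
have eA : om * A = \sum_(0 <= j < 2 ^ n) (f (grid_pt s w del n (2 ^ n) j) - f (grid_pt s w del n 0 j)) *
       ((spoke s w (dyadic R n j.+1) - spoke s w (dyadic R n j)) / spoke s w (dyadic R n j))
   + \sum_(0 <= j < 2 ^ n) (f (grid_pt s w del n 0 j) - f w) *
       ((spoke s w (dyadic R n j.+1) - spoke s w (dyadic R n j)) / spoke s w (dyadic R n j)).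
  rewrite -big_split mulr_sumr; apply: eq_bigr => j _ /=.
  rewrite p1 ratio; ring.
have b2 : modC (\sum_(0 <= j < 2 ^ n) (f (grid_pt s w del n 0 j) - f w) *
       ((spoke s w (dyadic R n j.+1) - spoke s w (dyadic R n j)) / spoke s w (dyadic R n j))) <= eta * K.
  apply: (le_trans (modC_sum _ _ _)).
  have -> : eta * K = (eta * (K / (2 ^ n)%:R)) *+ (2 ^ n - 0).
    rewrite subn0 -[RHS]mulr_natr; field.
    by rewrite (gt_eqF (pow2_gt0 R n)).
  rewrite -sumr_const_nat; apply: ler_sum_nat => j _.
  rewrite modCM ler_pM ?modC_ge0 //; last exact: angular_weight_le.
  apply: hd; rewrite /grid_pt sg0 [w + _]addrC addrK modCM modC_cR (gtr0_norm del0).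
  by apply: le_lt_trans deld; rewrite mulrC ler_wpM2r ?(ltW del0) //; apply: spoke_le.
have e1 : eta * K <= eps.
  rewrite /eta mulrAC ler_pdivrMr // ler_pM2l //; lra.
have hA : modC om * modC A <= 2 * eps.
  rewrite -modCM eA; apply: (le_trans (modCD _ _)).
  by move: hb b2 e1; lra.
rewrite /avg modCM modCV modC_nat -/A ler_pdivrMl ?pow2_gt0 //.
have N0 := pow2_gt0 R n.
have : (2 ^ n)%:R * (modC om * modC A) <= (2 ^ n)%:R * (2 * eps) by rewrite ler_pM2l.
have : 4 * modC A <= (2 ^ n)%:R * modC om * modC A by rewrite ler_wpM2r ?modC_ge0.
have := modC_ge0 A; move: N0 eps0; rewrite mulrA; nra.
Qed.

End CauchyAverage.

(** * Ultralimits and the mean over a circle *)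

Section Ultralimit.
Variable R : realType.
Local Notation C := (CC R).

(** Bounded sequences converge along an ultrafilter, by compactness of segments.
    A limit that always exists makes the mean over the circle a linear functional
    on all bounded functions, and such means can be iterated with no question of
    measurability. *)
Lemma real_ultralimit : exists lam : (nat -> R) -> R,
  [/\ forall (u v : nat -> R) (B : R), (forall n, `|u n| <= B) -> (forall n, `|v n| <= B) ->
        lam (fun n => u n + v n) = lam u + lam v,
      forall (c : R) (u : nat -> R) (B : R), (forall n, `|u n| <= B) -> lam (fun n => c * u n) = c * lam u,
      forall c : R, lam (fun _ => c) = c &
      forall (u : nat -> R) (B : R) n0, (exists B0, forall n, `|u n| <= B0) ->
        (forall n, (n0 <= n)%N -> u n <= B) -> lam u <= B].
Proof.
have [G [GU Goo]] := ultraFilterLemma (@eventually_filter).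
have GP : ProperFilter G by exact: ultra_proper.
have hc (u : nat -> R) (B : R) : (forall n, `|u n| <= B) -> cvg (u n @[n --> G]).
  move=> hB; have := @segment_compact R (- B) B; rewrite compact_ultra => hcp.
  have GI : UltraFilter (u n @[n --> G]).
    split; first exact: fmap_proper_filter.
    move=> H HP sub; apply/seteqP; split; last exact: sub.
    move=> A HA; have [h|h] := in_ultra_setVsetC (u @^-1` A) GU; first by [].
    have HnA : H (~` A) by apply: sub.
    have : H (A `&` ~` A) by apply: filterI.
    by rewrite setICr => /filter_ex [].
  have [|l [_ hl]] := hcp _ GI.
    change (G (u @^-1` `[- B, B]%classic)).
    by apply: filterE => n; have := hB n; rewrite ler_norml /= in_itv /=.
  by apply/cvg_ex; exists l.
exists (fun u => lim (u n @[n --> G])); split.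
- by move=> u v B hu hv; apply: cvg_lim => //; apply: (cvgD (hc u B hu) (hc v B hv)).
- by move=> c u B hu; apply: cvg_lim => //; apply: (cvgMl_tmp (hc u B hu)).
- by move=> c; apply: cvg_lim => //; exact: cvg_cst.
- move=> u B n0 [B0 hu] hb; apply: limr_le; first by exact: hc hu.
  by apply: Goo; exists n0 => // n /= hn; apply: hb.
Qed.

(** The factor 2 comes from treating real and imaginary parts separately. *)
Lemma complex_ultralimit : exists lam : (nat -> C) -> C,
  [/\ forall (u v : nat -> C) (B : R), (forall n, modC (u n) <= B) -> (forall n, modC (v n) <= B) ->
        lam (fun n => u n + v n) = lam u + lam v,
      forall (c : C) (u : nat -> C) (B : R), (forall n, modC (u n) <= B) -> lam (fun n => c * u n) = c * lam u,
      forall c : C, lam (fun _ => c) = c &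
      forall (u : nat -> C) (B : R) n0, (exists B0, forall n, modC (u n) <= B0) ->
        (forall n, (n0 <= n)%N -> modC (u n) <= B) -> modC (lam u) <= 2 * B].
Proof.
have [lam [lD lM lc lB]] := real_ultralimit.
pose re (u : nat -> C) n := complex.Re (u n); pose im (u : nat -> C) n := complex.Im (u n).
have bre (u : nat -> C) (B : R) : (forall n, modC (u n) <= B) -> forall n, `|re u n| <= B.
  by move=> h n; exact: le_trans (modC_Re _) (h n).
have bim (u : nat -> C) (B : R) : (forall n, modC (u n) <= B) -> forall n, `|im u n| <= B.
  by move=> h n; exact: le_trans (modC_Im _) (h n).
exists (fun u => cR (lam (re u)) + 'i * cR (lam (im u))); split.
- move=> u v B hu hv.
  rewrite (_ : re _ = fun n => re u n + re v n); last by apply/funext => n; exact: Re_D.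
  rewrite (_ : im _ = fun n => im u n + im v n); last by apply/funext => n; exact: Im_D.
  rewrite (lD _ _ _ (bre _ _ hu) (bre _ _ hv)) (lD _ _ _ (bim _ _ hu) (bim _ _ hv)).
  by rewrite !cRD; ring.
- move=> c u B hu.
  have h1 := bre _ _ hu; have h2 := bim _ _ hu.
  have k1 (a : R) : forall n, `|a * re u n| <= `|a| * B by move=> n; rewrite normrM ler_wpM2l.
  have k2 (a : R) : forall n, `|a * im u n| <= `|a| * B by move=> n; rewrite normrM ler_wpM2l.
  pose a := complex.Re c; pose b := complex.Im c.
  have B0 : 0 <= B by apply: le_trans (h1 0%N).
  have mx1 (x y : R) : `|x| * B <= (`|x| + `|y|) * B by rewrite ler_wpM2r // lerDl.
  have mx2 (x y : R) : `|y| * B <= (`|x| + `|y|) * B by rewrite ler_wpM2r // lerDr.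
  rewrite (_ : re _ = fun n => a * re u n + (- b) * im u n); last first.
    by apply/funext => n; rewrite /re Re_M mulNr.
  rewrite (_ : im (fun n => c * u n) = fun n => a * im u n + b * re u n); last first.
    by apply/funext => n; rewrite /im Im_M.
  rewrite (lD _ _ ((`|a| + `|- b|) * B)); last 2 first.
  + by move=> n; exact: le_trans (k1 _ n) (mx1 _ _).
  + by move=> n; exact: le_trans (k2 _ n) (mx2 _ _).
  rewrite (lD _ _ ((`|a| + `|b|) * B)); last 2 first.
  + by move=> n; exact: le_trans (k2 _ n) (mx1 _ _).
  + by move=> n; exact: le_trans (k1 _ n) (mx2 _ _).
  rewrite (lM a _ _ h1) (lM a _ _ h2) (lM b _ _ h1) (lM (- b) _ _ h2).
  rewrite [c in RHS]complex_decomp -/a -/b !cRD !cRM cRN.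
  have i2 : 'i * 'i = -1 :> C by rewrite -expr2 sqrCi.
  by ring: i2.
- by move=> c; rewrite /re /im !lc -complex_decomp.
- move=> u B n0 [B0 h0] hu.
  apply: (le_trans (modCD _ _)); rewrite modCM !modC_cR.
  have -> : modC 'i = 1 :> R by apply: cR_inj; rewrite cR_modC normCi.
  have neg (v : nat -> R) : (forall n, `|v n| <= B0) -> (forall n, (n0 <= n)%N -> `|v n| <= B) -> `|lam v| <= B.
    move=> hv1 hv2; rewrite ler_norml; apply/andP; split; last first.
      by apply: (lB _ _ n0); [exists B0 | move=> n /hv2; rewrite ler_norml => /andP[]].
    rewrite lerNl -mulN1r -(lM _ _ _ hv1); apply: (lB _ _ n0).
      by exists B0 => n; rewrite mulN1r normrN.
    by move=> n /hv2; rewrite ler_norml mulN1r lerNl => /andP[].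
  have h1 := neg (re u) (bre _ _ h0) (fun n hn => le_trans (modC_Re _) (hu n hn)).
  have h2 := neg (im u) (bim _ _ h0) (fun n hn => le_trans (modC_Im _) (hu n hn)).
  by move: h1 h2; rewrite mul1r; lra.
Qed.

End Ultralimit.

Section CircleMean.
Variable R : realType.
Local Notation C := (CC R).

Definition bdd_on (s B : R) (u : C -> C) := forall z, modC z = s -> modC (u z) <= B.

(** The role of L u is that of the integral of u dtheta / (2 pi) over the circle
    of radius s; since dz / (2 pi i) = z dtheta / (2 pi), [mean_cauchy] is Cauchy's
    formula. *)
Record circle_mean (s : R) (L : (C -> C) -> C) : Prop := CircleMean {
  mean_ext : forall u v, (forall z, modC z = s -> u z = v z) -> L u = L v;
  meanD : forall u v (B B' : R), bdd_on s B u -> bdd_on s B' v ->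
    L (fun z => u z + v z) = L u + L v;
  meanZ : forall (c : C) u (B : R), bdd_on s B u -> L (fun z => c * u z) = c * L u;
  mean_le : forall u (B : R), bdd_on s B u -> modC (L u) <= 2 * B;
  mean_cauchy : forall f (B : R), (forall z, modC z <= s -> cdifferentiable f z) -> bdd_on s B f ->
    forall w, modC w < s -> L (fun z => f z * (z / (z - w))) = f w }.

Lemma modC_node (s : R) n j : 0 < s -> modC (node s n j) = s.
Proof. by move=> s0; rewrite /node modCM modC_circ mulr1 modC_cR gtr0_norm. Qed.

Lemma avgD (s : R) n (u v : C -> C) :
  avg s n (fun z => u z + v z) = avg s n u + avg s n v.
Proof. by rewrite /avg big_split mulrDr. Qed.

Lemma avgZ (s : R) n c (u : C -> C) : avg s n (fun z => c * u z) = c * avg s n u.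
Proof. by rewrite /avg -mulr_sumr mulrCA. Qed.

Lemma avg_le (s B : R) n (u : C -> C) : 0 < s -> bdd_on s B u -> modC (avg s n u) <= B.
Proof.
move=> s0 hu; rewrite /avg modCM modCV modC_nat ler_pdivrMl ?pow2_gt0 //.
apply: (le_trans (modC_sum _ _ _)).
rewrite mulr_natl -[X in _ <= _ *+ X]subn0 -sumr_const_nat.
by apply: ler_sum_nat => j _; apply: hu; rewrite modC_node.
Qed.

Lemma avg_const (s : R) n (c : C) : avg s n (fun _ => c) = c.
Proof.
rewrite /avg sumr_const_nat subn0 -[c *+ _]mulr_natl mulKf // pnatr_eq0 expn_eq0.
Qed.

Lemma cdifferentiable_cst (c z : C) : cdifferentiable (fun _ => c) z.
Proof.
exists 0 => eps e0; exists 1 => // z' _.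
by rewrite subrr mul0r subrr modC0 mulr_ge0 ?modC_ge0 // ltW.
Qed.

Lemma cdifferentiable_mulX (f : C -> C) z : cdifferentiable f z -> cdifferentiable (fun x => x * f x) z.
Proof.
move=> hf; have [b hb] := hf; exists (f z + z * b) => eps e0.
have e2 : 0 < eps / (2 * (modC z + 1)).
  by rewrite divr_gt0 // mulr_gt0 //; have := modC_ge0 z; lra.
have e1 : 0 < eps / 2 by rewrite divr_gt0.
have [d1 d10 h1] := hb _ e2; have [d2 d20 h2] := cdifferentiable_cont hf e1.
exists (Num.min d1 d2); first by rewrite lt_min d10.
move=> z'; rewrite lt_min => /andP[k1 k2] /=.
rewrite [X in modC X <= _](_ : _ = z * (f z' - f z - b * (z' - z)) + (f z' - f z) * (z' - z)); last by ring.
apply: (le_trans (modCD _ _)); rewrite !modCM.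
have := h1 _ k1; have := h2 _ k2.
set m := modC (z' - z); set p := modC (_ - _); set q := modC (_ - _ - _) => g1 g2.
have m0 : 0 <= m by exact: modC_ge0.
have z0 := modC_ge0 z; have z1 : 0 < modC z + 1 by lra.
have a1 : p * m <= eps / 2 * m by rewrite ler_wpM2r.
have a2 : modC z * q <= eps / 2 * m.
  apply: (@le_trans _ _ ((modC z + 1) * (eps / (2 * (modC z + 1)) * m))).
    by rewrite ler_pM ?modC_ge0 //; lra.
  rewrite le_eqVlt; apply/orP; left; apply/eqP; field.
  exact: lt0r_neq0.
by move: a1 a2; lra.
Qed.

Lemma cdifferentiableX i (z : C) : cdifferentiable (fun x => x ^+ i) z.
Proof.
elim: i => [|i ih].
  rewrite (_ : (fun _ => _) = fun _ => 1); first exact: cdifferentiable_cst.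
  by apply/funext => x; rewrite expr0.
rewrite (_ : (fun _ => _) = fun x => x * x ^+ i); first exact: cdifferentiable_mulX.
by apply/funext => x; rewrite exprS.
Qed.

(** Cauchy's formula at 0 for z^(i + 1), conjugated: 1 / z = conj z / s^2 on the
    circle. *)
Lemma avgX_small (s : R) i : 0 < s -> forall eps : R, 0 < eps ->
  exists n0, forall n, (n0 <= n)%N -> modC (avg s n (fun z => (z^-1) ^+ i.+1)) <= eps.
Proof.
move=> s0 eps e0.
have e1 : 0 < eps * (s ^+ i.+1) ^+ 2 by rewrite mulr_gt0 // !exprn_gt0.
have [|n0 h] := @cauchy_avg R (fun z => z ^+ i.+1) s 0 _ (fun z _ => cdifferentiableX _ z) _ e1.
  by rewrite modC0.
exists n0 => n hn; have := h n hn.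
have nz j : node s n j != 0 by rewrite -modC_gt0 modC_node.
have -> : avg s n (fun z => (z ^+ i.+1 - 0 ^+ i.+1) * (z / (z - 0))) =
   Num.conj (avg s n (fun z => z^-1 ^+ i.+1)) * cR ((s ^+ i.+1) ^+ 2).
  rewrite /avg rmorphM /= fmorphV /= rmorph_nat -mulrA; congr (_ * _).
  rewrite rmorph_sum mulr_suml; apply: eq_bigr => j _.
  rewrite expr0n subr0 subr0 divff // mulr1 rmorphXn /= fmorphV /=.
  have -> : cR ((s ^+ i.+1) ^+ 2) = (node s n j * Num.conj (node s n j)) ^+ i.+1.
    by rewrite -normCK -cR_modC modC_node // -!cRX -!exprM mulnC.
  by rewrite [RHS]mulrC -[RHS]exprMn mulfK ?conjC_eq0.
by rewrite modCM modCJ modC_cR ger0_norm ?ler_pM2r // ?sqr_ge0 // exprn_gt0 // exprn_gt0.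
Qed.

(** Averages of (f z - f w) z / (z - w) tend to 0 by Cauchy's formula.  It
    remains to see that z / (z - w) has mean 1: it is the sum of the powers of
    w / z, all of mean 0 except the first. *)
Theorem circle_mean_exists (s : R) : 0 < s -> exists L, circle_mean s L.
Proof.
move=> s0; have [lam [lD lM lc lB]] := complex_ultralimit R.
have bavg u (B : R) : bdd_on s B u -> forall n, modC (avg s n u) <= B.
  by move=> hu n; apply: avg_le.
pose L g := lam (fun n => avg s n g).
have Lext u v : (forall z, modC z = s -> u z = v z) -> L u = L v.
  move=> h; congr (lam _); apply/funext => n; rewrite /avg; congr (_ * _).
  by apply: eq_bigr => j _; apply: h; rewrite modC_node.
have LD u v (B B' : R) : bdd_on s B u -> bdd_on s B' v -> L (fun z => u z + v z) = L u + L v.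
  move=> hu hv; rewrite /L -(lD _ _ (Num.max B B')).
  - by congr lam; apply/funext => n; rewrite avgD.
  - by move=> n; rewrite le_max bavg.
  - by move=> n; rewrite le_max (bavg v B') ?orbT.
have LZ (c : C) u (B : R) : bdd_on s B u -> L (fun z => c * u z) = c * L u.
  move=> hu; rewrite /L -(lM _ _ B).
  - by congr lam; apply/funext => n; rewrite avgZ.
  - exact: bavg.
have Lle u (B : R) : bdd_on s B u -> modC (L u) <= 2 * B.
  move=> hu; apply: (lB _ _ 0%N).
  - by exists B => n; apply: bavg.
  - by move=> n _; apply: bavg.
have L0 u (B : R) : bdd_on s B u -> (forall eps : R, 0 < eps -> exists n0, forall n, (n0 <= n)%N ->
    modC (avg s n u) <= eps) -> L u = 0.
  move=> hu h; apply/eqP; rewrite -modC_eq0 eq_le modC_ge0 andbT.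
  apply/ler_addgt0Pr => e e0; rewrite add0r.
  have e2 : 0 < e / 2 by rewrite divr_gt0.
  have [n0 hn] := h _ e2.
  rewrite (_ : e = 2 * (e / 2)); last by field.
  by apply: (lB _ _ n0) => //; exists B => n; apply: bavg.
have Lc c : L (fun _ => c) = c.
  by rewrite /L -[RHS]lc; congr lam; apply/funext => n; exact: avg_const.
exists L; split => // f B hf bf w ws.
have sw : 0 < s - modC w by rewrite subr_gt0.
pose k (z : C) := z / (z - w).
have kb z : modC z = s -> modC (k z) <= s / (s - modC w).
  move=> zs; rewrite modCM modCV zs ler_pM2l // lef_pV2 ?posrE //.
    by rewrite -zs modC_sub_ge.
  by apply: lt_le_trans sw _; rewrite -zs modC_sub_ge.
have kE N z : modC z = s ->
    k z = 1 + (\sum_(0 <= i < N) w ^+ i.+1 * (z^-1) ^+ i.+1) + (w / z) ^+ N.+1 * k z.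
  move=> zs; have z0 : z != 0 by rewrite -modC_gt0 zs.
  have zw : z - w != 0.
    by rewrite -modC_gt0; apply: lt_le_trans sw _; rewrite -zs modC_sub_ge.
  elim: N => [|N ih].
    by rewrite big_geq // addr0 expr1 /k; field; rewrite ?z0 ?zw.
  rewrite big_nat_recr //= addrA {1}ih -!addrA; congr (_ + (_ + _)).
  have kk : k z = 1 + w / z * k z by rewrite /k; field; rewrite ?z0 ?zw.
  rewrite -exprMn [in RHS](exprS _ N.+1) {1}kk; ring.
have LX i : L (fun z => z^-1 ^+ i.+1) = 0.
  apply: (L0 _ (s^-1 ^+ i.+1)); last exact: avgX_small.
  by move=> z zs; rewrite modCX modCV zs.
have bX i : bdd_on s (modC w ^+ i.+1 * s^-1 ^+ i.+1) (fun z => w ^+ i.+1 * z^-1 ^+ i.+1).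
  by move=> z zs; rewrite modCM !modCX modCV zs.
have LS N : exists2 B : R, bdd_on s B (fun z => 1 + \sum_(0 <= i < N) w ^+ i.+1 * (z^-1) ^+ i.+1) &
   L (fun z => 1 + \sum_(0 <= i < N) w ^+ i.+1 * (z^-1) ^+ i.+1) = 1.
  elim: N => [|N [B1 hB ih]].
    exists 1; first by move=> z _; rewrite big_geq // addr0 modC1.
    by rewrite -[RHS]Lc; apply: Lext => z _; rewrite big_geq // addr0.
  have e z : 1 + \sum_(0 <= i < N.+1) w ^+ i.+1 * (z^-1) ^+ i.+1 =
      (1 + \sum_(0 <= i < N) w ^+ i.+1 * (z^-1) ^+ i.+1) + w ^+ N.+1 * (z^-1) ^+ N.+1.
    by rewrite big_nat_recr //= addrA.
  exists (B1 + modC w ^+ N.+1 * s^-1 ^+ N.+1).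
    by move=> z zs; rewrite e; apply: (le_trans (modCD _ _)); rewrite lerD ?hB ?bX.
  rewrite (Lext _ _ (fun z _ => e z)) (LD _ _ _ _ hB (bX N)) ih.
  rewrite (LZ _ _ (s^-1 ^+ N.+1)) ?LX ?mulr0 ?addr0 //.
  by move=> z zs; rewrite modCX modCV zs.
have Lk : L k = 1.
  apply/eqP; rewrite -subr_eq0 -modC_eq0 eq_le modC_ge0 andbT.
  apply/ler_addgt0Pr => e e0; rewrite add0r.
  have q1 : `|modC w / s| < 1.
    by rewrite ger0_norm ?divr_ge0 ?modC_ge0 ?(ltW s0) // ltr_pdivrMr // mul1r.
  have e2 : 0 < e / (2 * (s / (s - modC w))) by rewrite !divr_gt0 // mulr_gt0 // divr_gt0.
  have [N hN] : exists N, (modC w / s) ^+ N.+1 <= e / (2 * (s / (s - modC w))).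
    have := cvg_expr q1 => /cvgrPdist_le /(_ _ e2) [N _ hN].
    exists N; have := hN N.+1 (leqnSn N); rewrite /= sub0r normrN ger0_norm //.
    by rewrite exprn_ge0 // divr_ge0 ?modC_ge0 // ltW.
  have [B1 hB1 e1] := LS N.
  have hr : bdd_on s ((modC w / s) ^+ N.+1 * (s / (s - modC w))) (fun z => (w / z) ^+ N.+1 * k z).
    move=> z zs; rewrite modCM modCX modCM modCV zs.
    by apply: ler_wpM2l; rewrite ?kb // exprn_ge0 // divr_ge0 ?modC_ge0 // ltW.
  rewrite (Lext _ _ (kE N)) (LD _ _ _ _ hB1 hr) e1 [1 + _]addrC addrK.
  apply: (le_trans (Lle _ _ hr)).
  have sp : 0 < 2 * (s / (s - modC w)) by rewrite mulr_gt0 // divr_gt0.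
  by move: hN; rewrite ler_pdivlMr //; lra.
pose g z := (f z - f w) * k z.
have bg : bdd_on s ((B + modC (f w)) * (s / (s - modC w))) g.
  move=> z zs; rewrite modCM ler_pM ?modC_ge0 ?kb //.
  by apply: (le_trans (modCB _ _)); rewrite lerD2r bf.
have Lg : L g = 0 by apply: (L0 _ _ bg); exact: cauchy_avg.
have bk : bdd_on s (modC (f w) * (s / (s - modC w))) (fun z => f w * k z).
  by move=> z zs; rewrite modCM ler_wpM2l ?modC_ge0 ?kb.
rewrite (Lext _ (fun z => g z + f w * k z)); last by move=> z _; rewrite /g /k /=; ring.
by rewrite (LD _ _ _ _ bg bk) Lg add0r (LZ _ _ _ kb) Lk mulr1.
Qed.

End CircleMean.

(** * Means against powers of the Cauchy kernel *)

Section Kernel.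
Variable R : realType.
Local Notation C := (CC R).

(** The a-th derivative in z of the Cauchy kernel u / (u - z), divided by a!. *)
Definition ckernel (a : nat) (u z : C) : C := u * (u - z)^-1 ^+ a.+1.

Variable s : R.
Hypothesis s0 : 0 < s.

Lemma half_gap (u z : C) : modC u = s -> modC z <= s / 2 -> s / 2 <= modC (u - z).
Proof. by move=> us zs; apply: le_trans (modC_sub_ge _ _); rewrite us; move: zs; lra. Qed.

Lemma half_neq (u z : C) : modC u = s -> modC z <= s / 2 -> u - z != 0.
Proof.
move=> us zs; rewrite -modC_gt0; apply: lt_le_trans (half_gap us zs).
by rewrite divr_gt0.
Qed.

Lemma inv_gap (u z : C) : modC u = s -> modC z <= s / 2 -> modC (u - z)^-1 <= 2 / s.
Proof.
move=> us zs; rewrite modCV -[2 / s]invf_div lef_pV2 ?posrE ?divr_gt0 //.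
  exact: half_gap.
by rewrite modC_gt0 half_neq.
Qed.

Definition ckernel_bound (a : nat) : R := s * (2 / s) ^+ a.+1.
Lemma ckernel_le a (u z : C) : modC u = s -> modC z <= s / 2 -> modC (ckernel a u z) <= ckernel_bound a.
Proof.
move=> us zs; rewrite modCM modCX us /ckernel_bound; apply: ler_wpM2l; first exact: ltW.
by rewrite lerXn2r ?nnegrE ?modC_ge0 ?divr_ge0 ?(ltW s0) ?inv_gap.
Qed.

(** With p = 1 / (u - z) and p' = 1 / (u - z - h) one has p' - p = h p p'; the
    case of powers follows by induction. *)
Lemma inv_pow_est k (u z h : C) : modC u = s -> modC z <= s / 2 -> modC (z + h) <= s / 2 ->
  modC ((u - (z + h))^-1 ^+ k - (u - z)^-1 ^+ k - k%:R * h * (u - z)^-1 ^+ k.+1)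
   <= (\sum_(i < k) i.+1%:R) * (2 / s) ^+ k.+2 * modC h ^+ 2.
Proof.
move=> us zs hs; have n1 := half_neq us zs; have n2 := half_neq us hs.
set p := (u - z)^-1; set p' := (u - (z + h))^-1.
have pp : p' - p = h * p * p' by rewrite /p /p'; field; rewrite n1 n2.
have bp : modC p <= 2 / s by exact: inv_gap.
have bp' : modC p' <= 2 / s by exact: inv_gap.
have s2 : 0 <= 2 / s by rewrite divr_ge0 // ltW.
elim: k => [|k ih].
  by rewrite big_ord0 mulr0n !mul0r !expr0 subrr subr0 modC0.
rewrite (_ : _ - _ = p' * (p' ^+ k - p ^+ k - k%:R * h * p ^+ k.+1)
   + k.+1%:R * h ^+ 2 * (p ^+ k.+2 * p')); last first.
  have e : p' = p + h * p * p' by rewrite -pp addrC subrK.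
  have e2 : p' * p ^+ k = p ^+ k.+1 + h * p' * p ^+ k.+1.
    by rewrite {1}e exprS; ring.
  have e3 : k%:R * h * p' * p ^+ k.+1 = k%:R * h * p ^+ k.+2 + k%:R * h ^+ 2 * (p ^+ k.+2 * p').
    by rewrite {1}e (exprS p k.+1); ring.
  have e4 : h * p' * p ^+ k.+1 = h * p ^+ k.+2 + h ^+ 2 * (p ^+ k.+2 * p').
    by rewrite {1}e (exprS p k.+1); ring.
  rewrite (_ : p' * _ = p' ^+ k.+1 - p' * p ^+ k - k%:R * h * p' * p ^+ k.+1); last first.
    by rewrite (exprS p'); ring.
  rewrite e2 e3 e4 -[in k.+1%:R]addn1 natrD; ring.
have eS : \sum_(i < k.+1) i.+1%:R = \sum_(i < k) i.+1%:R + k.+1%:R :> R by rewrite big_ord_recr.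
apply: (le_trans (modCD _ _)); rewrite eS.
rewrite [leRHS](_ : _ = (\sum_(i < k) i.+1%:R) * (2 / s) ^+ k.+3 * modC h ^+ 2
  + k.+1%:R * (2 / s) ^+ k.+3 * modC h ^+ 2); last by ring.
apply: lerD.
  rewrite (modCM p').
  apply: (@le_trans _ _ (2 / s * ((\sum_(i < k) i.+1%:R) * (2 / s) ^+ k.+2 * modC h ^+ 2))).
    by apply: ler_pM => //; rewrite ?modC_ge0 //; exact: ih.
  by rewrite (exprS _ k.+2) le_eqVlt; apply/orP; left; apply/eqP; ring.
rewrite (modCM (k.+1%:R * h ^+ 2)) (modCM k.+1%:R) (modCM (p ^+ k.+2)) modC_nat !modCX [leRHS](_ : _ = k.+1%:R * modC h ^+ 2 * (2 / s) ^+ k.+3); last by ring.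
apply: ler_wpM2l; first by rewrite mulr_ge0 ?exprn_ge0 ?modC_ge0.
rewrite [(2 / s) ^+ k.+3]exprSr; apply: ler_pM; rewrite ?exprn_ge0 ?modC_ge0 //.
by rewrite lerXn2r ?nnegrE ?modC_ge0.
Qed.

Definition ckernel_defect (a : nat) : R := s * ((\sum_(i < a.+1) i.+1%:R) * (2 / s) ^+ a.+3).
Lemma ckernel_est a (u z h : C) : modC u = s -> modC z <= s / 2 -> modC (z + h) <= s / 2 ->
  modC (ckernel a u (z + h) - ckernel a u z - a.+1%:R * h * ckernel a.+1 u z) <= ckernel_defect a * modC h ^+ 2.
Proof.
move=> us zs hs; rewrite /ckernel.
rewrite (_ : _ - _ = u * ((u - (z + h))^-1 ^+ a.+1 - (u - z)^-1 ^+ a.+1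
    - a.+1%:R * h * (u - z)^-1 ^+ a.+2)); last by ring.
rewrite modCM us /ckernel_defect -[leRHS]mulrA; apply: ler_wpM2l; first exact: ltW.
exact: inv_pow_est.
Qed.

Lemma ckernel0E a (u : C) : u != 0 -> ckernel a u 0 = u^-1 ^+ a.
Proof. by move=> u0; rewrite /ckernel subr0 exprS mulrA divff ?mul1r. Qed.

Lemma ckernel_geom N (u z : C) : modC u = s -> modC z <= s / 2 ->
  ckernel 0 u z = \sum_(0 <= i < N) z ^+ i * ckernel i u 0 + (z / u) ^+ N * ckernel 0 u z.
Proof.
move=> us zs; have u0 : u != 0 by rewrite -modC_gt0 us.
have n1 := half_neq us zs.
elim: N => [|N ih]; first by rewrite big_geq // add0r expr0 mul1r.
rewrite big_nat_recr //= -addrA {1}ih; congr (_ + _).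
have e : ckernel 0 u z = 1 + z / u * ckernel 0 u z.
  by rewrite /ckernel expr1; field; rewrite n1 u0.
by rewrite {1}e ckernel0E // (exprS (z / u)) exprMn; ring.
Qed.

Variable L : (C -> C) -> C.
Hypothesis hL : circle_mean s L.

Definition cauchy_mean (g : C -> C) a z := L (fun u => ckernel a u z * g u).

Lemma bdd_ckernel (g : C -> C) (B : R) a (z : C) : bdd_on s B g -> modC z <= s / 2 ->
  bdd_on s (ckernel_bound a * B) (fun u => ckernel a u z * g u).
Proof.
move=> hg zs u us; rewrite modCM ler_pM ?modC_ge0 ?ckernel_le ?hg //.
Qed.

Lemma cauchy_mean_le g (B : R) a z : bdd_on s B g -> modC z <= s / 2 -> modC (cauchy_mean g a z) <= 2 * (ckernel_bound a * B).
Proof. by move=> hg zs; apply: (mean_le hL); apply: bdd_ckernel. Qed.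

Lemma bddZ (c : C) (B : R) u : bdd_on s B u -> bdd_on s (modC c * B) (fun z => c * u z).
Proof. by move=> h z zs; rewrite modCM ler_wpM2l ?modC_ge0 ?h. Qed.

Lemma bddD (B B' : R) u v : bdd_on s B u -> bdd_on s B' v -> bdd_on s (B + B') (fun z => u z + v z).
Proof. by move=> h h' z zs; apply: (le_trans (modCD _ _)); rewrite lerD ?h ?h'. Qed.

Lemma mean_lin u v w (B B' B'' : R) (c e : C) : bdd_on s B u -> bdd_on s B' v -> bdd_on s B'' w ->
  L (fun z => u z + c * v z + e * w z) = L u + c * L v + e * L w.
Proof.
move=> hu hv hw; rewrite (meanD hL (bddD hu (bddZ c hv)) (bddZ e hw)).
by rewrite (meanD hL hu (bddZ c hv)) (meanZ hL c hv) (meanZ hL e hw).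
Qed.

(** Differentiation under the mean: the second-order estimate of the kernel is
    uniform on the circle. *)
Lemma cauchy_mean_est g (B : R) a (z h : C) : bdd_on s B g -> modC z <= s / 2 -> modC (z + h) <= s / 2 ->
  modC (cauchy_mean g a (z + h) - cauchy_mean g a z - a.+1%:R * h * cauchy_mean g a.+1 z) <= 2 * (ckernel_defect a * modC h ^+ 2 * B).
Proof.
move=> hg zs hs.
have -> : cauchy_mean g a (z + h) - cauchy_mean g a z - a.+1%:R * h * cauchy_mean g a.+1 z =
    L (fun u => ckernel a u (z + h) * g u + (-1) * (ckernel a u z * g u) + (- (a.+1%:R * h)) * (ckernel a.+1 u z * g u)).
  by rewrite (mean_lin (-1) _ (bdd_ckernel a hg hs) (bdd_ckernel a hg zs) (bdd_ckernel a.+1 hg zs)) mulN1r mulNr.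
apply: (mean_le hL) => u us.
rewrite mulN1r mulNr [a.+1%:R * h * (_ * _)]mulrA -!mulrBl.
rewrite modCM ler_pM ?modC_ge0 ?hg //; exact: ckernel_est.
Qed.

Lemma mean_sum (F : nat -> C -> C) (c : nat -> C) N (B : nat -> R) :
  (forall i, bdd_on s (B i) (F i)) ->
  (exists B', bdd_on s B' (fun z => \sum_(0 <= i < N) c i * F i z)) /\
  L (fun z => \sum_(0 <= i < N) c i * F i z) = \sum_(0 <= i < N) c i * L (F i).
Proof.
move=> hB; elim: N => [|N [[B' hb] ih]].
  split; first by exists 0 => z _; rewrite big_geq // modC0.
  have h0 : bdd_on s 0 (fun _ : C => 0) by move=> z _; rewrite modC0.
  transitivity (0 * L (fun _ => 0)); last by rewrite mul0r big_geq.
  rewrite -(meanZ hL 0 h0).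
  by apply: (mean_ext hL) => z _; rewrite big_geq // mul0r.
split.
  exists (B' + modC (c N) * B N) => z zs; rewrite big_nat_recr //=.
  by apply: (bddD hb (bddZ (c N) (hB N))).
rewrite big_nat_recr //= -ih -(meanZ hL (c N) (hB N)) -(meanD hL hb (bddZ (c N) (hB N))).
by apply: (mean_ext hL) => z _; rewrite big_nat_recr.
Qed.

Lemma bdd_ge0 u (B : R) : bdd_on s B u -> 0 <= B.
Proof.
move=> h; have := h (cR s); rewrite modC_cR gtr0_norm // => /(_ erefl).
by apply: le_trans; apply: modC_ge0.
Qed.

(** Geometric expansion of the kernel.  The constant does not depend on N, which
    is what later makes flat functions vanish. *)
Lemma cauchy_mean_taylor g (B : R) N (z : C) : bdd_on s B g -> modC z <= s / 2 ->
  modC (cauchy_mean g 0 z - \sum_(0 <= i < N) z ^+ i * cauchy_mean g i 0) <= 4 * B * (modC z / s) ^+ N.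
Proof.
move=> hg zs; have B0 := bdd_ge0 hg.
have z0 : modC (0 : C) <= s / 2 by rewrite modC0 divr_ge0 // ltW.
have [[B' hb] hs] := mean_sum (fun i => z ^+ i) N (fun i => bdd_ckernel i hg z0).
rewrite -[X in _ - X]hs -mulN1r.
have := mean_lin (-1) 0 (bdd_ckernel 0 hg zs) hb hb; rewrite -/(cauchy_mean g 0 z) mul0r addr0 => <-.
rewrite [leRHS](_ : _ = 2 * ((modC z / s) ^+ N * (ckernel_bound 0 * B))); last first.
  by rewrite /ckernel_bound expr1; field; apply: lt0r_neq0.
apply: (mean_le hL) => u us; rewrite mul0r addr0 mulN1r.
have -> : \sum_(0 <= i < N) z ^+ i * (ckernel i u 0 * g u) = (\sum_(0 <= i < N) z ^+ i * ckernel i u 0) * g u.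
  by rewrite mulr_suml; apply: eq_bigr => i _; rewrite mulrA.
rewrite {1}(ckernel_geom N us zs) mulrDl addrC addKr -mulrA modCM.
rewrite modCX modCM modCV us; apply: ler_wpM2l.
  by rewrite exprn_ge0 // divr_ge0 ?modC_ge0 // ltW.
by apply: bdd_ckernel.
Qed.

End Kernel.

(** * Double power series *)

Section TwoVariables.
Variable R : realType.
Local Notation C := (CC R).

Definition sep_holo (s B : R) (f : C -> C -> C) := forall z w, modC z <= s -> modC w <= s ->
  [/\ cdifferentiable (f^~ w) z, cdifferentiable (f z) w & modC (f z w) <= B].

(** Phi a b is the derivative of order a in z and b in w of f, divided by a! b!.
    The series converges on the polydisc of radius 2 s, whence the ratios in
    [bs_taylor]. *)
Record biseries (s : R) (f : C -> C -> C) (Phi : nat -> nat -> C -> C -> C) : Prop := Biseries {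
  bs_val : forall z w, modC z <= s -> modC w <= s -> Phi 0 0 z w = f z w;
  bs_bound : forall a b, exists K : R, forall z w, modC z <= s -> modC w <= s ->
     modC (Phi a b z w) <= K;
  bs_dz : forall a b, exists K : R, forall z h w, modC z <= s -> modC (z + h) <= s -> modC w <= s ->
     modC (Phi a b (z + h) w - Phi a b z w - a.+1%:R * h * Phi a.+1 b z w) <= K * modC h ^+ 2;
  bs_dw : forall a b, exists K : R, forall z w h, modC z <= s -> modC w <= s -> modC (w + h) <= s ->
     modC (Phi a b z (w + h) - Phi a b z w - b.+1%:R * h * Phi a b.+1 z w) <= K * modC h ^+ 2;
  bs_taylor : exists K : R, forall N z w, modC z <= s -> modC w <= s ->
     modC (f z w - \sum_(0 <= a < N) z ^+ a * \sum_(0 <= b < N) w ^+ b * Phi a b 0 0)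
       <= K * ((modC z / (2 * s)) ^+ N + (modC w / (2 * s)) ^+ N) }.

Lemma geom_half (x : R) N : 0 <= x -> x <= 2^-1 -> \sum_(0 <= i < N) x ^+ i <= 2.
Proof.
move=> x0 x1; have : \sum_(0 <= i < N) x ^+ i <= 2 - 2 * x ^+ N.
  elim: N => [|N ih]; first by rewrite big_geq // expr0; lra.
  rewrite big_nat_recr //= exprS.
  have p0 : 0 <= x ^+ N by rewrite exprn_ge0.
  have : x * x ^+ N <= 2^-1 * x ^+ N by rewrite ler_wpM2r.
  have : 2^-1 * x ^+ N + 2^-1 * x ^+ N = x ^+ N by field.
  by move: ih; lra.
have p0 : 0 <= x ^+ N by rewrite exprn_ge0.
by move: p0; lra.
Qed.

(** Applying Cauchy's formula in each variable writes f as an iterated mean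
    against a product of two kernels, and each kernel can be differentiated and
    expanded on its own. *)
Theorem biseries_exists (s B : R) f : 0 < s -> sep_holo s B f ->
  exists Phi, biseries (s / 2) f Phi.
Proof.
move=> s0 hf; have [L hL] := circle_mean_exists s0.
have z0 : modC (0 : C) <= s / 2 by rewrite modC0 divr_ge0 // ltW.
have hs z : modC z <= s / 2 -> modC z < s by move: s0; lra.
have bf u : modC u <= s -> bdd_on s B (f u).
  by move=> us v vs; have [] := hf u v us; rewrite ?vs.
pose g b w := fun u => cauchy_mean L (f u) b w.
have bg b w : modC w <= s / 2 -> bdd_on s (2 * (ckernel_bound s b * B)) (g b w).
  by move=> ws u us; apply: (cauchy_mean_le s0 hL) => //; apply: bf; rewrite us.
pose Phi a b z w := cauchy_mean L (g b w) a z.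
have PhiE z w : modC z <= s / 2 -> modC w <= s / 2 -> Phi 0 0 z w = f z w.
  move=> zs ws.
  rewrite /Phi /cauchy_mean (mean_ext hL (v := fun u => f u w * (u / (u - z)))).
    apply: (mean_cauchy hL (B := B)) => //; last exact: hs.
      move=> u us; have [] := hf u w us => //; exact/ltW/hs.
    by move=> u us; have [] := hf u w; rewrite ?us //; exact/ltW/hs.
  move=> u us; rewrite /ckernel expr1 mulrC; congr (_ * _).
  rewrite /g /cauchy_mean (mean_ext hL (v := fun v => f u v * (v / (v - w)))).
    apply: (mean_cauchy hL (B := B)) => //; last exact: hs.
      by move=> v vs; have [] := hf u v _ vs; rewrite ?us.
    by apply: bf; rewrite us.
  by move=> v vs; rewrite /ckernel expr1 mulrC.
have B0 : 0 <= B.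
  by apply: (bdd_ge0 s0 (bf 0 _)); rewrite modC0 ltW.
exists Phi; split => //.
- move=> a b; exists (2 * (ckernel_bound s a * (2 * (ckernel_bound s b * B)))) => z w zs ws.
  by apply: (cauchy_mean_le s0 hL) => //; apply: bg.
- move=> a b; exists (2 * (ckernel_defect s a * (2 * (ckernel_bound s b * B)))) => z h w zs hzs ws.
  apply: (le_trans (cauchy_mean_est s0 hL a (bg b w ws) zs hzs)).
  by rewrite le_eqVlt; apply/orP; left; apply/eqP; ring.
- move=> a b; exists (2 * (ckernel_bound s a * (2 * (ckernel_defect s b * B)))) => z w h zs ws hws.
  have b1 := bdd_ckernel s0 a (bg b _ hws) zs.
  have b2 := bdd_ckernel s0 a (bg b _ ws) zs.
  have b3 := bdd_ckernel s0 a (bg b.+1 _ ws) zs.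
  have -> : Phi a b z (w + h) - Phi a b z w - b.+1%:R * h * Phi a b.+1 z w =
      L (fun u => ckernel a u z * g b (w + h) u + (-1) * (ckernel a u z * g b w u)
           + (- (b.+1%:R * h)) * (ckernel a u z * g b.+1 w u)).
    by rewrite (mean_lin hL (-1) _ b1 b2 b3) mulN1r mulNr.
  rewrite [leRHS](_ : _ = 2 * (ckernel_bound s a * (2 * (ckernel_defect s b * modC h ^+ 2 * B)))); last by ring.
  apply: (mean_le hL) => u us.
  rewrite mulN1r mulNr [b.+1%:R * h * (_ * _)]mulrCA -!mulrBr.
  rewrite modCM ler_pM ?modC_ge0 ?ckernel_le //.
  by apply: cauchy_mean_est => //; apply: bf; rewrite us.
- exists (32 * B) => N z w zs ws.
  have zh : modC z / s <= 2^-1 by rewrite ler_pdivrMr //; move: zs; lra.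
  have zh0 : 0 <= modC z / s by rewrite divr_ge0 ?modC_ge0 // ltW.
  have wh0 : 0 <= modC w / s by rewrite divr_ge0 ?modC_ge0 // ltW.
  have -> : 2 * (s / 2) = s by field.
  rewrite -(PhiE _ _ zs ws).
  have t1 := cauchy_mean_taylor s0 hL N (bg 0 w ws) zs; rewrite -/(Phi 0 0 z w) in t1.
  have t2 i : modC (cauchy_mean L (g 0 w) i 0 - \sum_(0 <= b < N) w ^+ b * Phi i b 0 0) <=
     8 * B * (modC w / s) ^+ N * (s^-1) ^+ i.
    have [[B' hb] e] := mean_sum hL (fun b => w ^+ b) N (fun b => bdd_ckernel s0 i (bg b 0 z0) z0).
    rewrite -[X in _ - X]e -mulN1r.
    have := mean_lin hL (-1) 0 (bdd_ckernel s0 i (bg 0 w ws) z0) hb hb.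
    rewrite -/(cauchy_mean L (g 0 w) i 0) mul0r addr0 => <-.
    rewrite [leRHS](_ : _ = 2 * (s^-1 ^+ i * (4 * B * (modC w / s) ^+ N))); last by ring.
    apply: (mean_le hL) => u us; rewrite mul0r addr0 mulN1r.
    have u0 : u != 0 by rewrite -modC_gt0 us.
    have -> : \sum_(0 <= b < N) w ^+ b * (ckernel i u 0 * g b 0 u) =
        ckernel i u 0 * (\sum_(0 <= b < N) w ^+ b * g b 0 u).
      by rewrite mulr_sumr; apply: eq_bigr => b _; rewrite mulrCA.
    rewrite -mulrBr modCM ckernel0E // modCX modCV us; apply: ler_wpM2l.
      by rewrite exprn_ge0 // invr_ge0 ltW.
    by apply: cauchy_mean_taylor => //; apply: bf; rewrite us.
  rewrite (_ : _ - _ = (Phi 0 0 z w - \sum_(0 <= i < N) z ^+ i * cauchy_mean L (g 0 w) i 0)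
     + \sum_(0 <= i < N) z ^+ i * (cauchy_mean L (g 0 w) i 0 - \sum_(0 <= b < N) w ^+ b * Phi i b 0 0)); last first.
    rewrite -addrA; congr (_ + _); rewrite -sumrN -[X in X + _]sumrN -big_split /=.
    by apply: eq_bigr => i _; rewrite mulrBr addKr.
  apply: (le_trans (modCD _ _)).
  have t3 : modC (\sum_(0 <= i < N) z ^+ i * (cauchy_mean L (g 0 w) i 0 - \sum_(0 <= b < N) w ^+ b * Phi i b 0 0))
     <= 8 * B * (modC w / s) ^+ N * 2.
    apply: (le_trans (modC_sum _ _ _)).
    apply: (@le_trans _ _ (8 * B * (modC w / s) ^+ N * \sum_(0 <= i < N) (modC z / s) ^+ i)).
      rewrite mulr_sumr; apply: ler_sum => i _.
      rewrite modCM modCX (exprMn i (modC z)) [leRHS](_ : _ = modC z ^+ i * (8 * B * (modC w / s) ^+ N * s^-1 ^+ i)); last by ring.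
      by apply: ler_wpM2l; rewrite ?exprn_ge0 ?modC_ge0 ?t2.
    by apply: ler_wpM2l; rewrite ?mulr_ge0 ?exprn_ge0 ?geom_half.
  have e1 : 4 * (2 * (ckernel_bound s 0 * B)) = 16 * B.
    by rewrite /ckernel_bound expr1; field; apply: lt0r_neq0.
  rewrite e1 in t1.
  have p1 : 0 <= B * (modC z / s) ^+ N by rewrite mulr_ge0 ?exprn_ge0.
  have p2 : 0 <= B * (modC w / s) ^+ N by rewrite mulr_ge0 ?exprn_ge0.
  by move: t1 t3 p1 p2; lra.
Qed.

Section Consequences.
Variables (s : R) (f : C -> C -> C) (Phi : nat -> nat -> C -> C -> C).
Hypotheses (s0 : 0 < s) (hP : biseries s f Phi).

Lemma biseries_lip : exists2 K : R, 0 <= K & forall z w z' w',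
  modC z <= s -> modC w <= s -> modC z' <= s -> modC w' <= s ->
  modC (f z w - f z' w') <= K * (modC (z - z') + modC (w - w')).
Proof.
have [K1 h1] := bs_bound hP 1 0; have [K2 h2] := bs_bound hP 0 1.
have [K3 h3] := bs_dz hP 0 0; have [K4 h4] := bs_dw hP 0 0.
pose K := `|K1| + `|K2| + 2 * s * `|K3| + 2 * s * `|K4|.
have K0 : 0 <= K by rewrite !addr_ge0 // !mulr_ge0 // ltW.
have dist (x y : C) : modC x <= s -> modC y <= s -> modC (x - y) <= 2 * s.
  by move=> xs ys; apply: (le_trans (modCB _ _)); move: xs ys; lra.
have est (A K' : R) (F h : C) (P : C) : modC (F - 1%:R * h * P) <= K' * modC h ^+ 2 -> modC P <= A ->
    modC h <= 2 * s -> modC F <= (`|A| + 2 * s * `|K'|) * modC h.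
  move=> a1 a2 a3; rewrite (_ : F = (F - 1%:R * h * P) + h * P); last by ring.
  apply: (le_trans (modCD _ _)); rewrite modCM mulrDl [leRHS]addrC.
  have hh := modC_ge0 h.
  apply: lerD.
    apply: (le_trans a1); apply: (@le_trans _ _ (`|K'| * modC h ^+ 2)).
      by apply: ler_wpM2r; rewrite ?exprn_ge0 ?ler_norm.
    rewrite expr2 [leRHS](_ : _ = `|K'| * ((2 * s) * modC h)); last by ring.
    by rewrite ler_wpM2l // ler_wpM2r.
  rewrite mulrC; apply: ler_wpM2r => //; apply: (le_trans a2); exact: ler_norm.
exists K => // z w z' w' zs ws zs' ws'.
rewrite (_ : f z w - _ = (f z w - f z' w) + (f z' w - f z' w')); last by ring.
apply: (le_trans (modCD _ _)); rewrite mulrDr; apply: lerD.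
  have := h3 z' (z - z') w zs'; rewrite [z' + _]addrC subrK => /(_ zs ws) a1.
  rewrite !(bs_val hP) // in a1.
  apply: (le_trans (est _ _ _ _ _ a1 (h1 _ _ zs' ws) (dist _ _ zs zs'))).
  apply: ler_wpM2r; rewrite ?modC_ge0 // /K.
  have : 0 <= 2 * s * `|K4| by rewrite !mulr_ge0 // ltW.
  by have := normr_ge0 K2; lra.
have := h4 z' w' (w - w') zs' ws'; rewrite [w' + _]addrC subrK => /(_ ws) a1.
rewrite !(bs_val hP) // in a1.
apply: (le_trans (est _ _ _ _ _ a1 (h2 _ _ zs' ws') (dist _ _ ws ws'))).
apply: ler_wpM2r; rewrite ?modC_ge0 // /K.
have : 0 <= 2 * s * `|K3| by rewrite !mulr_ge0 // ltW.
by have := normr_ge0 K1; lra.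
Qed.

(** The Taylor remainders tend to 0 as N grows. *)
Lemma biseries_flat : (forall a b, Phi a b 0 0 = 0) ->
  forall z w, modC z <= s -> modC w <= s -> f z w = 0.
Proof.
move=> h0 z w zs ws; have [K hK] := bs_taylor hP.
apply/eqP; rewrite -modC_eq0 eq_le modC_ge0 andbT.
apply/ler_addgt0Pr => e e0; rewrite add0r.
have half x : modC x <= s -> modC x / (2 * s) <= 2^-1.
  by move=> xs; rewrite ler_pdivrMr ?mulr_gt0 //; move: xs; lra.
have pos x : 0 <= modC x / (2 * s) by rewrite divr_ge0 ?modC_ge0 // mulr_ge0 // ltW.
have q1 : `|2^-1 : R| < 1 by rewrite ger0_norm; lra.
have e1 : 0 < e / (2 * (`|K| + 1)) by rewrite divr_gt0 // mulr_gt0 // ltr_wpDl.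
have [N hN] : exists N, (2^-1 : R) ^+ N <= e / (2 * (`|K| + 1)).
  have := cvg_expr q1 => /cvgrPdist_le /(_ _ e1) [N _ hN].
  by exists N; have := hN N (leqnn N); rewrite /= sub0r normrN ger0_norm // exprn_ge0.
have := hK N z w zs ws; rewrite big1 ?subr0; last first.
  by move=> a _; rewrite big1 ?mulr0 // => b _; rewrite h0 mulr0.
move/le_trans; apply.
have a1 : (modC z / (2 * s)) ^+ N <= e / (2 * (`|K| + 1)).
  by apply: le_trans hN; rewrite lerXn2r ?nnegrE ?half // invr_ge0.
have a2 : (modC w / (2 * s)) ^+ N <= e / (2 * (`|K| + 1)).
  by apply: le_trans hN; rewrite lerXn2r ?nnegrE ?half // invr_ge0.
have k1 : 0 < `|K| + 1 by rewrite ltr_wpDl.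
apply: (@le_trans _ _ ((`|K| + 1) * (e / (2 * (`|K| + 1)) + e / (2 * (`|K| + 1))))); last first.
  by rewrite le_eqVlt; apply/orP; left; apply/eqP; field; apply: lt0r_neq0.
apply: (@le_trans _ _ (`|K| * ((modC z / (2 * s)) ^+ N + (modC w / (2 * s)) ^+ N))).
  by apply: ler_wpM2r; rewrite ?addr_ge0 ?exprn_ge0 ?ler_norm.
apply: ler_pM; rewrite ?addr_ge0 ?exprn_ge0 ?lerD //.
by rewrite lerDl.
Qed.

End Consequences.
End TwoVariables.

(** * Differentiable germs and their jets *)

Section Bridge.
Variable R : realType.
Local Notation C := (CC R).
Local Notation C2 := (CC2 R).

Lemma modC_lt (z : C) (e : R) : (`|z| < cR e) = (modC z < e).
Proof. by rewrite -cR_modC lt_cR. Qed.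

Lemma norm2_lt (q : C2) (e : R) : (`|q| < cR e) = (modC q.1 < e) && (modC q.2 < e).
Proof.
rewrite prod_normE -!cR_modC (_ : Num.max _ _ = cR (Num.max (modC q.1) (modC q.2))).
  by rewrite lt_cR gt_max.
by rewrite /Order.max lt_cR; case: ifP.
Qed.

Lemma pos_cR (e : C) : 0 < e -> exists2 r : R, 0 < r & e = cR r.
Proof.
move=> e0; exists (complex.Re e); last by rewrite /cR RRe_real // gtr0_real.
by rewrite -lt_cR /cR RRe_real // gtr0_real.
Qed.

Lemma nbhs0P (P : C -> Prop) : (\forall h \near (0 : C), P h) <->
  exists2 d : R, 0 < d & forall h : C, modC h < d -> P h.
Proof.
rewrite nbhs_normP; split.
  move=> [e /= /pos_cR [r r0 ->] he]; exists r => // h hr; apply: he.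
  by rewrite /= sub0r normrN modC_lt.
move=> [d d0 hd]; exists (cR d); first by rewrite /= lt_cR.
by move=> h /=; rewrite sub0r normrN modC_lt; apply: hd.
Qed.

Lemma nbhs2P (p : C2) (P : C2 -> Prop) : (\forall q \near p, P q) <->
  exists2 d : R, 0 < d & forall z w : C, modC z < d -> modC w < d -> P (p + (z, w)).
Proof.
rewrite nbhs_normP; split.
  move=> [e /= /pos_cR [r r0 ->] he]; exists r => // z w zr wr; apply: he.
  by rewrite /= opprD addNKr normrN norm2_lt /= zr wr.
move=> [d d0 hd]; exists (cR d); first by rewrite /= lt_cR.
move=> q /=; rewrite distrC norm2_lt /= => /andP[h1 h2].
have := hd _ _ h1 h2.
by rewrite -[X in p + X](surjective_pairing (q - p)) addrC subrK.
Qed.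

Lemma derivable_eps (f : C2 -> C2) (x v : C2) : derivable f x v ->
  forall eps : R, 0 < eps -> exists2 d : R, 0 < d & forall h : C, modC h < d ->
  modC ((f (h *: v + x)).1 - (f x).1 - h * ('D_v f x).1) <= eps * modC h /\
  modC ((f (h *: v + x)).2 - (f x).2 - h * ('D_v f x).2) <= eps * modC h.
Proof.
move=> /cvgrPdist_lt hd eps e0.
have ce : (0 : C) < cR eps by rewrite lt_cR.
have := hd _ ce; rewrite near_withinE => /nbhs0P [d d0 H].
exists d => // h hh; have [->|hn] := eqVneq h 0.
  by rewrite scale0r add0r !subrr !mul0r subrr modC0 mulr0.
have := H h hh hn; rewrite -/('D_v f x) norm2_lt /= => /andP[h1 h2].
have key (a b c : C) : modC (a - h^-1 * (b - c)) < eps -> modC (b - c - h * a) <= eps * modC h.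
  move=> k; rewrite (_ : b - c - h * a = - h * (a - h^-1 * (b - c))); last by field.
  by rewrite modCM modCN mulrC ler_wpM2r ?modC_ge0 // ltW.
by split; apply: key.
Qed.

Lemma derive_from_est (f : C2 -> C2) (x v b : C2) (K d : R) : 0 < d ->
  (forall h : C, modC h < d ->
   modC ((f (h *: v + x)).1 - (f x).1 - h * b.1) <= K * modC h ^+ 2 /\
   modC ((f (h *: v + x)).2 - (f x).2 - h * b.2) <= K * modC h ^+ 2) ->
  'D_v f x = b.
Proof.
move=> d0 H; apply: cvg_lim => //; apply/cvgrPdist_lt => e /pos_cR [r r0 ->].
rewrite near_withinE; apply/nbhs0P.
exists (Num.min d (r / (`|K| + 1))); first by rewrite lt_min d0 divr_gt0 // ltr_wpDl.
move=> h; rewrite lt_min => /andP[h1 h2] hn.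
have [k1 k2] := H h h1; rewrite norm2_lt /=.
have hp : 0 < modC h by rewrite modC_gt0.
have key (a b' c : C) : modC (b' - c - h * a) <= K * modC h ^+ 2 -> modC (a - h^-1 * (b' - c)) < r.
  move=> k; rewrite (_ : a - h^-1 * (b' - c) = - h^-1 * (b' - c - h * a)); last by field.
  rewrite modCM modCN modCV ltr_pdivrMl //; apply: (le_lt_trans k).
  move: h2; rewrite ltr_pdivlMr ?ltr_wpDl // => h2.
  rewrite expr2 mulrA [ltRHS]mulrC ltr_pM2r // mulrC.
  apply: le_lt_trans h2; apply: ler_wpM2l; first exact: ltW.
  by have := ler_norm K; lra.
by apply/andP; split; apply: key.
Qed.

Lemma differentiable_coord (f : C2 -> C2) (x : C2) : differentiable f x ->
  [/\ cdifferentiable (fun z => (f (z, x.2)).1) x.1, cdifferentiable (fun z => (f (z, x.2)).2) x.1,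
      cdifferentiable (fun w => (f (x.1, w)).1) x.2 & cdifferentiable (fun w => (f (x.1, w)).2) x.2].
Proof.
move=> df.
have d1 := derivable_eps (diff_derivable (v := @e1 R) df).
have d2 := derivable_eps (diff_derivable (v := @e2 R) df).
have E1 z' : (z' - x.1) *: @e1 R + x = (z', x.2).
  rewrite [LHS]surjective_pairing; congr (_, _).
    by change ((z' - x.1) * 1 + x.1 = z'); rewrite mulr1 subrK.
  by change ((z' - x.1) * 0 + x.2 = x.2); rewrite mulr0 add0r.
have E2 w' : (w' - x.2) *: @e2 R + x = (x.1, w').
  rewrite [LHS]surjective_pairing; congr (_, _).
    by change ((w' - x.2) * 0 + x.1 = x.1); rewrite mulr0 add0r.
  by change ((w' - x.2) * 1 + x.2 = w'); rewrite mulr1 subrK.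
have ex : f x = f (x.1, x.2) by rewrite -surjective_pairing.
split.
- exists ('D_(@e1 R) f x).1 => eps e0; have [d d0 hd] := d1 eps e0; exists d => // z' hz.
  by have [k1 k2] := hd _ hz; rewrite E1 ex in k1 k2; rewrite mulrC.
- exists ('D_(@e1 R) f x).2 => eps e0; have [d d0 hd] := d1 eps e0; exists d => // z' hz.
  by have [k1 k2] := hd _ hz; rewrite E1 ex in k1 k2; rewrite mulrC.
- exists ('D_(@e2 R) f x).1 => eps e0; have [d d0 hd] := d2 eps e0; exists d => // z' hz.
  by have [k1 k2] := hd _ hz; rewrite E2 ex in k1 k2; rewrite mulrC.
- exists ('D_(@e2 R) f x).2 => eps e0; have [d d0 hd] := d2 eps e0; exists d => // z' hz.
  by have [k1 k2] := hd _ hz; rewrite E2 ex in k1 k2; rewrite mulrC.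
Qed.

Definition coord1 (p : C2) (f : C2 -> C2) (z w : C) : C := (f (p + (z, w))).1.
Definition coord2 (p : C2) (f : C2 -> C2) (z w : C) : C := (f (p + (z, w))).2.

Lemma cdifferentiable_shift (f : C -> C) (p z : C) : cdifferentiable f (p + z) -> cdifferentiable (fun x => f (p + x)) z.
Proof.
move=> [b hb]; exists b => eps e0; have [d d0 hd] := hb eps e0; exists d => // z' hz.
have e : p + z' - (p + z) = z' - z by ring.
by have := hd (p + z'); rewrite e; apply.
Qed.

(** Boundedness on a small polydisc comes from continuity at p. *)
Lemma diff_near_sep_holo (f : C2 -> C2) (p : C2) :
  (\forall q \near p, differentiable f q) ->
  exists s B : R, [/\ 0 < s, sep_holo s B (coord1 p f) & sep_holo s B (coord2 p f)].
Proof.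
move=> hd.
have dp : differentiable f p by exact: nbhs_singleton hd.
have /(cvgrPdist_lt _ _).1 /(_ (cR 1)) : f q @[q --> p] --> f p by exact: differentiable_continuous.
rewrite lt_cR => /(_ ltr01) hc.
have /nbhs2P [d d0 H] : \forall q \near p, differentiable f q /\ `|f p - f q| < cR 1.
  by apply: filterS2 hd hc.
exists (d / 2), (modC (f p).1 + modC (f p).2 + 1).
have dd x : x <= d / 2 -> x < d by move: d0; lra.
have key z w : modC z <= d / 2 -> modC w <= d / 2 ->
   differentiable f (p + (z, w)) /\ modC (coord1 p f z w) <= modC (f p).1 + modC (f p).2 + 1
    /\ modC (coord2 p f z w) <= modC (f p).1 + modC (f p).2 + 1.
  move=> zs ws; have [df] := H z w (dd _ zs) (dd _ ws).
  rewrite distrC norm2_lt => /andP[/= h1 h2]; split => //.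
  have g1 := modC_sub_ge (f (p + (z, w))).1 (f p).1.
  have g2 := modC_sub_ge (f (p + (z, w))).2 (f p).2.
  have := modC_ge0 (f p).1; have := modC_ge0 (f p).2.
  by rewrite /coord1 /coord2; split; move: h1 h2 g1 g2; lra.
split; first by rewrite divr_gt0.
- move=> z w zs ws; have [df [b1 b2]] := key z w zs ws.
  have [c1 c2 c3 c4] := differentiable_coord df; split => //.
  + exact: (@cdifferentiable_shift (fun z => (f (z, p.2 + w)).1) p.1 z).
  + exact: (@cdifferentiable_shift (fun w => (f (p.1 + z, w)).1) p.2 w).
- move=> z w zs ws; have [df [b1 b2]] := key z w zs ws.
  have [c1 c2 c3 c4] := differentiable_coord df; split => //.
  + exact: (@cdifferentiable_shift (fun z => (f (z, p.2 + w)).2) p.1 z).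
  + exact: (@cdifferentiable_shift (fun w => (f (p.1 + z, w)).2) p.2 w).
Qed.

Lemma sep_holo_le (s s' B : R) f : s' <= s -> sep_holo s B f -> sep_holo s' B f.
Proof. by move=> ss h z w zs ws; apply: h; [exact: le_trans zs ss|exact: le_trans ws ss]. Qed.

Section Jets.
Variables (s : R) (f : C2 -> C2) (P1 P2 : nat -> nat -> C -> C -> C).
Hypotheses (s0 : 0 < s) (h1 : biseries s (coord1 0 f) P1) (h2 : biseries s (coord2 0 f) P2).

Lemma jet_e2 b z w : modC z < s -> modC w < s ->
  iter b (fun h => 'D_(@e2 R) h) f (z, w) = (b`!%:R * P1 0 b z w, b`!%:R * P2 0 b z w).
Proof.
elim: b z w => [|b ih] z w zs ws.
  rewrite fact0 !mul1r (bs_val h1) ?(bs_val h2) ?ltW // /coord1 /coord2 add0r /=.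
  by rewrite -surjective_pairing.
rewrite iterS.
have [K1 k1] := bs_dw h1 0 b; have [K2 k2] := bs_dw h2 0 b.
apply: (@derive_from_est _ _ _ _ (b`!%:R * `|K1| + b`!%:R * `|K2|) (s - modC w)); first by rewrite subr_gt0.
move=> h hh.
have ws' : modC (w + h) < s by apply: (le_lt_trans (modCD _ _)); move: hh; lra.
have -> : h *: @e2 R + (z, w) = (z, w + h).
  rewrite [LHS]surjective_pairing; congr (_, _).
    by change (h * 0 + z = z); rewrite mulr0 add0r.
  by change (h * 1 + w = w + h); rewrite mulr1 addrC.
rewrite !ih //=.
have key (K K' : R) (P : nat -> nat -> C -> C -> C) : modC (P 0 b z (w + h) - P 0 b z w - b.+1%:R * h * P 0 b.+1 z w) <= K * modC h ^+ 2 ->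
   b`!%:R * `|K| <= K' ->
   modC (b`!%:R * P 0 b z (w + h) - b`!%:R * P 0 b z w - h * (b.+1`!%:R * P 0 b.+1 z w)) <= K' * modC h ^+ 2.
  move=> a1 a2.
  rewrite factS natrM (_ : _ - _ = b`!%:R * (P 0 b z (w + h) - P 0 b z w - b.+1%:R * h * P 0 b.+1 z w)); last by ring.
  rewrite modCM modC_nat.
  apply: (@le_trans _ _ (b`!%:R * `|K| * modC h ^+ 2)).
    rewrite -[leRHS]mulrA ler_wpM2l //; apply: (le_trans a1).
    by rewrite ler_wpM2r ?exprn_ge0 ?modC_ge0 ?ler_norm.
  by rewrite ler_wpM2r ?exprn_ge0 ?modC_ge0.
split; [apply: (key K1) | apply: (key K2)].
- exact: k1 (ltW zs) (ltW ws) (ltW ws').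
- by rewrite lerDl mulr_ge0.
- exact: k2 (ltW zs) (ltW ws) (ltW ws').
- by rewrite lerDr mulr_ge0.
Qed.

(** The order of differentiation is that of [same_jet]: first in w, then in z. *)
Lemma jet_e1e2 a b z w : modC z < s -> modC w < s ->
  iter a (fun h => 'D_(@e1 R) h) (iter b (fun h => 'D_(@e2 R) h) f) (z, w)
    = (a`!%:R * (b`!%:R * P1 a b z w), a`!%:R * (b`!%:R * P2 a b z w)).
Proof.
elim: a z w => [|a ih] z w zs ws.
  change (iter b (fun h => 'D_(@e2 R) h) f (z, w) = (0`!%:R * (b`!%:R * P1 0 b z w), 0`!%:R * (b`!%:R * P2 0 b z w))).
  by rewrite (jet_e2 b zs ws) fact0; congr (_, _); rewrite mul1r.
rewrite iterS.
have [K1 k1] := bs_dz h1 a b; have [K2 k2] := bs_dz h2 a b.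
pose c : R := a`!%:R * b`!%:R.
have c0 : 0 <= c by rewrite mulr_ge0.
apply: (@derive_from_est _ _ _ _ (c * `|K1| + c * `|K2|) (s - modC z)); first by rewrite subr_gt0.
move=> h hh.
have zs' : modC (z + h) < s by apply: (le_lt_trans (modCD _ _)); move: hh; lra.
have -> : h *: @e1 R + (z, w) = (z + h, w).
  rewrite [LHS]surjective_pairing; congr (_, _).
    by change (h * 1 + z = z + h); rewrite mulr1 addrC.
  by change (h * 0 + w = w); rewrite mulr0 add0r.
rewrite !ih //=.
have key (K K' : R) (P : nat -> nat -> C -> C -> C) : modC (P a b (z + h) w - P a b z w - a.+1%:R * h * P a.+1 b z w) <= K * modC h ^+ 2 ->
   c * `|K| <= K' ->
   modC (a`!%:R * (b`!%:R * P a b (z + h) w) - a`!%:R * (b`!%:R * P a b z w) - h * (a.+1`!%:R * (b`!%:R * P a.+1 b z w))) <= K' * modC h ^+ 2.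
  move=> a1 a2.
  rewrite factS natrM (_ : _ - _ = (a`!%:R * b`!%:R) * (P a b (z + h) w - P a b z w - a.+1%:R * h * P a.+1 b z w)); last by ring.
  rewrite modCM (modCM a`!%:R) !modC_nat -/c.
  apply: (@le_trans _ _ (c * `|K| * modC h ^+ 2)).
    rewrite -[leRHS]mulrA ler_wpM2l //; apply: (le_trans a1).
    by rewrite ler_wpM2r ?exprn_ge0 ?modC_ge0 ?ler_norm.
  by rewrite ler_wpM2r ?exprn_ge0 ?modC_ge0.
split; [apply: (key K1) | apply: (key K2)].
- exact: k1 (ltW zs) (ltW zs') (ltW ws).
- by rewrite lerDl mulr_ge0.
- exact: k2 (ltW zs) (ltW zs') (ltW ws).
- by rewrite lerDr mulr_ge0.
Qed.

End Jets.

Lemma same_jet_coef (s : R) (f g : C2 -> C2) P1 P2 Q1 Q2 l : 0 < s ->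
  biseries s (coord1 0 f) P1 -> biseries s (coord2 0 f) P2 ->
  biseries s (coord1 0 g) Q1 -> biseries s (coord2 0 g) Q2 ->
  same_jet l 0 f g -> forall a b, (a + b <= l)%N ->
  P1 a b 0 0 = Q1 a b 0 0 /\ P2 a b 0 0 = Q2 a b 0 0.
Proof.
move=> s0 hf1 hf2 hg1 hg2 hj a b ab; have := hj a b ab.
have z0 : modC (0 : C) < s by rewrite modC0.
rewrite (jet_e1e2 hf1 hf2) // (jet_e1e2 hg1 hg2) // => -[].
have n0 k : (k`!)%:R != 0 :> C by rewrite pnatr_eq0 -lt0n fact_gt0.
by move=> /(mulfI (n0 a)) /(mulfI (n0 b)) -> /(mulfI (n0 a)) /(mulfI (n0 b)) ->.
Qed.

End Bridge.

(** * Polynomial functions *)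

Section PolyFun.
Variable F : numFieldType.

(** Identities between polynomials are kept as identities between functions;
    closure under the ring operations then gives cancellation of a nonzero
    factor, by [polyfun_eq0_neq0]. *)
Definition polyfun (h : F -> F) := exists p : {poly F}, forall x, h x = p.[x].

Lemma polyfun_cst c : polyfun (fun _ => c).
Proof. by exists c%:P => x; rewrite hornerC. Qed.
Lemma polyfun_id : polyfun (fun x => x).
Proof. by exists 'X => x; rewrite hornerX. Qed.
Lemma polyfunD g h : polyfun g -> polyfun h -> polyfun (fun x => g x + h x).
Proof. by move=> [p hp] [q hq]; exists (p + q) => x; rewrite hornerD hp hq. Qed.
Lemma polyfunN h : polyfun h -> polyfun (fun x => - h x).
Proof. by move=> [p hp]; exists (- p) => x; rewrite hornerN hp. Qed.
Lemma polyfunM g h : polyfun g -> polyfun h -> polyfun (fun x => g x * h x).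
Proof. by move=> [p hp] [q hq]; exists (p * q) => x; rewrite hornerM hp hq. Qed.
Lemma polyfunX h n : polyfun h -> polyfun (fun x => h x ^+ n).
Proof. by move=> [p hp]; exists (p ^+ n) => x; rewrite horner_exp hp. Qed.
Lemma polyfun_sum (G : nat -> F -> F) m n : (forall i, polyfun (G i)) ->
  polyfun (fun x => \sum_(m <= i < n) G i x).
Proof.
move=> hG; elim: n => [|n [p hp]].
  by exists 0 => x; rewrite big_geq ?horner0.
have [mn|nm] := leqP m n; last by exists 0 => x; rewrite big_geq ?horner0.
have [q hq] := hG n; exists (p + q) => x.
by rewrite big_nat_recr //= hornerD hp hq.
Qed.

Lemma polyfun_eq0 h : polyfun h -> (forall n : nat, h n.+1%:R = 0) -> forall x, h x = 0.
Proof.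
move=> [p hp] h0 x; suff -> : h x = (0 : {poly F}).[x] by rewrite horner0.
rewrite hp; congr (_.[x]); apply/eqP; apply: contraT => pn0.
have := @max_poly_roots _ p [seq n.+1%:R | n <- iota 0 (size p)] pn0.
rewrite size_map size_iota ltnn => H; apply: H.
  by apply/allP => y /mapP [n _ ->]; rewrite /root -hp h0.
rewrite map_inj_uniq ?iota_uniq // => a b /eqP; rewrite eqr_nat => /eqP [].
done.
Qed.

Lemma polyfun_eq0_neq0 h : polyfun h -> (forall x, x != 0 -> h x = 0) -> forall x, h x = 0.
Proof. by move=> hp h0; apply: polyfun_eq0 => // n; apply: h0; rewrite pnatr_eq0. Qed.

Lemma coef_eq0 (c : nat -> F) N : (forall u, \sum_(0 <= j < N) c j * u ^+ j = 0) ->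
  forall j, (j < N)%N -> c j = 0.
Proof.
elim: N c => [//|N ih] c h j jN.
have e0 : c 0%N = 0.
  have := h 0; rewrite big_nat_recl // expr0 mulr1 big1 ?addr0 // => i _.
  by rewrite expr0n mulr0.
case: j jN => [//|j] jN; apply: (ih (fun i => c i.+1)) => //.
apply: polyfun_eq0_neq0.
  apply: polyfun_sum => i; apply: polyfunM; [exact: polyfun_cst|apply: polyfunX; exact: polyfun_id].
move=> u un; have := h u; rewrite big_nat_recl // e0 mul0r add0r => hu.
apply: (mulfI un); rewrite mulr0 -[RHS]hu mulr_sumr; apply: eq_bigr => i _.
by rewrite exprS; ring.
Qed.

Lemma coef_mono (c : nat -> F) N K a : (K < N)%N ->
  (forall u, \sum_(0 <= j < N) c j * u ^+ j = a * u ^+ K) ->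
  c K = a /\ forall j, (j < N)%N -> j != K -> c j = 0.
Proof.
move=> KN h.
have h' : forall u, \sum_(0 <= j < N) (c j - (j == K)%:R * a) * u ^+ j = 0.
  move=> u; under eq_bigr do rewrite mulrBl.
  rewrite big_split /= sumrN h; apply/eqP; rewrite subr_eq0; apply/eqP.
  rewrite big_mkord (bigD1 (Ordinal KN)) //= eqxx mul1r big1 ?addr0 // => i iK.
  by rewrite (_ : (i == K :> nat) = false) ?mul0r //; apply/negbTE.
have k := coef_eq0 h'.
split; first by have /eqP := k K KN; rewrite eqxx mul1r subr_eq0 => /eqP.
by move=> j jN jK; have /eqP := k j jN; rewrite (negbTE jK) mul0r subr0 => /eqP.
Qed.

Lemma sum_weighted_at0 (c : nat -> F) d N v : (0 < d)%N ->
  \sum_(0 <= j < N.+1) c j * 0 ^+ (d * (N - j)) * v ^+ j = c N * v ^+ N.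
Proof.
move=> d0; rewrite big_nat_recr //= subnn muln0 expr0 mulr1 big1_seq ?add0r // => i.
rewrite mem_index_iota => /andP[_ /andP[_ iN]].
rewrite expr0n muln_eq0 (gtn_eqF d0) /= subn_eq0 leqNgt iN /= mulr0 mul0r //.
Qed.

End PolyFun.

Ltac polyf := repeat first
  [ exact: polyfun_cst | exact: polyfun_id | apply: polyfunD | apply: polyfunN
  | apply: polyfunM | apply: polyfunX | (apply: polyfun_sum => ?) | eassumption ].

(** * The polarized equation of an infinitesimal automorphism *)

(** The variables stand for x = 1, y in the place of conj z, u in that of w and
    v = 2 p - u in that of conj w, where e = d - k0 and p = y^e p1, p_x = y^e p3,
    p_y = y^(e-1) p2.  The polynomials a and b are F0 and G0 at x = 1, while ab and
    bb are their conjugates at (y, v). *)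
Section ModelAlgebra.
Variable R : realType.
Local Notation C := (CC R).
Variables (d e k0 : nat) (al : C) (p1 p2 p3 : C -> C).
Hypotheses (dek : d = (e + k0)%N) (e0 : (0 < e)%N) (ek : (e <= k0)%N) (al0 : al != 0).
Hypotheses (hp1 : polyfun p1) (hp2 : polyfun p2) (hp3 : polyfun p3).
Hypotheses (p10 : p1 0 = al) (p20 : p2 0 = e%:R * al) (p30 : p3 0 = k0%:R * al).

Variables (m n : nat) (A B : nat -> C).
Hypothesis mn : (n.+1 = m + d)%N.

Let v y u := 2 * (y ^+ e * p1 y) - u.
Let a u := \sum_(0 <= j < (m %/ d).+1) A j * u ^+ j.
Let b u := \sum_(0 <= j < (n %/ d).+1) B j * u ^+ j.
Let ab y w := \sum_(0 <= j < (m %/ d).+1) Num.conj (A j) * y ^+ (m - d * j) * w ^+ j.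
Let bb y w := \sum_(0 <= j < (n %/ d).+1) Num.conj (B j) * y ^+ (n - d * j) * w ^+ j.

Hypothesis model_eq : forall y u, b u + bb y (v y u) =
  2 * (y ^+ e * p3 y * a u + y ^+ e.-1 * p2 y * ab y (v y u)).

Let d2 : (2 <= d)%N. Proof. lia. Qed.
Let d0 : (0 < d)%N. Proof. lia. Qed.
Let k00 : k0%:R != 0 :> C. Proof. by rewrite pnatr_eq0; lia. Qed.
Let two0 : 2 != 0 :> C. Proof. by rewrite pnatr_eq0. Qed.

Let v0 u : v 0 u = - u.
Proof. by rewrite /v expr0n (gtn_eqF e0) mul0r mulr0 sub0r. Qed.

Let conclusion := (forall j, (j < (m %/ d).+1)%N -> A j = 0) /\
  (forall j, (j < (n %/ d).+1)%N -> B j = 0).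

Let pfv u : polyfun (v^~ u).
Proof. rewrite /v; polyf. Qed.

(** At y = 0 only b survives, so b = 0; the coefficient of y^e then gives a = 0. *)
Lemma model_rigid_mod_ge2 N r : m = (d * N + r)%N -> (2 <= r < d)%N -> conclusion.
Proof.
move=> mE rd.
have mN : (m %/ d = N)%N by rewrite mE mulnC divnMDl // divn_small ?addn0 //; lia.
have nE : n = (d * N.+1 + r.-1)%N by rewrite mulnS; lia.
have nN : (n %/ d = N.+1)%N by rewrite nE mulnC divnMDl // divn_small ?addn0 //; lia.
pose k y w := \sum_(0 <= j < N.+1) Num.conj (A j) * y ^+ (d * (N - j)) * w ^+ j.
have abE y w : ab y w = y ^+ r * k y w.
  rewrite /ab mN mulr_sumr; apply: eq_big_nat => j /andP[_ jN].
  rewrite (_ : m - d * j = r + d * (N - j))%N; last by rewrite mulnBr mE; nia.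
  by rewrite exprD; ring.
pose kk y w := \sum_(0 <= j < N.+2) Num.conj (B j) * y ^+ (d * (N.+1 - j)) * w ^+ j.
have bbE y w : bb y w = y ^+ r.-1 * kk y w.
  rewrite /bb nN mulr_sumr; apply: eq_big_nat => j /andP[_ jN].
  rewrite (_ : n - d * j = r.-1 + d * (N.+1 - j))%N; last by rewrite mulnBr nE; nia.
  by rewrite exprD; ring.
have b0 u : b u = 0.
  have := model_eq 0 u; rewrite bbE abE !expr0n (gtn_eqF e0).
  rewrite (_ : (r.-1 == 0)%N = false); last by lia.
  rewrite (_ : (r == 0)%N = false); last by lia.
  by rewrite !mul0r !mulr0 !addr0 mulr0.
have hB : forall j, (j < (n %/ d).+1)%N -> B j = 0 by exact: coef_eq0 b0.
have bb0 y w : bb y w = 0.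
  by rewrite /bb big1_seq // => j; rewrite mem_index_iota => /andP[_ /andP[_ jN]]; rewrite hB // conjC0 !mul0r.
split=> //; apply: coef_eq0 => u.
pose h y := p3 y * a u + y ^+ r.-1 * p2 y * k y (v y u).
have ph : polyfun h.
  rewrite /h /k; have pv := pfv u; polyf.
have := polyfun_eq0_neq0 ph _ 0.
rewrite /h p30 expr0n (_ : (r.-1 == 0)%N = false) ?mul0r ?addr0; last by lia.
move=> H; apply: (mulfI (mulf_neq0 k00 al0)); rewrite mulr0; apply: H => y y0.
apply: (mulfI (expf_neq0 e y0)); rewrite mulr0.
have := model_eq y u; rewrite b0 bb0 add0r abE => /esym/eqP; rewrite mulf_eq0 (negbTE two0) /= => /eqP <-.
rewrite -[in RHS](prednK e0) -[in RHS](prednK (_ : 0 < r)%N); last by lia.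
by rewrite [y ^+ e.-1.+1]exprS [y ^+ r.-1.+1]exprS -{1}(prednK e0) exprS; ring.
Qed.

Let divpow (x w : C) N : x ^+ N.+1 - w ^+ N.+1 = (x - w) * \sum_(i < N.+1) x ^+ (N - i) * w ^+ i.
Proof. by rewrite subrXX. Qed.

Let S (N : nat) (x w : C) := \sum_(0 <= i < N.+1) x ^+ (N - i) * w ^+ i.
Let divpowS (x w : C) N : x ^+ N.+1 - w ^+ N.+1 = (x - w) * S N x w.
Proof. by rewrite divpow /S big_mkord. Qed.
Let S_diag N (x : C) : S N x x = N.+1%:R * x ^+ N.
Proof.
transitivity (\sum_(0 <= i < N.+1) x ^+ N); last by rewrite sumr_const_nat subn0 mulr_natl.
by apply: eq_big_nat => i /andP[_ iN]; rewrite -exprD subnK // -ltnS.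
Qed.

(** At y = 0 the equation gives b u = B u^(N+1), and its coefficient of y^e gives
    a u = A u^N with k0 A = +- ((N+1) conj B - e conj A).  On the slice v = 0 it
    gives B = k0 A.  Hence k0 |A| = ((N+1) k0 - e) |A|, which forces A = 0 because
    e <= k0 and N >= 2. *)
Lemma model_rigid_mod1 N : m = (d * N).+1 -> (2 <= N)%N -> conclusion.
Proof.
move=> mE N2.
have mN : (m %/ d = N)%N by rewrite mE mulnC -addn1 divnMDl // divn_small ?addn0.
have nE : n = (d * N.+1)%N by rewrite mulnS; lia.
have nN : (n %/ d = N.+1)%N by rewrite nE mulKn.
pose k y w := \sum_(0 <= j < N.+1) Num.conj (A j) * y ^+ (d * (N - j)) * w ^+ j.
have abE y w : ab y w = y * k y w.
  rewrite /ab mN mulr_sumr; apply: eq_big_nat => j /andP[_ jN].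
  rewrite (_ : m - d * j = (d * (N - j)).+1)%N; last by rewrite mulnBr mE; nia.
  by rewrite exprS; ring.
pose kk y w := \sum_(0 <= j < N.+2) Num.conj (B j) * y ^+ (d * (N.+1 - j)) * w ^+ j.
have bbE y w : bb y w = kk y w.
  by rewrite /bb nN; apply: eq_bigr => j _; rewrite nE -mulnBr.
pose cA := Num.conj (A N); pose cB := Num.conj (B N.+1).
have pye (y : C) : y ^+ e = y * y ^+ e.-1 by rewrite -{1}(prednK e0) exprS.
have bu u : b u = - cB * (-1) ^+ N.+1 * u ^+ N.+1.
  have := model_eq 0 u; rewrite bbE abE /kk sum_weighted_at0 // v0 pye !mul0r !mulr0 addr0 mulr0.
  by move=> /eqP; rewrite addr_eq0 => /eqP ->; rewrite (exprNn u) /cB; ring.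
have [BN Bj] : B N.+1 = - cB * (-1) ^+ N.+1 /\ forall j, (j < N.+2)%N -> j != N.+1 -> B j = 0.
  by apply: coef_mono => // u; rewrite -bu /b nN.
have bbE' y w : bb y w = cB * w ^+ N.+1.
  rewrite bbE /kk big_nat_recr //= subnn muln0 expr0 mulr1 big1_seq ?add0r // => j.
  rewrite mem_index_iota => /andP[_ /andP[_ jN]].
  by rewrite Bj ?conjC0 ?mul0r //; lia.
have step u : cB * al * (N.+1%:R * (- u) ^+ N) = k0%:R * al * a u + e%:R * al * cA * (- u) ^+ N.
  pose h y := cB * p1 y * S N (v y u) (- u) - (p3 y * a u + p2 y * k y (v y u)).
  have ph : polyfun h.
    by rewrite /h /k /S; have pv := pfv u; polyf.
  have H : h 0 = 0.
    apply: (polyfun_eq0_neq0 ph) => y y0.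
    have := model_eq y u; rewrite bu bbE' abE.
    have -> : - cB * (-1) ^+ N.+1 * u ^+ N.+1 = - cB * (- u) ^+ N.+1 by rewrite (exprNn u); ring.
    rewrite -[_ + _]/(- cB * _ + cB * _) mulNr addrC -mulrBr divpowS.
    rewrite {1}/v opprK subrK => E.
    apply: (mulfI (mulf_neq0 two0 (expf_neq0 e y0))); rewrite mulr0 /h mulrBr.
    apply/eqP; rewrite subr_eq0; apply/eqP.
    transitivity (cB * (2 * (y ^+ e * p1 y) * S N (v y u) (- u))); first by ring.
    rewrite E; rewrite (pye y); ring.
  move: H; rewrite /h v0 S_diag p10 p20 p30 /k sum_weighted_at0 // => /eqP; rewrite subr_eq0 => /eqP ->.
  by rewrite /cA; ring.
have au u : a u = ((N.+1%:R * cB - e%:R * cA) * (-1) ^+ N / k0%:R) * u ^+ N.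
  have E := step u; rewrite (exprNn u) in E; apply: (mulfI (mulf_neq0 k00 al0)).
  transitivity (cB * al * (N.+1%:R * ((-1) ^+ N * u ^+ N)) - e%:R * al * cA * ((-1) ^+ N * u ^+ N)).
    by rewrite E; ring.
  by field.
have [AN Aj] : A N = (N.+1%:R * cB - e%:R * cA) * (-1) ^+ N / k0%:R /\ forall j, (j < N.+1)%N -> j != N -> A j = 0.
  by apply: coef_mono => // u; rewrite -au /a mN.
(* at u = 2 p, hence v = 0, the conjugate terms disappear *)
have BA : B N.+1 = k0%:R * A N.
  pose h y := p1 y ^+ N * (B N.+1 * p1 y - p3 y * A N).
  have ph : polyfun h by rewrite /h; polyf.
  have : h 0 = 0.
    apply: (polyfun_eq0_neq0 ph) => y y0.
    pose u := 2 * (y ^+ e * p1 y).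
    have := model_eq y u; rewrite /v subrr bbE' abE expr0n /= mulr0 addr0.
    have k00' : k y 0 = 0.
      rewrite /k big_nat_recl // Aj ?conjC0 ?mul0r ?add0r //; last by lia.
      by rewrite big1 // => j _; rewrite expr0n /= mulr0.
    rewrite k00' !mulr0 addr0 bu -BN au -AN => E.
    have eu : u = 2 * y ^+ e * p1 y by rewrite /u; ring.
    have yn : (2 * y ^+ e) ^+ N.+1 != 0 by rewrite expf_neq0 // mulf_neq0 // expf_neq0.
    apply: (mulfI yn); rewrite mulr0 /h.
    apply/eqP; rewrite mulrBr mulrBr subr_eq0; apply/eqP.
    transitivity (B N.+1 * u ^+ N.+1).
      by rewrite eu (exprMn N.+1 (2 * y ^+ e)) (exprS (p1 y)); ring.
    by rewrite E eu (exprMn N (2 * y ^+ e)) (exprS (2 * y ^+ e)); ring.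
  rewrite /h p10 p30 => /eqP; rewrite mulf_eq0 expf_eq0 (negbTE al0) andbF /=.
  rewrite subr_eq0 => /eqP E; apply: (mulIf al0); rewrite E; ring.
have A0 : A N = 0.
  have E : k0%:R * A N = (-1) ^+ N * ((N.+1 * k0 - e)%:R * cA).
    rewrite {1}AN mulrC divfK // /cB BA rmorphM /= rmorph_nat -/cA natrB; last by nia.
    by rewrite natrM; ring.
  have : modC (k0%:R * A N) = modC ((N.+1 * k0 - e)%:R * A N).
    rewrite E (modCM ((-1) ^+ N)) modCX modCN modC1 expr1n mul1r !modCM.
    by rewrite /cA modCJ.
  rewrite !modCM !modC_nat => /eqP; rewrite -subr_eq0 -mulrBl mulf_eq0 => /orP[|].
    rewrite subr_eq0 eqr_nat => /eqP h; exfalso; nia.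
  by rewrite modC_eq0 => /eqP.
split; rewrite ?mN ?nN => j jN.
  by have [->|h] := eqVneq j N; [exact: A0|exact: Aj].
by have [->|h] := eqVneq j N.+1; [rewrite BA A0 mulr0|exact: Bj].
Qed.

(** Here y = 0 gives b u = 2 [e = 1] al conj (A N) (-u)^N.  If e > 1 everything
    vanishes in turn.  If e = 1, the coefficient of y shows that a has only two
    terms, A u^N + A' u^(N-1), with k0 A' = N B, while the slice v = 0 gives
    B = k0 A'; so B = N B and N >= 2 forces B = 0. *)
Lemma model_rigid_mod0 N : m = (d * N)%N -> (2 <= N)%N ->
  (exists q, polyfun q /\ forall y, p2 y = e%:R * al + y * q y) -> conclusion.
Proof.
move=> mE N2 [q [hq p2E]].
have mN : (m %/ d = N)%N by rewrite mE mulKn.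
have nE : n = (d * N + d.-1)%N by lia.
have nN : (n %/ d = N)%N by rewrite nE mulnC divnMDl // divn_small ?addn0 //; lia.
pose kk y w := \sum_(0 <= j < N) Num.conj (A j) * y ^+ (d * (N - j.+1)) * w ^+ j.
pose cA := Num.conj (A N).
have abE y w : ab y w = cA * w ^+ N + y ^+ d * kk y w.
  rewrite /ab mN big_nat_recr //= mE subnn expr0 mulr1 addrC; congr (_ + _).
  rewrite mulr_sumr; apply: eq_big_nat => j /andP[_ jN].
  rewrite (_ : d * N - d * j = d + d * (N - j.+1))%N; last by rewrite !mulnBr mulnS; nia.
  by rewrite exprD; ring.
pose bk y w := \sum_(0 <= j < N.+1) Num.conj (B j) * y ^+ (d * (N - j)) * w ^+ j.
have bbE y w : bb y w = y ^+ d.-1 * bk y w.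
  rewrite /bb nN mulr_sumr; apply: eq_big_nat => j /andP[_ jN].
  rewrite (_ : n - d * j = d.-1 + d * (N - j))%N; last by rewrite mulnBr nE; nia.
  by rewrite exprD; ring.
have pye (y : C) : y ^+ e = y * y ^+ e.-1 by rewrite -{1}(prednK e0) exprS.
have pyd (y : C) : y ^+ d = y * y ^+ d.-1 by rewrite -{1}(prednK d0) exprS.
have pd0 : (0 : C) ^+ d.-1 = 0 by rewrite expr0n; case: (d) d2 => [|[|]].
have bu u : b u = 2 * ((0 : C) ^+ e.-1 * (e%:R * al) * (cA * (- u) ^+ N)).
  have := model_eq 0 u; rewrite bbE abE pye pyd pd0 v0 p20.
  by rewrite !mul0r !addr0 add0r => ->.
have [e1|e1] := eqVneq e 1%N; last first.
  have pe0 : (0 : C) ^+ e.-1 = 0 by rewrite expr0n; case: (e) e0 e1 => [|[|]].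
  have b0 u : b u = 0 by rewrite bu pe0 !mul0r mulr0.
  have hB : forall j, (j < (n %/ d).+1)%N -> B j = 0 by exact: coef_eq0 b0.
  have bb0 y w : bb y w = 0.
    by rewrite /bb big1_seq // => j; rewrite mem_index_iota => /andP[_ /andP[_ jN]]; rewrite hB // conjC0 !mul0r.
  have E y u : y != 0 -> y * p3 y * a u + p2 y * ab y (v y u) = 0.
    move=> y0; apply: (mulfI (mulf_neq0 two0 (expf_neq0 e.-1 y0))); rewrite mulr0.
    have := model_eq y u; rewrite b0 bb0 add0r => /esym <-; rewrite pye; ring.
  have cA0 : cA = 0.
    pose h y := y * p3 y * a (-1) + p2 y * (cA * v y (-1) ^+ N + y ^+ d * kk y (v y (-1))).
    have ph : polyfun h by rewrite /h /kk; have pv := pfv (-1); polyf.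
    have := polyfun_eq0_neq0 ph _ 0; rewrite /h v0 p20 pyd !mul0r add0r addr0 opprK expr1n mulr1 => H.
    have /eqP : e%:R * al * cA = 0 by apply: H => y y0; rewrite -abE; exact: E.
    by rewrite mulf_eq0 mulf_eq0 pnatr_eq0 (negbTE al0) (gtn_eqF e0) /= => /eqP.
  split=> //; apply: coef_eq0 => u.
  pose h y := p3 y * a u + p2 y * (y ^+ d.-1 * kk y (v y u)).
  have ph : polyfun h by rewrite /h /kk; have pv := pfv u; polyf.
  have := polyfun_eq0_neq0 ph _ 0; rewrite /h p30 pd0 mul0r mulr0 addr0 => H.
  apply: (mulfI (mulf_neq0 k00 al0)); rewrite mulr0; apply: H => y y0.
  apply: (mulfI y0); rewrite mulr0 -(E y u y0) abE cA0 mul0r add0r pyd; ring.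
have {}bu u : b u = (2 * al * cA * (-1) ^+ N) * u ^+ N.
  by rewrite bu e1 expr0 (exprNn u) /=; ring.
have [BN Bj] : B N = 2 * al * cA * (-1) ^+ N /\ forall j, (j < N.+1)%N -> j != N -> B j = 0.
  by apply: coef_mono => // u; rewrite -bu /b nN.
pose cB := Num.conj (B N).
have bbE' y w : bb y w = cB * y ^+ d.-1 * w ^+ N.
  rewrite bbE /bk big_nat_recr //= subnn muln0 expr0 mulr1 big1_seq ?add0r; first by rewrite /cB; ring.
  move=> j; rewrite mem_index_iota => /andP[_ /andP[_ jN]].
  by rewrite Bj ?conjC0 ?mul0r //; lia.
have [N' NE] : exists N', N = N'.+1 by exists N.-1; lia.
pose q0 := cB * (0 : C) ^+ d.-2 - 2 * q 0 * cA.
have au u : 2 * (k0%:R * al * a u) = q0 * (- u) ^+ N - 4 * al ^+ 2 * cA * (N%:R * (- u) ^+ N').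
  pose h y := cB * y ^+ d.-2 * v y u ^+ N - 2 * q y * cA * v y u ^+ N
     - 4 * al * p1 y * cA * S N' (v y u) (- u)
     - 2 * (p3 y * a u) - 2 * (p2 y * (y ^+ d.-1 * kk y (v y u))).
  have ph : polyfun h by rewrite /h /kk /S; have pv := pfv u; polyf.
  have H : h 0 = 0.
    apply: (polyfun_eq0_neq0 ph) => y y0; apply: (mulfI y0); rewrite mulr0.
    have pdd : y ^+ d.-1 = y * y ^+ d.-2.
      by rewrite -exprS; congr (_ ^+ _); move: d2; lia.
    have D : v y u ^+ N - (- u) ^+ N = 2 * (y * p1 y) * S N' (v y u) (- u).
      by rewrite NE divpowS {1}/v opprK subrK e1 expr1.
    have := model_eq y u; rewrite bu bbE' abE e1 expr0 expr1 mul1r => E.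
    have {E}E : 2 * al * cA * (- u) ^+ N + cB * y ^+ d.-1 * v y u ^+ N =
        2 * (y * p3 y * a u + p2 y * (cA * v y u ^+ N + y ^+ d * kk y (v y u))).
      by rewrite -E (exprNn u); ring.
    rewrite /h.
    transitivity ((2 * al * cA * (- u) ^+ N + cB * y ^+ d.-1 * v y u ^+ N)
        - 2 * (y * p3 y * a u + p2 y * (cA * v y u ^+ N + y ^+ d * kk y (v y u)))
        + 2 * al * cA * ((v y u ^+ N - (- u) ^+ N) - 2 * (y * p1 y) * S N' (v y u) (- u))).
      rewrite [p2 y * (cA * _ + _)]mulrDr {2}p2E e1 pyd pdd; ring.
    by rewrite E D !subrr mulr0 addr0.
  move: H; rewrite /h v0 S_diag p10 p30 pd0 !mul0r mulr0 mulr0 subr0 -NE => /eqP.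
  rewrite subr_eq0 => /eqP <-.
  by rewrite /q0; ring.
pose c1 := q0 * (-1) ^+ N / (2 * (k0%:R * al)).
pose c2 := - (4 * al ^+ 2 * cA * (N%:R * (-1) ^+ N')) / (2 * (k0%:R * al)).
have kal : k0%:R * al != 0 by rewrite mulf_neq0.
have au' u : a u = c1 * u ^+ N + c2 * u ^+ N'.
  apply: (mulfI (mulf_neq0 two0 kal)); rewrite -[LHS]mulrA au /c1 /c2 !(exprNn u).
  by field; rewrite al0 k00.
have NN' : N' != N by rewrite NE; lia.
have [AN Aj] : A N - (N == N')%:R * c2 = c1 /\
    forall j, (j < N.+1)%N -> j != N -> A j - (j == N')%:R * c2 = 0.
  apply: (@coef_mono _ (fun j => A j - (j == N')%:R * c2)) => // u.
  under eq_bigr do rewrite mulrBl.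
  rewrite big_split /= sumrN -[X in X - _](_ : a u = _); last by rewrite /a mN.
  rewrite au' (_ : \sum_(_ <= _ < _) _ = c2 * u ^+ N') ?addrK //.
  have N'N : (N' < N.+1)%N by lia.
  rewrite big_mkord (bigD1 (Ordinal N'N)) //= eqxx mul1r big1 ?addr0 // => i iK.
  by rewrite (_ : (i == N' :> nat) = false) ?mul0r //; apply/negbTE.
rewrite eq_sym (negbTE NN') mul0r subr0 in AN.
have A0 : A 0%N = 0.
  have := Aj 0%N isT; rewrite (_ : (0 == N')%N = false) ?mul0r ?subr0; last by lia.
  by apply; lia.
(* the slice v = 0 again; A 0 = 0 makes the conjugate term vanish there *)
have Bc : B N = k0%:R * c2.
  pose h y := p1 y ^+ N' * (B N * p1 y - p3 y * (2 * c1 * (y * p1 y) + c2)).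
  have ph : polyfun h by rewrite /h; polyf.
  have : h 0 = 0.
    apply: (polyfun_eq0_neq0 ph) => y y0.
    pose u := 2 * (y ^+ e * p1 y).
    have := model_eq y u; rewrite /v subrr bbE' abE expr0n.
    rewrite (_ : (N == 0)%N = false) ?mulr0 ?addr0 ?add0r; last by lia.
    have kk0 : kk y 0 = 0.
      rewrite /kk NE big_nat_recl // A0 conjC0 !mul0r add0r.
      by rewrite big1 // => j _; rewrite expr0n /= mulr0.
    rewrite kk0 !mulr0 addr0 bu -BN au' => E.
    have eu : u = 2 * y * p1 y by rewrite /u e1; ring.
    have yn : (2 * y) ^+ N != 0 by rewrite expf_neq0 // mulf_neq0.
    apply: (mulfI yn); rewrite mulr0 /h.
    apply/eqP; rewrite mulrBr mulrBr subr_eq0; apply/eqP.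
    transitivity (B N * u ^+ N).
      by rewrite eu (exprMn N (2 * y)) NE (exprS (p1 y)); ring.
    rewrite E eu (exprMn N (2 * y)) (exprMn N' (2 * y)) NE (exprS (p1 y)) (exprS (2 * y)) e1; ring.
  rewrite /h p10 p30 mul0r mulr0 add0r => /eqP; rewrite mulf_eq0 expf_eq0 (negbTE al0) andbF /=.
  rewrite subr_eq0 => /eqP E; apply: (mulIf al0); rewrite E; ring.
have BNB : B N = N%:R * B N.
  rewrite {1}Bc BN /c2 NE (exprS (-1) N'); field.
  by rewrite al0 k00.
have BN0 : B N = 0.
  move/eqP: BNB; rewrite -subr_eq0 -{1}[B N]mul1r -mulrBl mulf_eq0 => /orP[|/eqP //].
  by rewrite subr_eq0 -[1]/(1%:R) eqr_nat => /eqP h; exfalso; lia.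
have cA0 : cA = 0.
  move/eqP: BN; rewrite BN0 eq_sym !mulf_eq0 expf_eq0 oppr_eq0 oner_eq0 (negbTE two0) (negbTE al0) /= andbF orbF.
  by move=> /eqP.
have AN0 : A N = 0 by apply/eqP; rewrite -conjC_eq0 -/cA cA0.
have c20 : c2 = 0 by rewrite /c2 cA0 mulr0 mul0r oppr0 mul0r.
split; rewrite ?mN ?nN => j jN; have [->|h] := eqVneq j N => //.
  by have := Aj j jN h; rewrite c20 mulr0 subr0.
by apply: Bj.
Qed.

End ModelAlgebra.

(** * Rigidity of the model in large weight *)

Section ModelRigid.
Variable R : realType.
Local Notation C := (CC R).
Variables (d k0 : nat) (alpha : nat -> C).
Hypotheses (hk : (d <= k0 + k0)%N) (kd : (k0 < d)%N).
Hypothesis hal : forall j, (d - k0 <= j <= k0)%N -> alpha j = Num.conj (alpha (d - j)%N).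

(** P(z, conj z) with z and conj z replaced by independent variables. *)
Definition pol (x y : C) : C := \sum_(d - k0 <= j < k0.+1) alpha j * x ^+ j * y ^+ (d - j).
Definition pol_x (x y : C) : C :=
  \sum_(d - k0 <= j < k0.+1) alpha j * (j%:R * x ^+ j.-1) * y ^+ (d - j).
Definition pol_y (x y : C) : C :=
  \sum_(d - k0 <= j < k0.+1) alpha j * x ^+ j * ((d - j)%:R * y ^+ (d - j).-1).

Let rev (f : nat -> C) : \sum_(d - k0 <= j < k0.+1) f j = \sum_(d - k0 <= j < k0.+1) f (d - j)%N.
Proof.
rewrite big_nat_rev /=; apply: eq_big_nat => j jb; congr f; lia.
Qed.

Lemma conj_pol (z : C) : Num.conj (pol z (Num.conj z)) = pol z (Num.conj z).
Proof.
rewrite rmorph_sum /= [RHS]rev; apply: eq_big_nat => j jb.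
rewrite !rmorphM /= !rmorphXn /= conjCK hal; last by lia.
rewrite conjCK (_ : d - (d - j) = j)%N; last by lia.
by ring.
Qed.

Lemma conj_pol_x (z : C) : Num.conj (pol_x z (Num.conj z)) = pol_y z (Num.conj z).
Proof.
rewrite rmorph_sum /= [RHS]rev; apply: eq_big_nat => j jb.
rewrite !rmorphM /= !rmorphXn /= rmorph_nat conjCK hal; last by lia.
rewrite conjCK (_ : d - (d - j) = j)%N; last by lia.
by ring.
Qed.

Variables (m n : nat) (A B : nat -> C).
Hypotheses (mn : (n.+1 = m + d)%N) (n3 : (3 * d <= n)%N).

(** A weighted homogeneous polynomial of weight m', for x of weight 1 and u of
    weight d. *)
Definition wsum (N m' : nat) (c : nat -> C) (x u : C) : C :=
  \sum_(0 <= j < N) c j * x ^+ (m' - d * j) * u ^+ j.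
Definition conj_seq (c : nat -> C) j := Num.conj (c j).
Let F0 := wsum (m %/ d).+1 m A.
Let G0 := wsum (n %/ d).+1 n B.
Let F0b := wsum (m %/ d).+1 m (conj_seq A).
Let G0b := wsum (n %/ d).+1 n (conj_seq B).

Lemma conj_wsum N m' c (x u : C) :
  Num.conj (wsum N m' c x u) = wsum N m' (conj_seq c) (Num.conj x) (Num.conj u).
Proof.
rewrite /wsum rmorph_sum; apply: eq_bigr => j _.
by rewrite !rmorphM /= !rmorphXn.
Qed.

Hypothesis model_id : forall (z : C) (t : R),
  let w := pol z (Num.conj z) + 'i * cR t in
  let X := pol_x z (Num.conj z) * F0 z w in
  G0 z w + Num.conj (G0 z w) = 2 * (X + Num.conj X).

Let defect (a b t : C) : C :=
  let x := a + 'i * b in let y := a - 'i * b in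
  let u := pol x y + 'i * t in let v := pol x y - 'i * t in
  G0 x u + G0b y v - 2 * (pol_x x y * F0 x u + pol_y x y * F0b y v).

Lemma defect_real (a b t : R) : defect (cR a) (cR b) (cR t) = 0.
Proof.
have [z ez1 ez] : exists2 z : C, cR a + 'i * cR b = z & cR a - 'i * cR b = Num.conj z.
  by exists (cR a + 'i * cR b) => //; rewrite rmorphD rmorphM /= conjCi !conj_cR mulNr.
have := model_id z t; rewrite /defect ez1 ez /= => /eqP; rewrite -subr_eq0 => /eqP <-.
have ev : pol z (Num.conj z) - 'i * cR t = Num.conj (pol z (Num.conj z) + 'i * cR t).
  by rewrite rmorphD rmorphM /= conjCi !conj_cR mulNr conj_pol.
by rewrite rmorphM /= conj_pol_x ev /G0 /F0 /G0b /F0b !conj_wsum.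
Qed.

(** A polynomial in a, b, t that vanishes at all natural numbers is zero. *)
Lemma defect_zero a b t : defect a b t = 0.
Proof.
have H1 n1 n2 : forall t, defect n1%:R n2%:R t = 0.
  apply: polyfun_eq0; first by rewrite /defect /G0 /G0b /F0 /F0b /wsum /pol /pol_x /pol_y; polyf.
  by move=> n3'; rewrite -!cRn defect_real.
have H2 n1 : forall b t, defect n1%:R b t = 0.
  move=> b' t'; move: b'; apply: polyfun_eq0; last by move=> n2; apply: H1.
  by rewrite /defect /G0 /G0b /F0 /F0b /wsum /pol /pol_x /pol_y; polyf.
move: a; apply: polyfun_eq0; last by move=> n1; apply: H2.
by rewrite /defect /G0 /G0b /F0 /F0b /wsum /pol /pol_x /pol_y; polyf.
Qed.

(** The points x = a + i b, y = a - i b, u = p + i t fill C^3 as a, b, t vary in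
    C; for real a, b, t they satisfy y = conj x, and 2 p - u is then conj u. *)
Lemma polarized (x y u : C) : let v := 2 * pol x y - u in
  G0 x u + G0b y v = 2 * (pol_x x y * F0 x u + pol_y x y * F0b y v).
Proof.
move=> v; apply/eqP; rewrite -subr_eq0; apply/eqP.
have i0 : 'i != 0 :> C by exact: neq0Ci.
have := defect_zero ((x + y) / 2) ((x - y) / (2 * 'i)) ((u - pol x y) / 'i).
rewrite /defect.
have -> : (x + y) / 2 + 'i * ((x - y) / (2 * 'i)) = x by field.
have -> : (x + y) / 2 - 'i * ((x - y) / (2 * 'i)) = y by field.
have -> : pol x y + 'i * ((u - pol x y) / 'i) = u by field.
have -> : pol x y - 'i * ((u - pol x y) / 'i) = v by rewrite /v; field.
by [].
Qed.

Hypothesis al0 : alpha k0 != 0.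

(** (F0, G0) is an infinitesimal automorphism of the model Re w = P.  By weighted
    homogeneity it suffices to look at x = 1; the residue of m modulo d decides
    which terms without y or of degree one in y occur. *)
Theorem model_rigid : (forall j, (j < (m %/ d).+1)%N -> A j = 0) /\
  (forall j, (j < (n %/ d).+1)%N -> B j = 0).
Proof.
pose e := (d - k0)%N.
pose p1 (y : C) := \sum_(d - k0 <= j < k0.+1) alpha j * y ^+ (k0 - j).
pose p2 (y : C) := \sum_(d - k0 <= j < k0.+1) alpha j * (d - j)%:R * y ^+ (k0 - j).
pose p3 (y : C) := \sum_(d - k0 <= j < k0.+1) alpha j * j%:R * y ^+ (k0 - j).
have at0 (c : nat -> C) : \sum_(d - k0 <= j < k0.+1) c j * 0 ^+ (k0 - j) = c k0.
  rewrite big_nat_recr; last by lia.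
  rewrite /= subnn expr0 mulr1 big1_seq ?add0r // => j.
  rewrite mem_index_iota => /andP[_ jb]; rewrite expr0n (_ : (k0 - j == 0)%N = false) ?mulr0 //; lia.
have e0 : (0 < e)%N by rewrite /e; lia.
have ek : (e <= k0)%N by rewrite /e; lia.
have dek : d = (e + k0)%N by rewrite /e; lia.
have hp1 : polyfun p1 by rewrite /p1; polyf.
have hp2 : polyfun p2 by rewrite /p2; polyf.
have hp3 : polyfun p3 by rewrite /p3; polyf.
have p10 : p1 0 = alpha k0 by rewrite /p1 at0.
have p20 : p2 0 = e%:R * alpha k0 by rewrite /p2 at0 mulrC.
have p30 : p3 0 = k0%:R * alpha k0 by rewrite /p3 at0 mulrC.
have polE y : pol 1 y = y ^+ e * p1 y.
  rewrite /pol /p1 mulr_sumr; apply: eq_big_nat => j jb.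
  by rewrite expr1n mulr1 mulrCA -exprD; congr (_ * _ ^+ _); rewrite /e; lia.
have polxE y : pol_x 1 y = y ^+ e * p3 y.
  rewrite /pol_x /p3 mulr_sumr; apply: eq_big_nat => j jb.
  by rewrite expr1n mulr1 mulrCA -exprD; congr (_ * _ ^+ _); rewrite /e; lia.
have polyE y : pol_y 1 y = y ^+ e.-1 * p2 y.
  rewrite /pol_y /p2 mulr_sumr; apply: eq_big_nat => j jb.
  rewrite expr1n mulr1 mulrA mulrCA -exprD; congr (_ * _ ^+ _); rewrite /e; lia.
have wsum1 N m' c u : wsum N m' c 1 u = \sum_(0 <= j < N) c j * u ^+ j.
  by apply: eq_bigr => j _; rewrite expr1n mulr1.
have model y u : \sum_(0 <= j < (n %/ d).+1) B j * u ^+ j + G0b y (2 * (y ^+ e * p1 y) - u) =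
  2 * (y ^+ e * p3 y * (\sum_(0 <= j < (m %/ d).+1) A j * u ^+ j)
     + y ^+ e.-1 * p2 y * F0b y (2 * (y ^+ e * p1 y) - u)).
  have := polarized 1 y u; rewrite polE polxE polyE /G0 /F0 !wsum1.
  by [].
have d0 : (0 < d)%N by lia.
pose r := (m %% d)%N; pose N := (m %/ d)%N.
have mE : m = (d * N + r)%N by rewrite mulnC; exact: divn_eq.
have rd : (r < d)%N by rewrite ltn_mod.
have N2 : (2 <= N)%N by nia.
have [r0|r0] := eqVneq r 0%N.
  apply: (@model_rigid_mod0 R d e k0 (alpha k0) p1 p2 p3 dek e0 ek al0 hp1 hp2 hp3 p10 p20 p30 m n A B mn model N) => //.
    by rewrite {1}mE r0 addn0.
  pose q (y : C) := \sum_(d - k0 <= j < k0) alpha j * (d - j)%:R * y ^+ (k0 - j).-1.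
  exists q; split; first by rewrite /q; polyf.
  move=> y; rewrite /p2 big_nat_recr /=; last by lia.
  rewrite subnn expr0 mulr1 addrC; congr (_ + _); first by rewrite mulrC.
  rewrite /q mulr_sumr; apply: eq_big_nat => j jb.
  by rewrite mulrCA -exprS prednK //; lia.
have [r1|r1] := eqVneq r 1%N.
  apply: (@model_rigid_mod1 R d e k0 (alpha k0) p1 p2 p3 dek e0 ek al0 hp1 hp2 hp3 p10 p20 p30 m n A B mn model N) => //.
  by rewrite {1}mE r1 addn1.
apply: (model_rigid_mod_ge2 dek e0 ek al0 hp1 hp2 hp3 p30 mn model (N := N) (r := r)) => //.
lia.
Qed.

End ModelRigid.

(** * Lipschitz estimates for functions of class C^1 and C^2 *)

Section Lipschitz.
Variable R : realType.
Local Notation C := (CC R).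

Lemma lip_dir (V : normedModType R) (f : V -> R) (v x : V) (c K : R) :
  (forall s : R, `|s| <= `|c| -> derivable f (s *: v + x) v /\ `|'D_v f (s *: v + x)| <= K) ->
  `|f (c *: v + x) - f x| <= K * `|c|.
Proof.
move=> h; pose g (s : R) := f (s *: v + x).
have dg s : (fun h : R => h^-1 *: ((g \o shift s) (h *: (1 : R)) - g s)) =
   (fun h : R => h^-1 *: ((f \o shift (s *: v + x)) (h *: v) - f (s *: v + x))).
  apply/funext => t; rewrite /g /=; congr (_ *: (f _ - _)).
  by rewrite addrA -scalerDl; congr (_ *: _ + _); rewrite /GRing.scale /= mulr1.
have := @MVT_bound R g K 0 c; rewrite /g scale0r add0r subr0; apply => s sb.
have [|d1 d2] := h s.
  have [c0|c0] := leP 0 c.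
    by move: sb; rewrite min_l // max_r // => /andP[s1 s2]; rewrite !ger0_norm.
  move: sb; rewrite min_r ?max_l ?(ltW c0) // => /andP[s1 s2].
  by rewrite !ler0_norm ?lerN2 // ltW.
by split; [rewrite /derivable dg | rewrite /derive dg].
Qed.

Lemma near0_box (V : normedModType R) (P : V -> Prop) : (\forall x \near (0 : V), P x) ->
  exists2 d : R, 0 < d & forall x : V, `|x| < d -> P x.
Proof.
move=> /nbhs_normP [d /= d0 hd]; exists d => // x xd; apply: hd.
by rewrite /= sub0r normrN.
Qed.

Lemma class_C1_near (V : normedModType R) (f : V -> R) k (v : V) : class_C_near0 k.+1 f ->
  exists d K : R, [/\ 0 < d, 0 <= K & forall x, `|x| < d ->
    [/\ derivable f x v, `|'D_v f x| <= K & `|f x| <= K]].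
Proof.
move=> [U [Uo U0] [hc hd]]; have [dd cd] := hd v.
have cD : {for 0, continuous ('D_v f)} by case: k cd {hd} => [|k] [+ _]; exact.
have cf : {for 0, continuous f} by exact: hc.
have n1 : \forall x \near (0 : V), `|'D_v f 0 - 'D_v f x| < 1.
  by have /cvgrPdist_lt := cD; apply.
have n2 : \forall x \near (0 : V), `|f 0 - f x| < 1.
  by have /cvgrPdist_lt := cf; apply.
have n3 : \forall x \near (0 : V), U x by exact: open_nbhs_nbhs.
have [d d0 H] := near0_box (filterI n1 (filterI n2 n3)).
exists d, (`|'D_v f 0| + `|f 0| + 1); split; [exact: d0|by rewrite !addr_ge0|move=> x xd].
have [h1 [h2 h3]] := H x xd.
have g1 := ler_distD 0 ('D_v f 0) ('D_v f x).
have t (a b : R) : `|a - b| < 1 -> `|b| <= `|a| + 1.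
  move=> ab; rewrite (_ : b = a - (a - b)); last by ring.
  by apply: (le_trans (ler_normB _ _)); rewrite lerD2l ltW.
split; first exact: dd.
  by apply: (le_trans (t _ _ h1)); rewrite lerD2r lerDl.
by apply: (le_trans (t _ _ h2)); rewrite lerD2r lerDr.
Qed.

Lemma class_C1_lip2 (f : R * R -> R) k : class_C_near0 k.+1 f ->
  exists d K : R, [/\ 0 < d, 0 <= K & forall a b a' b' : R,
    `|a| < d -> `|b| < d -> `|a'| < d -> `|b'| < d ->
    `|f (a, b)| <= K /\ `|f (a', b') - f (a, b)| <= K * (`|a' - a| + `|b' - b|)].
Proof.
move=> hf.
have [d1 [K1 [d10 K10 h1]]] := class_C1_near ((1, 0) : R * R) hf.
have [d2 [K2 [d20 K20 h2]]] := class_C1_near ((0, 1) : R * R) hf.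
pose d := Num.min d1 d2 / 3.
have m0 : 0 < Num.min d1 d2 by rewrite lt_min d10.
have dd1 : 3 * d <= d1 by rewrite /d mulrC divfK // ge_min lexx.
have dd2 : 3 * d <= d2 by rewrite /d mulrC divfK // ge_min lexx orbT.
have d0 : 0 < d by rewrite divr_gt0.
exists d, (K1 + K2); split; rewrite ?addr_ge0 // => a b a' b' ad bd a'd b'd.
have box x y (D : R) : `|x| < D -> `|y| < D -> `|(x, y) : R * R| < D.
  by move=> hx hy; rewrite prod_normE gt_max /= hx.
have le3 (x y z D : R) : `|x| <= `|y - z| -> `|z| < d -> `|y| < d -> 3 * d <= D -> `|x + z| < D.
  move=> h3 h4 h5 h6; apply: (le_lt_trans (ler_normD _ _)).
  have := ler_normB y z; move: h3 h4 h5 h6; lra.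
have d1' : d < d1 by move: dd1 d0; lra.
have d2' : d < d2 by move: dd2 d0; lra.
split.
  have [_ _] := h1 (a, b) (box _ _ _ (lt_trans ad d1') (lt_trans bd d1')).
  by move/le_trans; apply; rewrite lerDl.
have e1 : (a', b') = (a' - a) *: ((1, 0) : R * R) + (a, b').
  rewrite [RHS]surjective_pairing; congr (_, _).
    by change (a' = (a' - a) * 1 + a); rewrite mulr1 subrK.
  by change (b' = (a' - a) * 0 + b'); rewrite mulr0 add0r.
have e2 : (a, b') = (b' - b) *: ((0, 1) : R * R) + (a, b).
  rewrite [RHS]surjective_pairing; congr (_, _).
    by change (a = (b' - b) * 0 + a); rewrite mulr0 add0r.
  by change (b' = (b' - b) * 1 + b); rewrite mulr1 subrK.
have s1 : `|f (a', b') - f (a, b')| <= K1 * `|a' - a|.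
  rewrite {1}e1; apply: lip_dir => s sh.
  have -> : s *: ((1, 0) : R * R) + (a, b') = (s + a, b').
    rewrite [LHS]surjective_pairing; congr (_, _).
      by change (s * 1 + a = s + a); rewrite mulr1.
    by change (s * 0 + b' = b'); rewrite mulr0 add0r.
  by have [] := h1 (s + a, b') (box _ _ _ (le3 _ _ _ _ sh ad a'd dd1) (lt_trans b'd d1')).
have s2 : `|f (a, b') - f (a, b)| <= K2 * `|b' - b|.
  rewrite {1}e2; apply: lip_dir => s sh.
  have -> : s *: ((0, 1) : R * R) + (a, b) = (a, s + b).
    rewrite [LHS]surjective_pairing; congr (_, _).
      by change (s * 0 + a = a); rewrite mulr0 add0r.
    by change (s * 1 + b = s + b); rewrite mulr1.
  by have [] := h2 (a, s + b) (box _ _ _ (lt_trans ad d2') (le3 _ _ _ _ sh bd b'd dd2)).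
have tri := ler_distD (f (a, b')) (f (a', b')) (f (a, b)).
apply: (le_trans tri).
have p1 : 0 <= K1 * `|b' - b| by rewrite mulr_ge0.
have p2 : 0 <= K2 * `|a' - a| by rewrite mulr_ge0.
by move: s1 s2 p1 p2; lra.
Qed.

Lemma class_C1_lip3 (f : R * R * R -> R) k : class_C_near0 k.+1 f ->
  exists d K : R, [/\ 0 < d, 0 <= K & forall a b c a' b' c' : R,
    `|a| < d -> `|b| < d -> `|c| < d -> `|a'| < d -> `|b'| < d -> `|c'| < d ->
    `|f (a, b, c)| <= K /\
    `|f (a', b', c') - f (a, b, c)| <= K * (`|a' - a| + `|b' - b| + `|c' - c|)].
Proof.
move=> hf.
have [d1 [K1 [d10 K10 h1]]] := class_C1_near ((1, 0, 0) : R * R * R) hf.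
have [d2 [K2 [d20 K20 h2]]] := class_C1_near ((0, 1, 0) : R * R * R) hf.
have [d3 [K3 [d30 K30 h3]]] := class_C1_near ((0, 0, 1) : R * R * R) hf.
pose d := Num.min d1 (Num.min d2 d3) / 3.
have m0 : 0 < Num.min d1 (Num.min d2 d3) by rewrite !lt_min d10 d20.
have dd1 : 3 * d <= d1 by rewrite /d mulrC divfK // ge_min lexx.
have dd2 : 3 * d <= d2 by rewrite /d mulrC divfK // !ge_min lexx orbT.
have dd3 : 3 * d <= d3 by rewrite /d mulrC divfK // !ge_min lexx !orbT.
have d0 : 0 < d by rewrite divr_gt0.
exists d, (K1 + K2 + K3); split; rewrite ?addr_ge0 // => a b c a' b' c' ad bd cd a'd b'd c'd.
have box x y z (D : R) : `|x| < D -> `|y| < D -> `|z| < D -> `|(x, y, z) : R * R * R| < D.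
  by move=> hx hy hz; rewrite prod_normE gt_max /= prod_normE gt_max /= hx hy.
have le3 (x y z D : R) : `|x| <= `|y - z| -> `|z| < d -> `|y| < d -> 3 * d <= D -> `|x + z| < D.
  move=> g3 g4 g5 g6; apply: (le_lt_trans (ler_normD _ _)).
  have := ler_normB y z; move: g3 g4 g5 g6; lra.
have d1' : d < d1 by move: dd1 d0; lra.
have d2' : d < d2 by move: dd2 d0; lra.
have d3' : d < d3 by move: dd3 d0; lra.
split.
  have [_ _] := h1 (a, b, c) (box _ _ _ _ (lt_trans ad d1') (lt_trans bd d1') (lt_trans cd d1')).
  by move/le_trans; apply; rewrite -addrA lerDl addr_ge0.
have E1 s x y z : s *: ((1, 0, 0) : R * R * R) + (x, y, z) = (s + x, y, z).
  rewrite [LHS]surjective_pairing [X in (X, _)]surjective_pairing; congr (_, _, _).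
  - by change (s * 1 + x = s + x); rewrite mulr1.
  - by change (s * 0 + y = y); rewrite mulr0 add0r.
  - by change (s * 0 + z = z); rewrite mulr0 add0r.
have E2 s x y z : s *: ((0, 1, 0) : R * R * R) + (x, y, z) = (x, s + y, z).
  rewrite [LHS]surjective_pairing [X in (X, _)]surjective_pairing; congr (_, _, _).
  - by change (s * 0 + x = x); rewrite mulr0 add0r.
  - by change (s * 1 + y = s + y); rewrite mulr1.
  - by change (s * 0 + z = z); rewrite mulr0 add0r.
have E3 s x y z : s *: ((0, 0, 1) : R * R * R) + (x, y, z) = (x, y, s + z).
  rewrite [LHS]surjective_pairing [X in (X, _)]surjective_pairing; congr (_, _, _).
  - by change (s * 0 + x = x); rewrite mulr0 add0r.
  - by change (s * 0 + y = y); rewrite mulr0 add0r.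
  - by change (s * 1 + z = s + z); rewrite mulr1.
have s1 : `|f (a', b', c') - f (a, b', c')| <= K1 * `|a' - a|.
  have e1 : (a', b', c') = (a' - a) *: ((1, 0, 0) : R * R * R) + (a, b', c') by rewrite E1 subrK.
  rewrite {1}e1; apply: lip_dir => s sh; rewrite E1.
  by have [] := h1 (s + a, b', c') (box _ _ _ _ (le3 _ _ _ _ sh ad a'd dd1) (lt_trans b'd d1') (lt_trans c'd d1')).
have s2 : `|f (a, b', c') - f (a, b, c')| <= K2 * `|b' - b|.
  have e2 : (a, b', c') = (b' - b) *: ((0, 1, 0) : R * R * R) + (a, b, c') by rewrite E2 subrK.
  rewrite {1}e2; apply: lip_dir => s sh; rewrite E2.
  by have [] := h2 (a, s + b, c') (box _ _ _ _ (lt_trans ad d2') (le3 _ _ _ _ sh bd b'd dd2) (lt_trans c'd d2')).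
have s3 : `|f (a, b, c') - f (a, b, c)| <= K3 * `|c' - c|.
  have e3 : (a, b, c') = (c' - c) *: ((0, 0, 1) : R * R * R) + (a, b, c) by rewrite E3 subrK.
  rewrite {1}e3; apply: lip_dir => s sh; rewrite E3.
  by have [] := h3 (a, b, s + c) (box _ _ _ _ (lt_trans ad d3') (lt_trans bd d3') (le3 _ _ _ _ sh cd c'd dd3)).
have tri := ler_distD (f (a, b', c')) (f (a', b', c')) (f (a, b, c)).
have tri2 := ler_distD (f (a, b, c')) (f (a, b', c')) (f (a, b, c)).
have p1 : 0 <= K1 * `|b' - b| by rewrite mulr_ge0.
have p2 : 0 <= K1 * `|c' - c| by rewrite mulr_ge0.
have p3 : 0 <= K2 * `|a' - a| by rewrite mulr_ge0.
have p4 : 0 <= K2 * `|c' - c| by rewrite mulr_ge0.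
have p5 : 0 <= K3 * `|a' - a| by rewrite mulr_ge0.
have p6 : 0 <= K3 * `|b' - b| by rewrite mulr_ge0.
by move: tri tri2 s1 s2 s3 p1 p2 p3 p4 p5 p6; lra.
Qed.

(** The derivative of th vanishes at 0 and is Lipschitz, hence it is bounded by
    K c on [-c, c]. *)
Lemma class_C2_lip_quadratic (th : R -> R) k : class_C_near0 k.+2 th ->
  th =O_ (0 : R) (fun t => t ^+ 2) ->
  th 0 = 0 /\ exists d K : R, [/\ 0 < d, 0 <= K & forall a b c : R,
    `|a| <= c -> `|b| <= c -> c < d -> `|th b - th a| <= K * c * `|b - a|].
Proof.
move=> hth hO.
have [d1 [K1 [d10 K10 h1]]] := class_C1_near (1 : R) hth.
have hth' : class_C_near0 k.+1 ('D_1 th).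
  by case: hth => U hU [_ hd]; exists U => //; have [] := hd 1.
have [d2 [K2 [d20 K20 h2]]] := class_C1_near (1 : R) hth'.
have [K3 K30 [d3 d30 h3]] : exists2 K3 : R, 0 < K3 & exists2 d3 : R, 0 < d3 & forall t : R, `|t| < d3 -> `|th t| <= K3 * t ^+ 2.
  have /eqO_exP [K3 K30 h] := hO; exists K3 => //.
  have [d3 d30 h3] := near0_box h; exists d3 => // t td.
  by have := h3 t td; rewrite (ger0_norm (sqr_ge0 t)).
have th0 : th 0 = 0.
  apply/eqP; rewrite -normr_le0; apply: le_trans (h3 0 _) _; rewrite ?normr0 //.
  by rewrite expr0n mulr0.
have D0 : 'D_1 th 0 = 0.
  apply: cvg_lim => //; apply/cvgrPdist_lt => e e0.
  rewrite near_withinE; apply/nbhs_normP.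
  exists (Num.min d3 (e / K3)); first by rewrite /= lt_min d30 divr_gt0.
  move=> t /=; rewrite sub0r normrN lt_min => /andP[t1 t2] tn.
  rewrite sub0r normrN /shift /= addr0 th0 subr0 normrM normfV.
  have -> : t *: (1 : R) = t by rewrite /GRing.scale /= mulr1.
  rewrite ltr_pdivrMl ?normr_gt0 //; apply: (le_lt_trans (h3 _ t1)).
  rewrite -real_normK ?num_real // expr2 mulrA [ltRHS]mulrC ltr_pM2r ?normr_gt0 //.
  by move: t2; rewrite ltr_pdivlMr // mulrC.
split=> //; exists (Num.min d1 d2), K2; split => //; first by rewrite lt_min d10.
move=> a b c ac bc; rewrite lt_min => /andP[c1 c2].
apply: MVT_bound => s sb.
have sc : `|s| <= c.
  move: sb ac bc; rewrite !ler_norml => /andP[s1 s2] /andP[a1 a2] /andP[b1 b2].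
  move: s1 s2; rewrite ge_min le_max => /orP[s1|s1] /orP[s2|s2]; lra.
have [dt _ _] := h1 s (le_lt_trans sc c1).
split => //.
have := @lip_dir _ ('D_1 th) 1 0 s K2.
rewrite addr0 D0 subr0 (_ : s *: (1 : R) = s); last by rewrite /GRing.scale /= mulr1.
move=> H; apply: (@le_trans _ _ (K2 * `|s|)); last by rewrite ler_wpM2l.
apply: H => u us; rewrite addr0 (_ : u *: (1 : R) = u); last by rewrite /GRing.scale /= mulr1.
by have [] := h2 u (le_lt_trans (le_trans us sc) c2).
Qed.

End Lipschitz.

(** * Orders and leading terms along curves *)

Section Asymptotics.
Variable R : realType.
Local Notation C := (CC R).
Implicit Types (E F : R -> C) (j k : nat).

(** The parameter p is the scale of the dilations (z, w) |-> (p z, p^d w); all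
    quantities are followed along curves as p tends to 0 from the right. *)
Definition isO k E := exists K r : R, 0 < r /\ forall p : R, 0 < p -> p < r -> modC (E p) <= K * p ^+ k.

Lemma isO_norm k E : isO k E -> exists K r : R, [/\ 0 <= K, 0 < r, r <= 1 &
  forall p : R, 0 < p -> p < r -> modC (E p) <= K * p ^+ k].
Proof.
move=> [K [r [r0 h]]]; exists `|K|, (Num.min r 1); split => //.
- by rewrite lt_min r0 ltr01.
- by rewrite ge_min lexx orbT.
move=> p p0; rewrite lt_min => /andP[pr _]; apply: (le_trans (h p p0 pr)).
by rewrite ler_wpM2r ?exprn_ge0 ?ler_norm // ltW.
Qed.

Lemma isO_dom k E F (c r : R) : 0 < r -> (forall p : R, 0 < p -> p < r -> modC (F p) <= c * modC (E p)) ->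
  isO k E -> isO k F.
Proof.
move=> r0 h /isO_norm [K [r' [K0 r'0 _ hE]]]; exists (`|c| * K), (Num.min r r'); split.
  by rewrite lt_min r0.
move=> p p0; rewrite lt_min => /andP[p1 p2]; apply: (le_trans (h p p0 p1)).
apply: (@le_trans _ _ (`|c| * modC (E p))); first by rewrite ler_wpM2r ?modC_ge0 ?ler_norm.
by rewrite -mulrA ler_wpM2l ?hE.
Qed.

Lemma isO_ext k E F (r : R) : 0 < r -> (forall p : R, 0 < p -> p < r -> F p = E p) -> isO k E -> isO k F.
Proof. by move=> r0 h; apply: (@isO_dom _ _ _ 1 r) => // p p0 pr; rewrite h // mul1r. Qed.

Lemma isO_weak k j E : (j <= k)%N -> isO k E -> isO j E.
Proof.
move=> jk /isO_norm [K [r [K0 r0 r1 h]]]; exists K, r; split => // p p0 pr.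
apply: (le_trans (h p p0 pr)); rewrite ler_wpM2l //.
by rewrite ler_wiXn2l ?(ltW p0) // (le_trans (ltW pr)).
Qed.

Lemma isO_D k E F : isO k E -> isO k F -> isO k (fun p => E p + F p).
Proof.
move=> [K [r [r0 h]]] [K' [r' [r'0 h']]]; exists (K + K'), (Num.min r r'); split.
  by rewrite lt_min r0.
move=> p p0; rewrite lt_min => /andP[p1 p2]; apply: (le_trans (modCD _ _)).
by rewrite mulrDl lerD ?h ?h'.
Qed.

Lemma isO_N k E : isO k E -> isO k (fun p => - E p).
Proof. by move=> [K [r [r0 h]]]; exists K, r; split => // p p0 pr; rewrite modCN h. Qed.

Lemma isO_B k E F : isO k E -> isO k F -> isO k (fun p => E p - F p).
Proof. by move=> h h'; apply: isO_D => //; apply: isO_N. Qed.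

Lemma isO_M k j E F : isO k E -> isO j F -> isO (k + j) (fun p => E p * F p).
Proof.
move=> /isO_norm [K [r [K0 r0 _ h]]] /isO_norm [K' [r' [K'0 r'0 _ h']]].
exists (K * K'), (Num.min r r'); split; first by rewrite lt_min r0.
move=> p p0; rewrite lt_min => /andP[p1 p2]; rewrite modCM exprD mulrACA.
by rewrite ler_pM ?modC_ge0 ?h ?h'.
Qed.

Lemma isO_cst c : isO 0 (fun _ => c).
Proof. by exists (modC c), 1; split => // p _ _; rewrite expr0 mulr1. Qed.

Lemma isO_0 k : isO k (fun _ => 0).
Proof. by exists 0, 1; split => // p _ _; rewrite modC0 mul0r. Qed.

Lemma isO_Z k c E : isO k E -> isO k (fun p => c * E p).
Proof. by move=> h; rewrite -[k]add0n; apply: isO_M => //; apply: isO_cst. Qed.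

Lemma isO_rho k : isO k (fun p => cR p ^+ k).
Proof.
by exists 1, 1; split => // p p0 _; rewrite modCX modC_cR gtr0_norm // mul1r.
Qed.

Lemma isO_X k E n : isO k E -> isO (k * n) (fun p => E p ^+ n).
Proof.
move=> h; elim: n => [|n ih].
  by rewrite muln0; apply: (isO_ext ltr01 _ (isO_cst 1)) => p _ _; rewrite expr0.
by rewrite mulnS; apply: (isO_ext ltr01 _ (isO_M h ih)) => p _ _; rewrite exprS.
Qed.

Lemma isO_conj k E : isO k E -> isO k (fun p => Num.conj (E p)).
Proof. by move=> [K [r [r0 h]]]; exists K, r; split => // p p0 pr; rewrite modCJ h. Qed.

Lemma isO_Im k E : isO k E -> isO k (fun p => cR (complex.Im (E p))).
Proof.
move=> [K [r [r0 h]]]; exists K, r; split => // p p0 pr.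
by rewrite modC_cR; apply: le_trans (modC_Im _) (h p p0 pr).
Qed.

Lemma isO_sum k (G : nat -> R -> C) m n : (forall i, (m <= i < n)%N -> isO k (G i)) ->
  isO k (fun p => \sum_(m <= i < n) G i p).
Proof.
elim: n => [|n ih] h.
  by apply: (isO_ext ltr01 _ (isO_0 k)) => p _ _; rewrite big_geq.
have [mn|nm] := leqP m n; last first.
  by apply: (isO_ext ltr01 _ (isO_0 k)) => p _ _; rewrite big_geq.
have h1 : isO k (fun p => \sum_(m <= i < n) G i p).
  by apply: ih => i /andP[i1 i2]; apply: h; rewrite i1 ltnW.
have h2 : isO k (G n) by apply: h; rewrite mn ltnSn.
by apply: (isO_ext ltr01 _ (isO_D h1 h2)) => p _ _; rewrite big_nat_recr.
Qed.

Lemma isO_small k E : isO k.+1 E -> forall d : R, 0 < d -> exists2 r : R, 0 < r &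
  forall p : R, 0 < p -> p < r -> modC (E p) < d.
Proof.
move=> /(isO_weak (isT : (1 <= k.+1)%N)) /isO_norm [K [r [K0 r0 _ h]]] d d0.
exists (Num.min r (d / (K + 1))); first by rewrite lt_min r0 divr_gt0 // ltr_wpDl.
move=> p p0; rewrite lt_min => /andP[p1 p2]; apply: (le_lt_trans (h p p0 p1)).
rewrite expr1; move: p2; rewrite ltr_pdivlMr ?ltr_wpDl // => p2.
apply: le_lt_trans p2; rewrite mulrC ler_wpM2l ?(ltW p0) //; lra.
Qed.

Lemma isO_lim k c : isO k.+1 (fun p => cR p ^+ k * c) -> c = 0.
Proof.
move=> /isO_norm [K [r [K0 r0 _ h]]]; apply/eqP; rewrite -modC_eq0 eq_le modC_ge0 andbT.
apply/ler_addgt0Pr => e e0; rewrite add0r.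
pose p := Num.min (r / 2) (e / (K + 1)).
have K1 : 0 < K + 1 by rewrite ltr_wpDl.
have p0 : 0 < p by rewrite lt_min !divr_gt0.
have pr : p < r by rewrite gt_min; apply/orP; left; move: r0; lra.
have pe : p <= e / (K + 1) by rewrite ge_min lexx orbT.
have := h p p0 pr; rewrite modCM modCX modC_cR (gtr0_norm p0) [X in _ <= X](_ : _ = p ^+ k * (K * p)); last by rewrite exprS; ring.
rewrite ler_pM2l ?exprn_gt0 // => hc.
apply: (le_trans hc); move: pe; rewrite ler_pdivlMr // => pe.
apply: le_trans pe; rewrite mulrC ler_wpM2l ?(ltW p0) //; lra.
Qed.

(** The coefficient e may vanish. *)
Definition leading j E e := isO j.+1 (fun p => E p - cR p ^+ j * e).

Lemma leading_isO j E e : leading j E e -> isO j E.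
Proof.
move=> h; have h1 := isO_weak (leqnSn j) h.
have h2 := isO_Z e (isO_rho j).
by apply: (isO_ext ltr01 _ (isO_D h1 h2)) => p _ _; ring.
Qed.

Lemma leading_ext j E F e (r : R) : 0 < r -> (forall p : R, 0 < p -> p < r -> F p = E p) -> leading j E e -> leading j F e.
Proof. by move=> r0 h; apply: (isO_ext r0) => p p0 pr; rewrite h. Qed.

Lemma leading_D j E F e f : leading j E e -> leading j F f -> leading j (fun p => E p + F p) (e + f).
Proof. by move=> h h'; apply: (isO_ext ltr01 _ (isO_D h h')) => p _ _; ring. Qed.

Lemma leading_isO0 j E : isO j.+1 E -> leading j E 0.
Proof. by apply: (isO_ext ltr01) => p _ _; rewrite mulr0 subr0. Qed.

Lemma leading_M j k E F e f : leading j E e -> leading k F f -> leading (j + k) (fun p => E p * F p) (e * f).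
Proof.
move=> h h'; have h1 := isO_M h (leading_isO h'); rewrite addSn in h1.
have h2 := isO_M (isO_Z e (isO_rho j)) h'; rewrite addnS in h2.
by apply: (isO_ext ltr01 _ (isO_D h1 h2)) => p _ _; rewrite exprD; ring.
Qed.

Lemma leading_cst c : leading 0 (fun _ => c) c.
Proof. by apply: (isO_ext ltr01 _ (isO_0 1)) => p _ _; rewrite expr0 mul1r subrr. Qed.

Lemma leading_Z j E e c : leading j E e -> leading j (fun p => c * E p) (c * e).
Proof. by move=> h; rewrite -[j]add0n; apply: leading_M => //; apply: leading_cst. Qed.

Lemma leading_X j E e n : leading j E e -> leading (j * n) (fun p => E p ^+ n) (e ^+ n).
Proof.
move=> h; elim: n => [|n ih].
  by rewrite muln0; apply: (leading_ext ltr01 _ (leading_cst 1)) => p _ _; rewrite expr0.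
by rewrite mulnS exprS; apply: (leading_ext ltr01 _ (leading_M h ih)) => p _ _; rewrite exprS.
Qed.

Lemma leading_conj j E e : leading j E e -> leading j (fun p => Num.conj (E p)) (Num.conj e).
Proof.
move=> /isO_conj h; apply: (isO_ext ltr01 _ h) => p _ _.
by rewrite rmorphB rmorphM /= rmorphXn /= conj_cR.
Qed.

Lemma leading_sum j (G : nat -> R -> C) (g : nat -> C) m n : (forall i, (m <= i < n)%N -> leading j (G i) (g i)) ->
  leading j (fun p => \sum_(m <= i < n) G i p) (\sum_(m <= i < n) g i).
Proof.
move=> h; have := isO_sum (G := fun i p => G i p - cR p ^+ j * g i) h.
by apply: (isO_ext ltr01) => p _ _; rewrite big_split /= sumrN mulr_sumr.
Qed.

Lemma leading_rho j e : leading j (fun p => cR p ^+ j * e) e.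
Proof. by apply: (isO_ext ltr01 _ (isO_0 j.+1)) => p _ _; rewrite subrr. Qed.

Lemma leading_uniq j E e e' : leading j E e -> leading j E e' -> e = e'.
Proof.
move=> h h'; apply/eqP; rewrite -subr_eq0; apply/eqP; apply: (@isO_lim j).
by apply: (isO_ext ltr01 _ (isO_B h' h)) => p _ _; ring.
Qed.

Lemma cRReE (z : C) : cR (complex.Re z) = (z + Num.conj z) / 2.
Proof. by rewrite addJ mulrC mulKf // pnatr_eq0. Qed.

Lemma leading_Re j E e : leading j E e -> leading j (fun p => cR (complex.Re (E p))) (cR (complex.Re e)).
Proof.
move=> h; have := leading_Z (2^-1) (leading_D h (leading_conj h)); rewrite mulrC -cRReE.
by apply: (leading_ext ltr01) => p _ _; rewrite cRReE mulrC.
Qed.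

(** Two curves of order j whose difference has order j + k.  For k > 0 the
    coefficient of the difference behaves like a derivation on products. *)
Definition leading_pair k j E1 E2 e dl := leading j E1 e /\ leading (j + k) (fun p => E2 p - E1 p) dl.

Lemma leading_pair_M k j i E1 E2 F1 F2 e f de df : (0 < k)%N -> leading_pair k j E1 E2 e de -> leading_pair k i F1 F2 f df ->
  leading_pair k (j + i) (fun p => E1 p * F1 p) (fun p => E2 p * F2 p) (e * f) (e * df + de * f).
Proof.
move=> k0 [h1 h2] [g1 g2]; split; first exact: leading_M.
have a1 := leading_M h1 g2; have a2 := leading_M h2 g1.
have a3 := isO_M (leading_isO h2) (leading_isO g2).
have e1 : (j + (i + k) = j + i + k)%N by lia.
have e2 : (j + k + i = j + i + k)%N by lia.
rewrite e1 in a1; rewrite e2 in a2.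
have {}a3 : leading (j + i + k) (fun p => (E2 p - E1 p) * (F2 p - F1 p)) 0.
  by apply: leading_isO0; apply: isO_weak a3; lia.
have := leading_D (leading_D a1 a2) a3; rewrite addr0.
by apply: (leading_ext ltr01) => p _ _; ring.
Qed.

Lemma leading_pair_cst k c : leading_pair k 0 (fun _ => c) (fun _ => c) c 0.
Proof.
split; first exact: leading_cst.
by apply: leading_isO0; apply: (isO_ext ltr01 _ (isO_0 _)) => p _ _; rewrite subrr.
Qed.

Lemma leading_pair_ext k j E1 E2 F1 F2 e de : (forall p, F1 p = E1 p) -> (forall p, F2 p = E2 p) ->
  leading_pair k j E1 E2 e de -> leading_pair k j F1 F2 e de.
Proof.
by move=> h1 h2 [a b]; split; [apply: (leading_ext ltr01 _ a) | apply: (leading_ext ltr01 _ b)] => p _ _; rewrite ?h1 ?h2.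
Qed.

Lemma leading_pair_X k j E1 E2 e de n : (0 < k)%N -> leading_pair k j E1 E2 e de ->
  leading_pair k (j * n) (fun p => E1 p ^+ n) (fun p => E2 p ^+ n) (e ^+ n) (n%:R * e ^+ n.-1 * de).
Proof.
move=> k0 h; elim: n => [|n ih].
  rewrite muln0 expr0 mulr0n !mul0r.
  by apply: leading_pair_ext (leading_pair_cst k 1) => p; rewrite expr0.
rewrite mulnS; have := leading_pair_M k0 h ih.
have -> : e * (n%:R * e ^+ n.-1 * de) + de * e ^+ n = n.+1%:R * e ^+ n * de.
  rewrite -[n.+1]addn1 natrD; case: n {ih} => [|n] /=; first by rewrite !mul0r mulr0 expr0; ring.
  by rewrite exprS; ring.
by rewrite -exprS; apply: leading_pair_ext => p; rewrite exprS.
Qed.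

Lemma leading_pair_conj k j E1 E2 e de : leading_pair k j E1 E2 e de ->
  leading_pair k j (fun p => Num.conj (E1 p)) (fun p => Num.conj (E2 p)) (Num.conj e) (Num.conj de).
Proof.
move=> [a b]; split; first exact: leading_conj.
by apply: (leading_ext ltr01 _ (leading_conj b)) => p _ _; rewrite rmorphB.
Qed.

(** The version of [leading_pair] without coefficients, for functions that are
    only Lipschitz. *)
Definition close_pair k j E1 E2 := [/\ isO j E1, isO j E2 & isO (j + k) (fun p => E2 p - E1 p)].

Lemma close_pair_M k j i E1 E2 F1 F2 : close_pair k j E1 E2 -> close_pair k i F1 F2 ->
  close_pair k (j + i) (fun p => E1 p * F1 p) (fun p => E2 p * F2 p).
Proof.
move=> [a1 a2 a3] [b1 b2 b3]; split; [exact: isO_M|exact: isO_M|].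
have c1 := isO_M a1 b3; have c2 := isO_M a3 b2.
have e1 : (j + (i + k) = j + i + k)%N by lia.
have e2 : (j + k + i = j + i + k)%N by lia.
rewrite e1 in c1; rewrite e2 in c2.
by apply: (isO_ext ltr01 _ (isO_D c1 c2)) => p _ _; ring.
Qed.

Lemma close_pair_weak k j i E1 E2 : (i <= j)%N -> close_pair k j E1 E2 -> close_pair k i E1 E2.
Proof.
by move=> ij [a b c]; split; apply: isO_weak; try eassumption; rewrite ?leq_add2r.
Qed.

Lemma close_pair_cst k c : close_pair k 0 (fun _ => c) (fun _ => c).
Proof.
split; try exact: isO_cst.
by apply: (isO_ext ltr01 _ (isO_0 _)) => p _ _; rewrite subrr.
Qed.

Lemma close_pair_ext k j E1 E2 F1 F2 : (forall p, F1 p = E1 p) -> (forall p, F2 p = E2 p) ->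
  close_pair k j E1 E2 -> close_pair k j F1 F2.
Proof.
by move=> h1 h2 [a b c]; split; [apply: (isO_ext ltr01 _ a)|apply: (isO_ext ltr01 _ b)|apply: (isO_ext ltr01 _ c)] => p _ _; rewrite ?h1 ?h2.
Qed.

Lemma close_pair_X k j E1 E2 n : close_pair k j E1 E2 -> close_pair k (j * n) (fun p => E1 p ^+ n) (fun p => E2 p ^+ n).
Proof.
move=> h; elim: n => [|n ih].
  by rewrite muln0; apply: close_pair_ext (close_pair_cst k 1) => p; rewrite expr0.
by rewrite mulnS; apply: close_pair_ext (close_pair_M h ih) => p; rewrite exprS.
Qed.

Lemma close_pair_conj k j E1 E2 : close_pair k j E1 E2 -> close_pair k j (fun p => Num.conj (E1 p)) (fun p => Num.conj (E2 p)).
Proof.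
move=> [a b c]; split; [exact: isO_conj|exact: isO_conj|].
by apply: (isO_ext ltr01 _ (isO_conj c)) => p _ _; rewrite rmorphB.
Qed.

Lemma close_pair_D k j E1 E2 F1 F2 : close_pair k j E1 E2 -> close_pair k j F1 F2 ->
  close_pair k j (fun p => E1 p + F1 p) (fun p => E2 p + F2 p).
Proof.
move=> [a1 a2 a3] [b1 b2 b3]; split; [exact: isO_D|exact: isO_D|].
by apply: (isO_ext ltr01 _ (isO_D a3 b3)) => p _ _; ring.
Qed.

Lemma close_pair_sum k j (E1 E2 : nat -> R -> C) m n : (forall i, (m <= i < n)%N -> close_pair k j (E1 i) (E2 i)) ->
  close_pair k j (fun p => \sum_(m <= i < n) E1 i p) (fun p => \sum_(m <= i < n) E2 i p).
Proof.
move=> h; split.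
- by apply: isO_sum => i /h [].
- by apply: isO_sum => i /h [].
have : isO (j + k) (fun p => \sum_(m <= i < n) (E2 i p - E1 i p)) by apply: isO_sum => i /h [].
by apply: (isO_ext ltr01) => p _ _; rewrite big_split /= sumrN.
Qed.

End Asymptotics.

(** * Leading weighted parts of a double series *)

Section Leading.
Variable R : realType.
Local Notation C := (CC R).

(** Along such curves the monomial z^i w^j has order i + d j. *)
Lemma leading_series (s : R) f Phi d q (zc wc : R -> C) z1 w1 : 0 < s -> (0 < d)%N -> biseries s f Phi ->
  (forall i j, (i + d * j < q)%N -> Phi i j 0 0 = 0) ->
  leading 1 zc z1 -> leading d wc w1 ->
  leading q (fun p => f (zc p) (wc p)) (wsum d (q %/ d).+1 q (fun j => Phi (q - d * j)%N j 0 0) z1 w1).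
Proof.
move=> s0 d0 hP hlow hz hw; have [K hK] := bs_taylor hP.
pose N := q.+1.
pose T a b (z w : C) := Phi a b 0 0 * z ^+ a * w ^+ b.
pose P z w := \sum_(0 <= a < N) \sum_(0 <= b < N) T a b z w.
have PE z w : P z w = \sum_(0 <= a < N) z ^+ a * \sum_(0 <= b < N) w ^+ b * Phi a b 0 0.
  apply: eq_bigr => a _; rewrite mulr_sumr; apply: eq_bigr => b _; rewrite /T; ring.
have oz := leading_isO hz; have ow := leading_isO hw.
have [r1 r10 sz] := isO_small oz s0.
have [r2 r20 sw] : exists2 r : R, 0 < r & forall p : R, 0 < p -> p < r -> modC (wc p) < s.
  by apply: (@isO_small _ d.-1) s0; rewrite prednK.
have hrem : isO N (fun p => f (zc p) (wc p) - P (zc p) (wc p)).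
  have := isO_X N oz; rewrite mul1n => /isO_norm [K1 [r3 [K10 r30 _ b1]]].
  have := isO_weak (leq_pmull N d0) (isO_X N ow) => /isO_norm [K2 [r4 [K20 r40 _ b2]]].
  exists (`|K| * ((2 * s)^-1 ^+ N * (K1 + K2))), (Num.min (Num.min r1 r2) (Num.min r3 r4)); split.
    by rewrite !lt_min r10 r20 r30.
  move=> p p0; rewrite !lt_min => /andP[/andP[p1 p2] /andP[p3 p4]].
  have := hK N _ _ (ltW (sz p p0 p1)) (ltW (sw p p0 p2)); rewrite -PE => h.
  apply: (le_trans h); apply: (@le_trans _ _ (`|K| * ((modC (zc p) / (2 * s)) ^+ N + (modC (wc p) / (2 * s)) ^+ N))).
    apply: ler_wpM2r; last exact: ler_norm.
    by rewrite addr_ge0 // exprn_ge0 // divr_ge0 ?modC_ge0 // mulr_ge0 // ltW.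
  rewrite -mulrA ler_wpM2l // !exprMn -mulrDl mulrC -mulrA ler_wpM2l //.
    by rewrite exprn_ge0 // invr_ge0 mulr_ge0 // ltW.
  rewrite mulrDl lerD //; first by have := b1 p p0 p3; rewrite modCX.
  by have := b2 p p0 p4; rewrite modCX.
have hP' : leading q (fun p => P (zc p) (wc p))
   (\sum_(0 <= a < N) \sum_(0 <= b < N) (if (a + d * b == q)%N then T a b z1 w1 else 0)).
  apply: leading_sum => a _; apply: leading_sum => b _.
  have h := leading_M (leading_Z (Phi a b 0 0) (leading_X a hz)) (leading_X b hw); rewrite mul1n in h.
  case: ifPn => [/eqP e|ne]; first by rewrite e in h.
  apply: leading_isO0; have [lt|ge] := ltnP (a + d * b) q.
    apply: (isO_ext ltr01 _ (isO_0 _ _)) => p _ _.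
    by rewrite /T hlow // !mul0r.
  by apply: isO_weak (leading_isO h); rewrite ltn_neqAle eq_sym ne.
have := leading_D hP' (leading_isO0 hrem).
rewrite addr0 (_ : \sum_(_ <= _ < _) _ = wsum d (q %/ d).+1 q (fun j => Phi (q - d * j)%N j 0 0) z1 w1).
  by apply: (leading_ext ltr01) => p _ _; ring.
rewrite exchange_big /= /wsum.
have qN : ((q %/ d).+1 <= N)%N by rewrite ltnS leq_div.
rewrite (@big_cat_nat _ _ _ (q %/ d).+1) //= [X in _ + X]big1_seq ?addr0; last first.
  move=> b; rewrite mem_index_iota => /andP[_ /andP[bq _]].
  rewrite big1_seq // => a _; case: eqP => // e; exfalso.
  by move: bq; rewrite ltnNge leq_divRL // => /negP; apply; rewrite -e mulnC leq_addl.
apply: eq_big_nat => b /andP[_ bq].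
have dbq : (d * b <= q)%N by move: bq; rewrite ltnS leq_divRL // mulnC.
have aN : (q - d * b < N)%N by rewrite ltnS leq_subr.
rewrite big_mkord (bigD1 (Ordinal aN)) //= subnK // eqxx big1 ?addr0 // => a ha.
case: eqP => // e; case/eqP: ha; apply: val_inj => /=; lia.
Qed.

(** By induction on the weight q: along (p, p^d u) the part of weight q is the
    leading term of f, and it is O(p^(q+1)), so it vanishes for every u. *)
Lemma low_coefs (s K : R) f Phi d L : 0 < s -> (0 < d)%N -> biseries s f Phi ->
  (forall z w, modC z <= s -> modC w <= s -> modC (f z w) <= K * (modC z + modC w) ^+ L) ->
  forall q, (q < L)%N -> forall i j, (i + d * j = q)%N -> Phi i j 0 0 = 0.
Proof.
move=> s0 d0 hP hK; elim/ltn_ind => q ih qL i j ij.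
have low i' j' : (i' + d * j' < q)%N -> Phi i' j' 0 0 = 0.
  by move=> h; apply: (ih _ h) => //; apply: ltn_trans qL.
suff H : forall u, \sum_(0 <= j' < (q %/ d).+1) Phi (q - d * j')%N j' 0 0 * u ^+ j' = 0.
  have := coef_eq0 H (j := j); rewrite (_ : q - d * j = i)%N; last by lia.
  by apply; rewrite ltnS leq_divRL // mulnC; lia.
move=> u.
have hz : leading 1 (fun p : R => cR p ^+ 1 * 1) (1 : C) by exact: leading_rho.
have hw : leading d (fun p : R => cR p ^+ d * u) (u : C) by exact: leading_rho.
have := leading_series s0 d0 hP low hz hw.
set g := fun p : R => _; set G0 := wsum _ _ _ _ _ _ => hG.
have GE : G0 = \sum_(0 <= j' < (q %/ d).+1) Phi (q - d * j')%N j' 0 0 * u ^+ j'.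
  by rewrite /G0 /wsum; apply: eq_bigr => j' _; rewrite expr1n mulr1.
rewrite -GE; apply: (leading_uniq hG); apply: leading_isO0.
have [r1 r10 sz] := isO_small (leading_isO hz) s0.
have [r2 r20 sw] : exists2 r : R, 0 < r & forall p : R, 0 < p -> p < r -> modC (cR p ^+ d * u) < s.
  by apply: (@isO_small _ d.-1) s0; rewrite prednK //; exact: leading_isO hw.
have oz := leading_isO hz; have ow := isO_weak d0 (leading_isO hw).
apply: (isO_weak qL).
have : isO L (fun p : R => cR (modC (cR p ^+ 1 * (1 : C)) + modC (cR p ^+ d * u)) ^+ L).
  rewrite -{1}[L]mul1n; apply: isO_X.
  move: oz ow => /isO_norm [K1 [r3 [K10 r30 _ b1]]] /isO_norm [K2 [r4 [K20 r40 _ b2]]].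
  exists (K1 + K2), (Num.min r3 r4); split; first by rewrite lt_min r30.
  move=> p p0; rewrite lt_min => /andP[p3 p4].
  rewrite modC_cR ger0_norm ?addr_ge0 ?modC_ge0 // mulrDl lerD //; [exact: b1|exact: b2].
apply: (@isO_dom _ _ _ _ K (Num.min r1 r2)); first by rewrite lt_min r10.
move=> p p0; rewrite lt_min => /andP[p1 p2].
rewrite modCX modC_cR ger0_norm ?addr_ge0 ?modC_ge0 //.
by apply: hK; apply: ltW; [exact: sz|exact: sw].
Qed.

End Leading.

(** * The remainder of the defining function *)

Section Remainder.
Variable R : realType.
Local Notation C := (CC R).

Lemma ofR2E (z : C) : ofR2 (complex.Re z, complex.Im z) = z.
Proof. by case: z. Qed.

Lemma close_pair_lip2 (h : C -> C) m k (z1 z2 : R -> C) :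
  class_C_near0 m.+1 (fun x : R * R => complex.Re (h (ofR2 x))) ->
  class_C_near0 m.+1 (fun x : R * R => complex.Im (h (ofR2 x))) ->
  close_pair k 1 z1 z2 -> close_pair k 0 (fun p => h (z1 p)) (fun p => h (z2 p)).
Proof.
move=> /class_C1_lip2 [d1 [K1 [d10 K10 l1]]] /class_C1_lip2 [d2 [K2 [d20 K20 l2]]] [g1 g2 g3].
have dm : 0 < Num.min d1 d2 by rewrite lt_min d10.
have [r1 r10 s1] := isO_small g1 dm; have [r2 r20 s2] := isO_small g2 dm.
have rm : 0 < Num.min r1 r2 by rewrite lt_min r10.
have key (x y : C) : modC x < Num.min d1 d2 -> modC y < Num.min d1 d2 ->
   modC (h x) <= K1 + K2 /\ modC (h y - h x) <= (K1 + K2) * (2 * modC (y - x)).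
  rewrite !lt_min => /andP[x1 x2] /andP[y1 y2].
  have rx := modC_Re x; have ix := modC_Im x; have ry := modC_Re y; have iy := modC_Im y.
  have [a1 a2] := l1 (complex.Re x) (complex.Im x) (complex.Re y) (complex.Im y)
     (le_lt_trans rx x1) (le_lt_trans ix x1) (le_lt_trans ry y1) (le_lt_trans iy y1).
  have [b1 b2] := l2 (complex.Re x) (complex.Im x) (complex.Re y) (complex.Im y)
     (le_lt_trans rx x2) (le_lt_trans ix x2) (le_lt_trans ry y2) (le_lt_trans iy y2).
  rewrite !ofR2E in a1 a2 b1 b2.
  split; first by apply: (le_trans (modC_ReIm _)); rewrite lerD.
  have e : `|complex.Re y - complex.Re x| + `|complex.Im y - complex.Im x| <= 2 * modC (y - x).
    have := modC_Re (y - x); have := modC_Im (y - x); rewrite Re_D Im_D Re_N Im_N; lra.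
  apply: (le_trans (modC_ReIm _)); rewrite Re_D Im_D Re_N Im_N mulrDl.
  apply: lerD; first by apply: (le_trans a2); rewrite ler_wpM2l.
  by apply: (le_trans b2); rewrite ler_wpM2l.
split.
- exists (K1 + K2), (Num.min r1 r2); split => // p p0; rewrite lt_min => /andP[p1 p2].
  by rewrite expr0 mulr1; have [] := key _ _ (s1 p p0 p1) (s2 p p0 p2).
- exists (K1 + K2), (Num.min r1 r2); split => // p p0; rewrite lt_min => /andP[p1 p2].
  by rewrite expr0 mulr1; have [] := key _ _ (s2 p p0 p2) (s1 p p0 p1).
rewrite add0n; apply: (@isO_dom _ _ _ _ ((K1 + K2) * 2) (Num.min r1 r2) _ _ (isO_weak (leqnSn k) g3)) => //.
move=> p p0; rewrite lt_min => /andP[p1 p2]; rewrite -mulrA.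
by have [] := key _ _ (s1 p p0 p1) (s2 p p0 p2).
Qed.

Lemma close_pair_lip3 (h : C -> R -> C) m k d (z1 z2 : R -> C) (t1 t2 : R -> R) : (0 < d)%N ->
  class_C_near0 m.+1 (fun x : R * R * R => complex.Re (h (ofR2 x.1) x.2)) ->
  class_C_near0 m.+1 (fun x : R * R * R => complex.Im (h (ofR2 x.1) x.2)) ->
  close_pair k 1 z1 z2 -> close_pair k d (fun p => cR (t1 p)) (fun p => cR (t2 p)) ->
  close_pair k 0 (fun p => h (z1 p) (t1 p)) (fun p => h (z2 p) (t2 p)).
Proof.
move=> dpos /class_C1_lip3 [d1 [K1 [d10 K10 l1]]] /class_C1_lip3 [d2 [K2 [d20 K20 l2]]] [g1 g2 g3] [q1 q2 q3].
have dm : 0 < Num.min d1 d2 by rewrite lt_min d10.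
have [r1 r10 s1] := isO_small g1 dm; have [r2 r20 s2] := isO_small g2 dm.
rewrite -(prednK dpos) in q1 q2.
have [r3 r30 s3] := isO_small q1 dm; have [r4 r40 s4] := isO_small q2 dm.
have rm : 0 < Num.min (Num.min r1 r2) (Num.min r3 r4) by rewrite !lt_min r10 r20 r30.
have key (x y : C) (s t : R) : modC x < Num.min d1 d2 -> modC y < Num.min d1 d2 ->
   modC (cR s) < Num.min d1 d2 -> modC (cR t) < Num.min d1 d2 ->
   modC (h x s) <= K1 + K2 /\ modC (h y t - h x s) <= (K1 + K2) * (2 * modC (y - x) + modC (cR t - cR s)).
  rewrite -cRB !modC_cR !lt_min => /andP[x1 x2] /andP[y1 y2] /andP[s1' s2'] /andP[t1' t2'].
  have rx := modC_Re x; have ix := modC_Im x; have ry := modC_Re y; have iy := modC_Im y.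
  have [a1 a2] := l1 (complex.Re x) (complex.Im x) s (complex.Re y) (complex.Im y) t
     (le_lt_trans rx x1) (le_lt_trans ix x1) s1' (le_lt_trans ry y1) (le_lt_trans iy y1) t1'.
  have [b1 b2] := l2 (complex.Re x) (complex.Im x) s (complex.Re y) (complex.Im y) t
     (le_lt_trans rx x2) (le_lt_trans ix x2) s2' (le_lt_trans ry y2) (le_lt_trans iy y2) t2'.
  rewrite !ofR2E in a1 a2 b1 b2.
  split; first by apply: (le_trans (modC_ReIm _)); rewrite lerD.
  have e : `|complex.Re y - complex.Re x| + `|complex.Im y - complex.Im x| + `|t - s| <= 2 * modC (y - x) + `|t - s|.
    have := modC_Re (y - x); have := modC_Im (y - x); rewrite Re_D Im_D Re_N Im_N; lra.
  apply: (le_trans (modC_ReIm _)); rewrite Re_D Im_D Re_N Im_N mulrDl.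
  apply: lerD; first by apply: (le_trans a2); rewrite ler_wpM2l.
  by apply: (le_trans b2); rewrite ler_wpM2l.
split.
- exists (K1 + K2), (Num.min (Num.min r1 r2) (Num.min r3 r4)); split => // p p0.
  rewrite !lt_min => /andP[/andP[p1 p2] /andP[p3 p4]].
  by rewrite expr0 mulr1; have [] := key _ _ _ _ (s1 p p0 p1) (s2 p p0 p2) (s3 p p0 p3) (s4 p p0 p4).
- exists (K1 + K2), (Num.min (Num.min r1 r2) (Num.min r3 r4)); split => // p p0.
  rewrite !lt_min => /andP[/andP[p1 p2] /andP[p3 p4]].
  by rewrite expr0 mulr1; have [] := key _ _ _ _ (s2 p p0 p2) (s1 p p0 p1) (s4 p p0 p4) (s3 p p0 p3).
have w1 := isO_weak (leqnSn k) g3; have w2 := isO_weak (leq_addl d k) q3.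
move: w1 w2 => /isO_norm [M1 [r5 [M10 r50 _ b1]]] /isO_norm [M2 [r6 [M20 r60 _ b2]]].
exists ((K1 + K2) * (2 * M1 + M2)), (Num.min (Num.min (Num.min r1 r2) (Num.min r3 r4)) (Num.min r5 r6)); split.
  by rewrite lt_min rm lt_min r50.
move=> p p0; rewrite !lt_min => /andP[/andP[/andP[p1 p2] /andP[p3 p4]] /andP[p5 p6]].
have [_] := key _ _ _ _ (s1 p p0 p1) (s2 p p0 p2) (s3 p p0 p3) (s4 p p0 p4).
move/le_trans; apply; rewrite -[X in _ <= X]mulrA; apply: ler_wpM2l; first by rewrite addr_ge0.
rewrite [X in _ <= X]mulrDl; apply: lerD; last exact: b2.
by rewrite -[X in _ <= X]mulrA; apply: ler_wpM2l => //; apply: b1.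
Qed.

(** theta1 is quadratic at 0 and t has order d, so theta1 t has order 2 d. *)
Lemma close_pair_theta (th : R -> R) m k d (t1 t2 : R -> R) : (0 < d)%N ->
  class_C_near0 m.+2 th -> th =O_ (0 : R) (fun t => t ^+ 2) ->
  close_pair k d (fun p => cR (t1 p)) (fun p => cR (t2 p)) ->
  close_pair k d.+1 (fun p => cR (th (t1 p))) (fun p => cR (th (t2 p))).
Proof.
move=> dpos hth hO [q1 q2 q3]; have [th0 [dl [K [dl0 K0 hl]]]] := class_C2_lip_quadratic hth hO.
have q1' := q1; have q2' := q2; rewrite -(prednK dpos) in q1' q2'.
have dl2 : 0 < dl / 2 by rewrite divr_gt0.
have [r1 r10 s1] := isO_small q1' dl2; have [r2 r20 s2] := isO_small q2' dl2.
have single (t : R -> R) r : 0 < r -> isO d (fun p => cR (t p)) ->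
    (forall p : R, 0 < p -> p < r -> modC (cR (t p)) < dl / 2) -> isO d.+1 (fun p => cR (th (t p))).
  move=> r0 ot st; apply: (@isO_weak _ (d + d)); first by lia.
  apply: (@isO_dom _ _ (fun p => cR (t p) * cR (t p)) _ K r) (isO_M ot ot) => // p p0 pr.
  rewrite modCM !modC_cR.
  have := hl 0 (t p) `|t p|; rewrite normr0 th0 !subr0 mulrA; apply => //.
  by have := st p p0 pr; rewrite modC_cR; move: dl0; lra.
split; [exact: single s1|exact: single s2|].
have o12 : isO d (fun p => cR (`|t1 p| + `|t2 p|)).
  move: q1 q2 => /isO_norm [M1 [r5 [M10 r50 _ b1]]] /isO_norm [M2 [r6 [M20 r60 _ b2]]].
  exists (M1 + M2), (Num.min r5 r6); split; first by rewrite lt_min r50.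
  move=> p p0; rewrite lt_min => /andP[p5 p6]; rewrite modC_cR ger0_norm ?addr_ge0 // mulrDl.
  by apply: lerD; rewrite -modC_cR; [exact: b1|exact: b2].
have := isO_M o12 q3; have e : (d.+1 + k <= d + (d + k))%N by lia.
move/(isO_weak e); apply: (@isO_dom _ _ _ _ K (Num.min r1 r2)); first by rewrite lt_min r10.
move=> p p0; rewrite lt_min => /andP[p1 p2].
rewrite modCM -!cRB !modC_cR (ger0_norm (addr_ge0 (normr_ge0 _) (normr_ge0 _))) mulrA.
apply: hl; rewrite ?lerDl ?lerDr //.
by have := s1 p p0 p1; have := s2 p p0 p2; rewrite !modC_cR; lra.
Qed.

Definition Rest (d : nat) (r0 : nat -> nat -> C -> C) (r1 : nat -> nat -> nat -> C -> R -> C)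
    (theta1 : R -> R) (z : C) (t : R) : C :=
  \sum_(i < d.+2) z ^+ i * Num.conj z ^+ (d.+1 - i) * r0 i (d.+1 - i)%N z
  + \sum_(1 <= l < d) \sum_(i < (d - l).+1)
      z ^+ i * Num.conj z ^+ (d - l - i) * cR t ^+ l * r1 i (d - l - i)%N l z t
  + cR (theta1 t).

(** Each term is a monomial of weight at least d + 1 times a Lipschitz function. *)
Lemma close_pair_Rest d r0 r1 theta1 m k (z1 z2 : R -> C) (t1 t2 : R -> R) : (2 <= d)%N ->
  (forall i j, (i + j = d.+1)%N ->
     class_C_near0 m.+2 (fun x : R * R => complex.Re (r0 i j (ofR2 x))) /\
     class_C_near0 m.+2 (fun x : R * R => complex.Im (r0 i j (ofR2 x)))) ->
  (forall i j l, (1 <= l <= d.-1)%N -> (i + j = d - l)%N ->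
     class_C_near0 m.+2 (fun x : R * R * R => complex.Re (r1 i j l (ofR2 x.1) x.2)) /\
     class_C_near0 m.+2 (fun x : R * R * R => complex.Im (r1 i j l (ofR2 x.1) x.2))) ->
  class_C_near0 m.+2 theta1 -> theta1 =O_ (0 : R) (fun t => t ^+ 2) ->
  close_pair k 1 z1 z2 -> close_pair k d (fun p => cR (t1 p)) (fun p => cR (t2 p)) ->
  close_pair k d.+1 (fun p => Rest d r0 r1 theta1 (z1 p) (t1 p)) (fun p => Rest d r0 r1 theta1 (z2 p) (t2 p)).
Proof.
move=> d2 h0 h1 hth hO hz ht; have d0 : (0 < d)%N by lia.
rewrite /Rest; apply: close_pair_D; last exact: (close_pair_theta d0 hth hO ht).
have hX i j : close_pair k (i + j) (fun p => z1 p ^+ i * Num.conj (z1 p) ^+ j) (fun p => z2 p ^+ i * Num.conj (z2 p) ^+ j).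
  by have := close_pair_M (close_pair_X i hz) (close_pair_X j (close_pair_conj hz)); rewrite !mul1n.
apply: close_pair_D.
  pose T (i : nat) (z : R -> C) p := z p ^+ i * Num.conj (z p) ^+ (d.+1 - i) * r0 i (d.+1 - i)%N (z p).
  have : close_pair k d.+1 (fun p => \sum_(0 <= i < d.+2) T i z1 p) (fun p => \sum_(0 <= i < d.+2) T i z2 p).
    apply: close_pair_sum => i /andP[_ id]; have e : (i + (d.+1 - i) = d.+1)%N by lia.
    have [hr hi] := h0 i (d.+1 - i)%N e.
    by have := close_pair_M (hX i (d.+1 - i)%N) (close_pair_lip2 hr hi hz); rewrite addn0 e.
  by apply: close_pair_ext => p; rewrite big_mkord.
apply: close_pair_sum => l /andP[l1 ld].
pose T (i : nat) (z : R -> C) (t : R -> R) p :=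
  z p ^+ i * Num.conj (z p) ^+ (d - l - i) * cR (t p) ^+ l * r1 i (d - l - i)%N l (z p) (t p).
have : close_pair k d.+1 (fun p => \sum_(0 <= i < (d - l).+1) T i z1 t1 p) (fun p => \sum_(0 <= i < (d - l).+1) T i z2 t2 p).
  apply: close_pair_sum => i /andP[_ id]; have e : (i + (d - l - i) = d - l)%N by lia.
  have lb : (1 <= l <= d.-1)%N by lia.
  have [hr hi] := h1 i (d - l - i)%N l lb e.
  have := close_pair_M (close_pair_M (hX i (d - l - i)%N) (close_pair_X l ht)) (close_pair_lip3 d0 hr hi hz ht).
  by apply: close_pair_weak; rewrite e; nia.
by apply: close_pair_ext => p; rewrite big_mkord.
Qed.

End Remainder.

(** * From the hypersurface to its model *)

Section Rigidity.
Variable R : realType.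
Local Notation C := (CC R).
Local Notation C2 := (CC2 R).

(** The differential of P in the direction de is P_z de + conj (P_z de), since P
    is real. *)
Lemma leading_pair_pol d k0 alpha k (E1 E2 : R -> C) e de : (k0 < d)%N -> (0 < k)%N ->
  (d <= k0 + k0)%N ->
  (forall j, (d - k0 <= j <= k0)%N -> alpha j = Num.conj (alpha (d - j)%N)) ->
  leading_pair k 1 E1 E2 e de ->
  leading_pair k d (fun p => pol d k0 alpha (E1 p) (Num.conj (E1 p)))
    (fun p => pol d k0 alpha (E2 p) (Num.conj (E2 p)))
    (pol d k0 alpha e (Num.conj e))
    (pol_x d k0 alpha e (Num.conj e) * de + Num.conj (pol_x d k0 alpha e (Num.conj e) * de)).
Proof.
move=> kd kp hk hal h.
have key j : (d - k0 <= j < k0.+1)%N ->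
  leading_pair k d (fun p => alpha j * E1 p ^+ j * Num.conj (E1 p) ^+ (d - j))
    (fun p => alpha j * E2 p ^+ j * Num.conj (E2 p) ^+ (d - j))
    (alpha j * e ^+ j * Num.conj e ^+ (d - j))
    ((alpha j * (j%:R * e ^+ j.-1) * Num.conj e ^+ (d - j)) * de
     + (alpha j * e ^+ j * ((d - j)%:R * Num.conj e ^+ (d - j).-1)) * Num.conj de).
  move=> /andP[j1 j2].
  have := leading_pair_M kp (leading_pair_M kp (leading_pair_cst k (alpha j)) (leading_pair_X j kp h)) (leading_pair_X (d - j) kp (leading_pair_conj h)).
  rewrite add0n !mul1n subnKC; last by lia.
  set x := _ + _ * _; set y := _ + _ * _; suff -> : x = y by [].
  rewrite /x /y; ring.
split.
  by apply: leading_sum => j /key [].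
rewrite rmorphM /= conj_pol_x // /pol_x /pol_y !mulr_suml -big_split /=.
have := leading_sum (fun j jb => (key j jb).2).
by apply: (leading_ext ltr01) => p _ _; rewrite big_split /= sumrN.
Qed.

Variables (d k0 m0 : nat) (alpha : nat -> C) (r0 : nat -> nat -> C -> C)
  (r1 : nat -> nat -> nat -> C -> R -> C) (theta1 : R -> R).
Hypotheses (d2 : (2 <= d)%N) (hk : (d <= k0 + k0)%N) (kd : (k0 < d)%N).
Hypothesis hal : forall j, (d - k0 <= j <= k0)%N -> alpha j = Num.conj (alpha (d - j)%N).
Hypothesis al0 : alpha k0 != 0.
Hypothesis hr0 : forall i j, (i + j = d.+1)%N ->
     class_C_near0 m0.+2 (fun x : R * R => complex.Re (r0 i j (ofR2 x))) /\
     class_C_near0 m0.+2 (fun x : R * R => complex.Im (r0 i j (ofR2 x))).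
Hypothesis hr1 : forall i j l, (1 <= l <= d.-1)%N -> (i + j = d - l)%N ->
     class_C_near0 m0.+2 (fun x : R * R * R => complex.Re (r1 i j l (ofR2 x.1) x.2)) /\
     class_C_near0 m0.+2 (fun x : R * R * R => complex.Im (r1 i j l (ofR2 x.1) x.2)).
Hypotheses (hth : class_C_near0 m0.+2 theta1) (hO : theta1 =O_ (0 : R) (fun t => t ^+ 2)).

Let P z := pol d k0 alpha z (Num.conj z).
Let Rs := Rest d r0 r1 theta1.

Variables (M : set C2) (f g : C -> C -> C) (s dl K : R) (Phi Psi : nat -> nat -> C -> C -> C).
Hypotheses (s0 : 0 < s) (dl0 : 0 < dl) (hPhi : biseries s f Phi) (hPsi : biseries s g Psi).
Hypothesis fK : forall z w, modC z <= s -> modC w <= s ->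
  modC (f z w) <= K * (modC z + modC w) ^+ (3 * d).+1.
Hypothesis gK : forall z w, modC z <= s -> modC w <= s ->
  modC (g z w) <= K * (modC z + modC w) ^+ (3 * d).+1.
Let onM (z w : C) := exists r : R, (M (z, w) <-> r = 0) /\
  cR r = - cR (complex.Re w) + (P z + Rs z (complex.Im w)).
Hypothesis graphM : forall z w, modC z < dl -> modC w < dl ->
  onM z w /\ onM (z + f z w) (w + g z w).
Hypothesis FM : forall z w, modC z < dl -> modC w < dl -> M (z, w) -> M (z + f z w, w + g z w).

(** A point of M over (p z1, p^d t1) is (zc, wc), with wc read off the graph.
    Subtracting the equations of M at this point and at its image gives
    Re g = (P (zc + f) - P zc) + (difference of the remainders); the last term has
    order n + 1 and the coefficients of p^n are equal. *)
Lemma leading_identity n m : (n.+1 = m + d)%N -> (d < n)%N ->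
  (forall i j, (i + d * j < m)%N -> Phi i j 0 0 = 0) ->
  (forall i j, (i + d * j < n)%N -> Psi i j 0 0 = 0) ->
  forall (z1 : C) (t1 : R),
  let w1 := pol d k0 alpha z1 (Num.conj z1) + 'i * cR t1 in
  let F0 := wsum d (m %/ d).+1 m (fun j => Phi (m - d * j)%N j 0 0) z1 w1 in
  let G0 := wsum d (n %/ d).+1 n (fun j => Psi (n - d * j)%N j 0 0) z1 w1 in
  let X := pol_x d k0 alpha z1 (Num.conj z1) * F0 in
  G0 + Num.conj G0 = 2 * (X + Num.conj X).
Proof.
move=> mn dn hf hg z1 t1 w1 F0 G0 X.
have d0 : (0 < d)%N by lia.
pose k := (n - d)%N; have k0' : (0 < k)%N by rewrite /k; lia.
have mk : m = k.+1 by rewrite /k; lia.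
have nk : n = (d + k)%N by rewrite /k; lia.
pose zc (p : R) : C := cR p ^+ 1 * z1.
pose tc (p : R) : R := p ^+ d * t1.
pose Y p := P (zc p) + Rs (zc p) (tc p).
pose wc p : C := cR (complex.Re (Y p)) + 'i * cR (tc p).
have hz : leading 1 zc z1 by exact: leading_rho.
have htc : leading d (fun p => cR (tc p)) (cR t1).
  by apply: (leading_ext ltr01 _ (leading_rho d (cR t1))) => p _ _; rewrite /tc cRM cRX.
have h00 : close_pair 0 1 (fun _ => 0) zc.
  split; [exact: isO_0|exact: leading_isO hz|].
  by apply: (isO_ext ltr01 _ (leading_isO hz)) => p _ _; rewrite subr0.
have h0t : close_pair 0 d (fun _ => cR 0) (fun p => cR (tc p)).
  split; [exact: isO_0|exact: leading_isO htc|].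
  by rewrite addn0; apply: (isO_ext ltr01 _ (leading_isO htc)) => p _ _; rewrite subr0.
have [_ oRs _] := close_pair_Rest d2 hr0 hr1 hth hO h00 h0t.
have hDLz : leading_pair k 1 zc zc z1 0.
  split=> //; apply: leading_isO0.
  by apply: (isO_ext ltr01 _ (isO_0 _ _)) => p _ _; rewrite subrr.
have [hP _] := leading_pair_pol kd k0' hk hal hDLz.
have hY : leading d Y (pol d k0 alpha z1 (Num.conj z1)).
  by have := leading_D hP (leading_isO0 oRs); rewrite addr0.
have ePz : cR (complex.Re (pol d k0 alpha z1 (Num.conj z1))) = pol d k0 alpha z1 (Num.conj z1).
  by rewrite cRReE conj_pol // -[X in X + _]mulr1 -[X in _ + X]mulr1 -mulrDr mulfK // pnatr_eq0.
have hw : leading d wc w1.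
  have := leading_D (leading_Re hY) (leading_Z 'i htc); rewrite ePz.
  exact.
have hF := leading_series s0 d0 hPhi hf hz hw; rewrite -/F0 in hF.
have hG := leading_series s0 d0 hPsi hg hz hw; rewrite -/G0 in hG.
pose z2 p := zc p + f (zc p) (wc p).
pose t2 p := tc p + complex.Im (g (zc p) (wc p)).
have hz2 : leading_pair k 1 zc z2 z1 F0.
  split=> //; rewrite add1n -mk; apply: (leading_ext ltr01 _ hF) => p _ _.
  by rewrite /z2 addrC addKr.
have [_ hPd] := leading_pair_pol kd k0' hk hal hz2; rewrite -nk -/X in hPd.
have Dz2 : close_pair k 1 zc z2.
  have [a b] := hz2; have b' := leading_isO b; split => //; first exact: leading_isO a.
  have b1 : isO 1 (fun p => z2 p - zc p) by apply: isO_weak b'; lia.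
  by apply: (isO_ext ltr01 _ (isO_D (leading_isO a) b1)) => p _ _; ring.
have Dt2 : close_pair k d (fun p => cR (tc p)) (fun p => cR (t2 p)).
  have b := isO_Im (leading_isO hG); rewrite nk in b.
  split; first exact: leading_isO htc.
    have b1 := isO_weak (leq_addr k d) b.
    by apply: (isO_ext ltr01 _ (isO_D (leading_isO htc) b1)) => p _ _; rewrite /t2 cRD.
  by apply: (isO_ext ltr01 _ b) => p _ _; rewrite /t2 cRD addrC addKr.
have [_ _ hRd] := close_pair_Rest d2 hr0 hr1 hth hO Dz2 Dt2; rewrite addSn -nk in hRd.
have [e1 e10 sz] := isO_small (leading_isO hz) dl0.
have [e2 e20 sw] : exists2 r : R, 0 < r & forall p : R, 0 < p -> p < r -> modC (wc p) < dl.
  by apply: (@isO_small _ d.-1) dl0; rewrite prednK //; exact: leading_isO hw.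
have hsum := leading_D hPd (leading_isO0 hRd); rewrite addr0 in hsum.
have hRe : leading n (fun p => cR (complex.Re (g (zc p) (wc p)))) (X + Num.conj X).
  apply: (leading_ext (r := Num.min e1 e2) _ _ hsum); first by rewrite lt_min e10.
  move=> p p0; rewrite lt_min => /andP[p1 p2].
  have zs := sz p p0 p1; have ws := sw p p0 p2.
  have [[ra [Ma Ea]] [rb [Mb Eb]]] := graphM zs ws.
  have Rew : complex.Re (wc p) = complex.Re (Y p).
    by rewrite /wc Re_D Re_M -complexiE /= mul0r mulr0 subrr addr0.
  have Imw : complex.Im (wc p) = tc p.
    by rewrite /wc Im_D Im_M -complexiE /= mul0r mul1r add0r add0r.
  have ra0 : ra = 0.
    have := congr1 (@complex.Re R) Ea; rewrite Imw Rew -/(Y p) Re_D Re_N /= => ->.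
    by rewrite addNr.
  have rb0 : rb = 0 by apply/Mb; apply: FM => //; apply/Ma.
  have t2E : complex.Im (wc p + g (zc p) (wc p)) = t2 p by rewrite Im_D Imw.
  move: Ea Eb; rewrite ra0 rb0 Imw t2E -/(z2 p) cR0 (Re_D (wc p) (g (zc p) (wc p))) (cRD (complex.Re (wc p))) => /esym/eqP.
  rewrite addrC subr_eq0 => /eqP Ea /esym/eqP; rewrite addrC subr_eq0 => /eqP Eb.
  rewrite (_ : cR (complex.Re (g (zc p) (wc p))) = (P (z2 p) + Rs (z2 p) (t2 p)) - (P (zc p) + Rs (zc p) (tc p))).
    by rewrite /P /Rs; ring.
  by rewrite Ea Eb; ring.
have := leading_uniq (leading_Re hG) hRe; rewrite cRReE => <-.
by rewrite mulrC divfK // pnatr_eq0.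
Qed.

(** Otherwise a coefficient of least weight n exists, and the leading parts of
    weight n contradict [model_rigid]. *)
Lemma no_leading : (forall i j, Phi i j 0 0 = 0) /\ (forall i j, Psi i j 0 0 = 0).
Proof.
have d0 : (0 < d)%N by lia.
have lowf := low_coefs s0 d0 hPhi fK; have lowg := low_coefs s0 d0 hPsi gK.
pose Q n := exists i j, ((i + d * j + d)%N = n.+1 /\ Phi i j 0 0 != 0) \/
   ((i + d * j)%N = n /\ Psi i j 0 0 != 0).
have noQ n : ~ Q n.
  elim/ltn_ind: n => n ih Qn.
  have n3 : (3 * d < n)%N.
    case: Qn => i [j [[e nz]|[e nz]]].
      have [lt|ge] := ltnP (i + d * j) (3 * d).+1; last by lia.
      by move: nz; rewrite (lowf _ lt i j erefl) eqxx.
    have [lt|ge] := ltnP (i + d * j) (3 * d).+1; last by lia.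
    by move: nz; rewrite (lowg _ lt i j erefl) eqxx.
  pose m := (n.+1 - d)%N.
  have mn : (n.+1 = m + d)%N by rewrite /m; lia.
  have dn : (d < n)%N by lia.
  have hf i j : (i + d * j < m)%N -> Phi i j 0 0 = 0.
    move=> lt; apply/eqP; apply: contrapT => /negP nz.
    by apply: (ih (i + d * j + d).-1); [lia | exists i, j; left; split => //; lia].
  have hg i j : (i + d * j < n)%N -> Psi i j 0 0 = 0.
    move=> lt; apply/eqP; apply: contrapT => /negP nz.
    by apply: (ih (i + d * j)%N) => //; exists i, j; right.
  have [A0 B0] := model_rigid hk kd hal mn (ltnW n3) (leading_identity mn dn hf hg) al0.
  case: Qn => i [j [[e nz]|[e nz]]].
    have := A0 j; rewrite (_ : m - d * j = i)%N; last by lia.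
    rewrite ltnS leq_divRL // => H; case/eqP: nz; apply: H; rewrite mulnC; lia.
  have := B0 j; rewrite (_ : n - d * j = i)%N; last by lia.
  rewrite ltnS leq_divRL // => H; case/eqP: nz; apply: H; rewrite mulnC; lia.
split=> i j; apply/eqP; apply: contrapT => /negP nz.
  by apply: (noQ (i + d * j + d).-1); exists i, j; left; split => //; lia.
by apply: (noQ (i + d * j)%N); exists i, j; right.
Qed.

End Rigidity.

(** * The transition map *)

Section Final.
Variable R : realType.
Local Notation C := (CC R).
Local Notation C2 := (CC2 R).

Lemma biseries_near (f : C2 -> C2) (p : C2) : (\forall q \near p, differentiable f q) ->
  exists s0 : R, 0 < s0 /\ forall s : R, 0 < s -> s <= s0 ->
    exists P Q, biseries s (coord1 p f) P /\ biseries s (coord2 p f) Q.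
Proof.
move=> /diff_near_sep_holo [s [B [s0 h1 h2]]]; exists (s / 2); split; first by rewrite divr_gt0.
move=> t t0 ts; have t20 : 0 < 2 * t by rewrite mulr_gt0.
have t2s : 2 * t <= s by move: ts; lra.
have [P hP] := biseries_exists t20 (sep_holo_le t2s h1).
have [Q hQ] := biseries_exists t20 (sep_holo_le t2s h2).
by exists P, Q; rewrite (_ : t = 2 * t / 2) //; field.
Qed.

(** Only monomials of degree at least l + 1 are left in the difference of the
    Taylor polynomials. *)
Lemma jets_close (s : R) f g P Q l : 0 < s -> biseries s f P -> biseries s g Q ->
  (forall a b, (a + b <= l)%N -> P a b 0 0 = Q a b 0 0) ->
  exists K r : R, [/\ 0 <= K, 0 < r, r <= s & forall z w, modC z <= r -> modC w <= r ->
    modC (f z w - g z w) <= K * (modC z + modC w) ^+ l.+1].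
Proof.
move=> s0 hP hQ hj; have [K1 k1] := bs_taylor hP; have [K2 k2] := bs_taylor hQ.
pose N := l.+1.
pose c a b := P a b 0 0 - Q a b 0 0.
pose K3 := \sum_(0 <= a < N) \sum_(0 <= b < N) modC (c a b).
have K30 : 0 <= K3 by apply: sumr_ge0 => a _; apply: sumr_ge0 => b _; exact: modC_ge0.
pose u := (2 * s)^-1 ^+ N.
have u0 : 0 <= u by rewrite exprn_ge0 // invr_ge0 mulr_ge0 // ltW.
exists ((`|K1| + `|K2|) * (u * 2) + K3), (Num.min s 2^-1); split.
- by rewrite addr_ge0 // mulr_ge0 ?addr_ge0 // mulr_ge0.
- by rewrite lt_min s0; lra.
- by rewrite ge_min lexx.
move=> z w; rewrite !le_min => /andP[zs z2] /andP[ws w2].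
set S := modC z + modC w; have z0 := modC_ge0 z; have w0 := modC_ge0 w.
have S1 : S <= 1 by rewrite /S; move: z2 w2; lra.
have S0 : 0 <= S by rewrite addr_ge0.
have hrem (K : R) : K * ((modC z / (2 * s)) ^+ N + (modC w / (2 * s)) ^+ N) <= `|K| * (u * 2) * S ^+ N.
  apply: (@le_trans _ _ (`|K| * ((modC z / (2 * s)) ^+ N + (modC w / (2 * s)) ^+ N))).
    apply: ler_wpM2r; last exact: ler_norm.
    by rewrite addr_ge0 // exprn_ge0 // divr_ge0 // mulr_ge0 // ltW.
  rewrite -[X in _ <= X]mulrA; apply: ler_wpM2l => //.
  rewrite !exprMn -/u -mulrDl mulrC -[X in _ <= X]mulrA; apply: ler_wpM2l => //.
  rewrite mulr_natl mulr2n; apply: lerD; rewrite lerXn2r ?nnegrE //.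
    by rewrite /S lerDl.
  by rewrite /S lerDr.
rewrite (_ : f z w - g z w =
  (f z w - \sum_(0 <= a < N) z ^+ a * \sum_(0 <= b < N) w ^+ b * P a b 0 0)
  - (g z w - \sum_(0 <= a < N) z ^+ a * \sum_(0 <= b < N) w ^+ b * Q a b 0 0)
  + \sum_(0 <= a < N) \sum_(0 <= b < N) c a b * (z ^+ a * w ^+ b)); last first.
  have -> : \sum_(0 <= a < N) \sum_(0 <= b < N) c a b * (z ^+ a * w ^+ b) =
    \sum_(0 <= a < N) z ^+ a * (\sum_(0 <= b < N) w ^+ b * P a b 0 0)
    - \sum_(0 <= a < N) z ^+ a * (\sum_(0 <= b < N) w ^+ b * Q a b 0 0).
    rewrite -sumrB; apply: eq_bigr => a _; rewrite -mulrBr -sumrB mulr_sumr.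
    by apply: eq_bigr => b _; rewrite /c; ring.
  by ring.
apply: (le_trans (modCD _ _)); rewrite mulrDl; apply: lerD.
  apply: (le_trans (modCB _ _)); rewrite mulrDl mulrDl; apply: lerD.
    exact: le_trans (k1 N z w zs ws) (hrem K1).
  exact: le_trans (k2 N z w zs ws) (hrem K2).
apply: (le_trans (modC_sum _ _ _)); rewrite mulr_suml; apply: ler_sum => a _.
apply: (le_trans (modC_sum _ _ _)); rewrite mulr_suml; apply: ler_sum => b _.
have [ab|ab] := leqP (a + b) l.
  by rewrite /c hj // subrr mul0r modC0 mul0r.
rewrite modCM; apply: ler_wpM2l; first exact: modC_ge0.
rewrite modCM !modCX; apply: (@le_trans _ _ (S ^+ a * S ^+ b)).
  by apply: ler_pM; rewrite ?exprn_ge0 // lerXn2r ?nnegrE // /S ?lerDl ?lerDr.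
by rewrite -exprD ler_wiXn2l.
Qed.

(** F is the inverse G1 of H1 composed with H2; the last estimate holds because
    G1 is Lipschitz and F - id = G1 o H2 - G1 o H1. *)
Lemma transition_map (M M' : set C2) (H1 H2 : C2 -> C2) l :
  biholomorphism_germ 0 M M' H1 -> biholomorphism_germ 0 M M' H2 -> same_jet l 0 H1 H2 ->
  exists F : C2 -> C2, [/\ \forall q \near (0 : C2), differentiable F q,
    \forall q \near (0 : C2), M q -> M (F q),
    \forall q \near (0 : C2), F q = q -> H1 q = H2 q,
    F 0 = 0 &
    exists K r : R, 0 < r /\ forall z w : C, modC z <= r -> modC w <= r ->
      modC ((F (z, w)).1 - z) <= K * (modC z + modC w) ^+ l.+1 /\
      modC ((F (z, w)).2 - w) <= K * (modC z + modC w) ^+ l.+1].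
Proof.
move=> [U1 [G1 [U10 [U1o d1] [V1o dG1] GH1 im1]]] [U2 [G2 [U20 [U2o d2] _ _ im2]]] hj.
have e0 : H1 0 = H2 0 by exact: (hj 0%N 0%N).
have nU1 : \forall q \near (0 : C2), U1 q by exact: open_nbhs_nbhs.
have nU2 : \forall q \near (0 : C2), U2 q by exact: open_nbhs_nbhs.
have c1 : H1 x @[x --> (0 : C2)] --> H1 0 by exact: differentiable_continuous (d1 _ U10).
have c2 : H2 x @[x --> (0 : C2)] --> H2 0 by exact: differentiable_continuous (d2 _ U20).
have V1n : \forall q \near H1 0, (H1 @` U1) q.
  by apply: open_nbhs_nbhs; split => //; exists 0.
have nV : \forall q \near (0 : C2), (H1 @` U1) (H2 q).
  by apply: c2; rewrite -e0.
exists (G1 \o H2); split.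
- apply: filterS2 nU2 nV => q q2 qV.
  by apply: differentiable_comp; [exact: d2|exact: dG1].
- apply: filterS2 nU2 nV => q q2 qV Mq.
  have : (M' `&` (H2 @` U2)) (H2 q) by rewrite -im2; exists q.
  move=> [M'q _]; have : (H1 @` (M `&` U1)) (H2 q) by rewrite im1.
  by move=> [y [My U1y] yE]; rewrite /= -yE GH1.
- apply: filterS nV => q [y U1y yE] Fq; rewrite -yE; congr H1.
  by rewrite -Fq /= -yE GH1.
- by rewrite /= -e0 GH1.
have n1 : \forall q \near (0 : C2), differentiable H1 q by apply: filterS nU1 => q; exact: d1.
have n2 : \forall q \near (0 : C2), differentiable H2 q by apply: filterS nU2 => q; exact: d2.
have n3 : \forall q \near H1 0, differentiable G1 q by apply: filterS V1n => q; exact: dG1.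
have [s1 [s10 b1]] := biseries_near n1; have [s2 [s20 b2]] := biseries_near n2.
have [s3 [s30 b3]] := biseries_near n3.
pose s := Num.min s1 s2; have s0 : 0 < s by rewrite lt_min s10.
have ss1 : s <= s1 by rewrite ge_min lexx.
have ss2 : s <= s2 by rewrite ge_min lexx orbT.
have [P1 [P2 [hP1 hP2]]] := b1 s s0 ss1.
have [Q1 [Q2 [hQ1 hQ2]]] := b2 s s0 ss2.
have [T1 [T2 [hT1 hT2]]] := b3 s3 s30 (lexx _).
have jc := same_jet_coef s0 hP1 hP2 hQ1 hQ2 hj.
have [K1 [r1 [K10 r10 r1s k1]]] := jets_close s0 hQ1 hP1 (fun a b ab => esym (jc a b ab).1).
have [K2 [r2 [K20 r20 r2s k2]]] := jets_close s0 hQ2 hP2 (fun a b ab => esym (jc a b ab).2).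
have [L1 L10 l1] := biseries_lip s30 hT1; have [L2 L20 l2] := biseries_lip s30 hT2.
have cs3 : (0 : C) < cR s3 by rewrite lt_cR.
have near1 : \forall q \near (0 : C2), `|H1 q - H1 0| < cR s3.
  by have /cvgrPdistC_lt := c1; apply.
have near2 : \forall q \near (0 : C2), `|H2 q - H1 0| < cR s3.
  by rewrite e0; have /cvgrPdistC_lt := c2; apply.
have [r3 r30 hr] := (nbhs2P _ _).1 (filterI nU1 (filterI near1 near2)).
exists ((L1 + L2) * (K1 + K2)), (Num.min (Num.min r1 r2) (r3 / 2)); split.
  by rewrite !lt_min r10 r20 divr_gt0.
move=> z w; rewrite !le_min => /andP[/andP[z1 z2] z3] /andP[/andP[w1 w2] w3].
have z3' : modC z < r3 by move: z3 r30; lra.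
have w3' : modC w < r3 by move: w3 r30; lra.
have := hr z w z3' w3'; rewrite add0r => -[q1 [h1 h2]].
move: h1 h2; rewrite !norm2_lt => /andP[h11 h12] /andP[h21 h22].
set S := (modC z + modC w) ^+ l.+1.
have S0 : 0 <= S by rewrite exprn_ge0 // addr_ge0 // modC_ge0.
have a1 := k1 z w z1 w1; have a2 := k2 z w z2 w2.
rewrite /coord1 /coord2 !add0r -/S in a1 a2.
have pE (q : C2) : H1 0 + ((q - H1 0).1, (q - H1 0).2) = q.
  by rewrite -surjective_pairing addrC subrK.
have D1 : (H2 (z, w) - H1 0).1 - (H1 (z, w) - H1 0).1 = (H2 (z, w)).1 - (H1 (z, w)).1.
  by change ((H2 (z, w)).1 - (H1 0).1 - ((H1 (z, w)).1 - (H1 0).1) = (H2 (z, w)).1 - (H1 (z, w)).1); ring.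
have D2 : (H2 (z, w) - H1 0).2 - (H1 (z, w) - H1 0).2 = (H2 (z, w)).2 - (H1 (z, w)).2.
  by change ((H2 (z, w)).2 - (H1 0).2 - ((H1 (z, w)).2 - (H1 0).2) = (H2 (z, w)).2 - (H1 (z, w)).2); ring.
have g1 := l1 _ _ _ _ (ltW h21) (ltW h22) (ltW h11) (ltW h12).
have g2 := l2 _ _ _ _ (ltW h21) (ltW h22) (ltW h11) (ltW h12).
rewrite /coord1 /coord2 !pE D1 D2 GH1 //= in g1 g2.
have tot : modC ((H2 (z, w)).1 - (H1 (z, w)).1) + modC ((H2 (z, w)).2 - (H1 (z, w)).2) <= (K1 + K2) * S.
  by rewrite mulrDl lerD.
have KS0 : 0 <= (K1 + K2) * S by rewrite mulr_ge0 // addr_ge0.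
split.
  apply: (le_trans g1); rewrite -mulrA; apply: ler_pM => //; rewrite ?addr_ge0 ?modC_ge0 //.
  by rewrite lerDl.
apply: (le_trans g2); rewrite -mulrA; apply: ler_pM => //; rewrite ?addr_ge0 ?modC_ge0 //.
by rewrite lerDr.
Qed.

End Final.

Theorem theorem1p2 (d k0 : nat) (hdk : admissible_pair d k0) :
  exists l : nat,
  forall (R : realType) (M M' : set (CC2 R)),
    real_hypersurface (d./2 + k0 + 5) M ->
    M 0 ->
    pseudoconvex M ->
    dangelo_type M 0 (d%:R%:E)%E ->
    admissible_form d k0 M ->
    real_hypersurface 1 M' ->
    forall H1 H2 : CC2 R -> CC2 R,
      biholomorphism_germ 0 M M' H1 ->
      biholomorphism_germ 0 M M' H2 ->
      same_jet l 0 H1 H2 ->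
      \forall q \near (0 : CC2 R), H1 q = H2 q.
Proof.
(* all weights up to 3 d are then excluded, as F - id = O(r^(3 d + 1)) *)
exists (3 * d)%N => R M M' _ M0 _ _ hform _ H1 H2 hH1 hH2 hj.
have [F [dF MF FH F0 [K [r [r0 hK]]]]] := transition_map hH1 hH2 hj.
case: hdk => dodd /andP[dk kd].
have d2 : (2 <= d)%N by lia.
have hk : (d <= k0 + k0)%N by lia.
case: hform => U [rho [alpha [R0 [R1 [th [[U0 [Uo _ Urho _]] [hal al0 _ _] [h0 h1 hth hO] hE]]]]]].
have [m0 m0E] : exists m0, (k0 - d./2 + 5 = m0.+2)%N by exists (k0 - d./2 + 3)%N; lia.
rewrite m0E in h0 h1 hth.
pose F' (q : CC2 R) := F q - q.
have dF' : \forall q \near (0 : CC2 R), differentiable F' q.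
  by apply: filterS dF => q dq; apply: differentiableB.
have [s' [s'0 bs]] := biseries_near dF'.
pose s := Num.min s' r; have s0 : 0 < s by rewrite lt_min s'0.
have ss' : s <= s' by rewrite ge_min lexx.
have [P [Q [hP hQ]]] := bs s s0 ss'.
have fE z w : coord1 0 F' z w = (F (z, w)).1 - z by rewrite /coord1 add0r.
have gE z w : coord2 0 F' z w = (F (z, w)).2 - w by rewrite /coord2 add0r.
have nU : \forall q \near (0 : CC2 R), U q by exact: open_nbhs_nbhs.
have nUF : \forall q \near (0 : CC2 R), U (F q).
  have cF : F x @[x --> (0 : CC2 R)] --> F 0.
    by apply: differentiable_continuous; exact: nbhs_singleton dF.
  by apply: cF; rewrite F0.
have [dl dl0 hdl] := (nbhs2P _ _).1 (filterI MF (filterI nU nUF)).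
have FzE z w : F (z, w) = (z + coord1 0 F' z w, w + coord2 0 F' z w).
  by rewrite fE gE [LHS]surjective_pairing; congr (_, _); rewrite addrC subrK.
have onM z w : U (z, w) -> exists r : R, (M (z, w) <-> r = 0) /\
  cR r = - cR (complex.Re w) + (pol d k0 alpha z (Num.conj z) + Rest d R0 R1 th z (complex.Im w)).
  move=> Uzw; exists (rho (z, w)); split; first exact: Urho.
  by rewrite hE // /Rest /admissible_poly /pol !addrA.
have bound z w : modC z <= s -> modC w <= s ->
   modC (coord1 0 F' z w) <= K * (modC z + modC w) ^+ (3 * d).+1 /\
   modC (coord2 0 F' z w) <= K * (modC z + modC w) ^+ (3 * d).+1.
  by rewrite !le_min fE gE => /andP[_ zr] /andP[_ wr]; exact: hK.
have [cP cQ] : (forall i j, P i j 0 0 = 0) /\ (forall i j, Q i j 0 0 = 0).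
  apply: (@no_leading R d k0 m0 alpha R0 R1 th d2 hk kd hal al0 h0 h1 hth hO M
    (coord1 0 F') (coord2 0 F') s dl K P Q s0 dl0 hP hQ).
  - by move=> z w zs ws; have [] := bound z w zs ws.
  - by move=> z w zs ws; have [] := bound z w zs ws.
  - move=> z w zd wd; have [_ [Uq UFq]] := hdl z w zd wd.
    rewrite add0r in Uq UFq; split; first exact: onM.
    by apply: onM; rewrite -FzE.
  - move=> z w zd wd; have [Mq _] := hdl z w zd wd.
    by rewrite add0r in Mq; rewrite -FzE.
have Fid : \forall q \near (0 : CC2 R), F q = q.
  apply/nbhs2P; exists s => // z w zs ws; rewrite add0r FzE.
  by rewrite (biseries_flat s0 hP cP (ltW zs) (ltW ws)) (biseries_flat s0 hQ cQ (ltW zs) (ltW ws)) !addr0.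
by apply: filterS2 FH Fid => q; apply.
Qed.
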